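(* Let $k\geq1$ and $\ell\geq0$ be two integers, and let $p_1<p_2$, $a<b$ be finite real numbers. Suppose that $u_0\in H^3(\mathbb{R})$ is such that $\widehat{u_0}$ is a $\mathcal{C}^\ell$-function on $\mathbb{R}$ with $\mathrm{supp}\,\widehat{u_0}\subseteq[p_1,p_2]$, and that $V\in L^2(\mathbb{R})$ is such that $\widehat V$ is a $\mathcal{C}^k$-function on $\mathbb{R}$ with $\mathrm{supp}\,\widehat V\subseteq[a,b]$. For $t\geq0$ let $W(t,\cdot):\mathbb{R}\to\mathbb{C}$ be the function defined by $$W(t,p)=-i\int_0^t\widetilde W(\tau,p)\,e^{i\tau p^2}\,d\tau,$$ where $\widetilde W:[0,t]\times\mathbb{R}\to\mathbb{C}$ is defined by $$\widetilde W(\tau,p)=\Big(\widehat V*\big(e^{-i\tau\,\cdot^2}\,\widehat{u_0}(\cdot)\big)\Big)(p)=\int_a^b\widehat V(y)\,\widehat{u_0}(p-y)\,e^{-i\tau(p-y)^2}\,dy .$$ Then the support of $W(t,\cdot)$ is contained in $[p_1+a,p_2+b]$ for all $t\geq0$, and $$\forall\,(t,x)\in[0,+\infty)\times\mathbb{R}\qquad \big(S_2(t)u_0\big)(x)=\frac{1}{2\pi}\int_{\mathbb{R}}W(t,p)\,e^{-itp^2+ixp}\,dp .$$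
   Context: Fourier transform convention: $\widehat f(p)=\int_{\mathbb{R}}f(x)e^{-ixp}dx$ (extended to $L^2(\mathbb{R})$), with inverse $\mathcal{F}^{-1}$. Dyson-Phillips terms for $i\partial_tu=-\partial_{xx}u+Vu$: for $t\geq0$, $S_1(t)f=\mathcal{F}^{-1}\big(e^{-itp^2}\widehat f(p)\big)$ and $$S_2(t)f=\int_0^tS_1(t-\tau)\,B_V\,S_1(\tau)f\,d\tau,\qquad (B_Vg)(x)=-iV(x)g(x),$$ the integral being a Bochner integral in $H^1(\mathbb{R})$ (under the hypotheses $V\in W^{1,\infty}(\mathbb{R})$, so $B_V$ is bounded on $H^1(\mathbb{R})$). $(S_2(t)u_0)(x)$ is the value at $x$ of the continuous representative.
   Formalization: The factor 1/(2π) in the last formula is replaced by 1/(2π)²: with the stated Fourier convention and the unnormalised convolution defining W̃, the printed formula is off by a factor 2π. *)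

(* Defs.v *)
From HB Require Import structures.
From mathcomp Require Import all_boot all_order all_algebra.
From mathcomp Require Import all_classical all_reals all_analysis.
From mathcomp Require Import complex.

Set Implicit Arguments.
Unset Strict Implicit.
Unset Printing Implicit Defensive.

Import Order.TTheory GRing.Theory Num.Theory.
Import numFieldNormedType.Exports.
Local Open Scope classical_set_scope.
Local Open Scope ring_scope.
Local Open Scope complex_scope.

(* Elements of L^2(R) and H^s(R) are represented by functions R -> R[i];
   the operators below are defined on functions, are invariant under a.e.
   equality, and return some representative of their value. *)

Section ComplexValued.
Context {R : realType}.
Implicit Types (f g V : R -> R[i]) (t x p : R).

Local Notation mu := (@lebesgue_measure R).
Local Notation cRe := (@complex.Re R).
Local Notation cIm := (@complex.Im R).

Definition expi (theta : R) : R[i] := cos theta +i* sin theta.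

Definition cintegral (D : set R) f : R[i] :=
  Rintegral mu D (cRe \o f) +i* Rintegral mu D (cIm \o f).

Definition cLp (q : \bar R) f : Prop :=
  cRe \o f \in Lfun mu q /\ cIm \o f \in Lfun mu q.

Definition L2norm f : \bar R := Lnorm mu 2%:E (fun x => (Normc.normc (f x))%:E).

Definition Cn (n : nat) f : Prop :=
  forall h : R -> R, h = cRe \o f \/ h = cIm \o f ->
    (forall j, (j < n)%N -> forall x, derivable (derive1n j h) x 1) /\
    continuous (derive1n n h).

Definition supp f : set R := closure [set x | f x != 0].

Definition convolution f g (p : R) : R[i] :=
  cintegral setT (fun y => f y * g (p - y)).

Definition continuous_representative f : R -> R[i] :=
  xget (fun=> 0) [set g | Cn 0 g /\ ae_eq mu setT f g].

End ComplexValued.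

Section Fourier.
Context {R : realType}.
Implicit Types (f g : R -> R[i]).

Local Notation mu := (@lebesgue_measure R).

Definition fourierL1 f (p : R) : R[i] :=
  cintegral setT (fun x => f x * expi (- (x * p))).

(* [g] represents the L^2 Fourier transform of [f]: extension of [fourierL1]
   by continuity from the dense subspace L^1 `&` L^2 of L^2. *)
Definition is_fourier f g : Prop :=
  [/\ cLp 2%:E f, cLp 2%:E g &
    exists f_ : nat -> R -> R[i],
      [/\ forall n, cLp 1%:E (f_ n) /\ cLp 2%:E (f_ n),
          L2norm (fun x => f_ n x - f x) @[n --> \oo] --> 0%E &
          L2norm (fun p => fourierL1 (f_ n) p - g p) @[n --> \oo] --> 0%E]].

Definition fourier f : R -> R[i] := xget (fun=> 0) [set g | is_fourier f g].

Definition inv_fourier g : R -> R[i] :=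
  xget (fun=> 0) [set f | is_fourier f g].

(* The factor 1/(2 pi) is Plancherel's constant, so that the H^0 norm is the
   L^2 norm. [sobolev_norm s f] is only meaningful when [f] is in L^2. *)
Definition sobolev_norm (s : nat) f : \bar R :=
  ((((2 * pi)^-1)%:E *
    \int[mu]_p ((1 + p ^+ 2) ^+ s * Normc.normc (fourier f p) ^+ 2)%:E)
      `^ 2^-1)%E.

Definition sobolev (s : nat) f : Prop :=
  cLp 2%:E f /\ (sobolev_norm s f < +oo)%E.

End Fourier.

Section BochnerH1.
Context {R : realType}.

Local Notation mu := (@lebesgue_measure R).

(* tau |-> \sum_i 1_{A_i}(tau) c_i, the A_i not being required disjoint *)
Record simpleH1 := SimpleH1 {
  simple_size : nat ;
  simple_set : 'I_simple_size -> set R ;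
  simple_coef : 'I_simple_size -> R -> R[i] }.

Definition simple_on (D : set R) (s : simpleH1) : Prop :=
  forall i, [/\ measurable (simple_set (s := s) i),
                simple_set (s := s) i `<=` D &
                sobolev 1 (simple_coef (s := s) i)].

Definition simple_val (s : simpleH1) (tau x : R) : R[i] :=
  \sum_i (\1_(simple_set (s := s) i) tau)%:C * simple_coef (s := s) i x.

Definition simple_int (s : simpleH1) (x : R) : R[i] :=
  \sum_i (fine (mu (simple_set (s := s) i)))%:C * simple_coef (s := s) i x.

Definition simple_error (F : R -> R -> R[i]) (s : simpleH1) (tau : R) :
    \bar R :=
  sobolev_norm 1 (fun x => F tau x - simple_val s tau x).

(* [F] is strongly measurable and Bochner integrable on [0, t], as an
   H^1-valued map, with integral [G] *)
Definition is_bochnerH1 (t : R) (F : R -> R -> R[i]) (G : R -> R[i]) : Prop :=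
  [/\ forall tau, tau \in `[0, t] -> sobolev 1 (F tau),
      sobolev 1 G &
      exists s : nat -> simpleH1,
        [/\ forall n, simple_on `[0, t] (s n),
            {ae mu, forall tau, tau \in `[0, t] ->
              simple_error F (s n) tau @[n --> \oo] --> 0%E},
            (\int[mu]_(tau in `[0%R, t]) simple_error F (s n) tau)%E
                @[n --> \oo] --> 0%E &
            sobolev_norm 1 (fun x => simple_int (s n) x - G x)
                @[n --> \oo] --> 0%E]].

Definition bochnerH1 (t : R) (F : R -> R -> R[i]) : R -> R[i] :=
  xget (fun=> 0) [set G | is_bochnerH1 t F G].

End BochnerH1.

Section DysonPhillips.
Context {R : realType}.
Implicit Types (f g V uhat Vhat : R -> R[i]) (t tau x p : R).

Definition S1 t f : R -> R[i] :=
  inv_fourier (fun p => expi (- (t * p ^+ 2)) * fourier f p).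

Definition B V g : R -> R[i] := fun x => - (0 +i* 1) * V x * g x.

Definition S2 V t f : R -> R[i] :=
  bochnerH1 t (fun tau => S1 (t - tau) (B V (S1 tau f))).

(* With the normalization of [fourierL1],
     fourier (V g) = (2 pi)^-1 * convolution (fourier V) (fourier g),
   while [Wtilde] is the bare convolution. The factor (2 pi)^-1 thus lost adds
   to the one of the inversion formula: W carries the constant (2 pi)^-2, not
   (2 pi)^-1, in the Fourier representation of [S2]. *)
Definition Wtilde Vhat uhat tau : R -> R[i] :=
  convolution Vhat (fun q => expi (- (tau * q ^+ 2)) * uhat q).

Definition W Vhat uhat t p : R[i] :=
  - (0 +i* 1) *
  cintegral `[0, t] (fun tau => Wtilde Vhat uhat tau p * expi (tau * p ^+ 2)).

Lemma WtildeE Vhat uhat (a b tau p : R) : supp Vhat `<=` `[a, b] ->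
  Wtilde Vhat uhat tau p =
  cintegral `[a, b]
    (fun y => Vhat y * uhat (p - y) * expi (- (tau * (p - y) ^+ 2))).
Proof.
move=> sV.
have V0 y : y \notin `[a, b]%classic -> Vhat y = 0.
  rewrite notin_setE => yab; apply: contra_notP yab => /eqP Vy.
  by apply: sV; apply: subset_closure.
have E y : Vhat y * (expi (- (tau * (p - y) ^+ 2)) * uhat (p - y)) =
           Vhat y * uhat (p - y) * expi (- (tau * (p - y) ^+ 2)).
  by rewrite [expi _ * _]mulrC mulrA.
rewrite /Wtilde /convolution /cintegral.
by congr (_ +i* _); rewrite [RHS]Rintegral_mkcond; apply: eq_Rintegral => y _;
  rewrite E patchE; case: ifPn => // /V0 ->; rewrite !mul0r.
Qed.

End DysonPhillips.

(* Main.v *)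
Require Import Defs.
From HB Require Import structures.
From mathcomp Require Import all_boot all_order all_algebra.
From mathcomp Require Import all_classical all_reals all_analysis.
From mathcomp Require Import complex measurable_realfun ring lra.

(* The L^2 Fourier transform is built by a duality argument: damping with the
   Poisson weight e^(-e|p|), whose transform is the positive kernel
   2e / (e^2 + y^2), gives the Plancherel bound on L^1 and L^2, which extends to
   L^2 by completeness; testing against indicators of intervals then gives
   inversion and injectivity.

   In frequency, S_1 multiplies by e^(-itp^2) and B_V is a convolution with
   the transform of V divided by 2 pi, so S_1(t-tau) B_V S_1(tau) u_0 has the
   transform Phi(tau, p) = -i (2 pi)^-1 e^(-i(t-tau)p^2) Wtilde(tau, p). This
   symbol vanishes for p outside [p_1 + a, p_2 + b] and is bounded and Lipschitz
   in tau, uniformly in p; hence the step functions with step 1/(n+1) in tau are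
   H^1 approximations, and the Bochner integral exists with transform
   int_0^t Phi(tau, p) dtau = (2 pi)^-1 e^(-itp^2) W(t, p). A Bochner integral is
   determined by its transform, almost everywhere, so Fourier inversion gives
   the formula; its right-hand side is Lipschitz in x, hence it is the continuous
   representative. *)

Set Implicit Arguments.
Unset Strict Implicit.
Unset Printing Implicit Defensive.

Import Order.TTheory GRing.Theory Num.Theory.
Import numFieldNormedType.Exports.
Local Open Scope classical_set_scope.
Local Open Scope ring_scope.
Local Open Scope complex_scope.

(** [fourier], [inv_fourier] and [bochnerH1] each select some function satisfying a relation, so
    nothing can be computed from them directly: each one needs an existence statement and a
    uniqueness statement up to null sets. The proof therefore works with the relation [isF] between
    a function and its transform, which is stable under sums, scalars, reflection and change of
    measurable representative. The constant 2 pi enters once, as the mass of the Poisson kernel; for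
    Plancherel the inequality suffices. Transforms of indicators are square-integrable but not
    integrable, so inversion for them cannot come from an absolutely convergent double integral. The
    damping restores convergence, and removing it amounts to the limit of an explicit difference of
    arctangents. Since both transforms have compact support, a bound on a symbol that is uniform in
    p is at once an H^1 bound, and the quadratic phases are uniformly Lipschitz in time. The H^1
    error of a simple function is not known to be measurable in tau, so its integral is only
    compared by monotonicity. *)

Local Notation cRe := (@complex.Re _).
Local Notation cIm := (@complex.Im _).
Local Notation normc := Normc.normc.

(** * Complex-valued functions *)

Section ComplexModulus.
Context {R : realType}.
Implicit Types z w : R[i].

Lemma cReM z w : cRe (z * w) = cRe z * cRe w - cIm z * cIm w.
Proof. by case: z w => [a b] [c d]. Qed.

Lemma cImM z w : cIm (z * w) = cRe z * cIm w + cIm z * cRe w.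
Proof. by case: z w => [a b] [c d]. Qed.

Lemma cReD z w : cRe (z + w) = cRe z + cRe w.
Proof. by case: z w => [a b] [c d]. Qed.

Lemma cImD z w : cIm (z + w) = cIm z + cIm w.
Proof. by case: z w => [a b] [c d]. Qed.

Lemma cReN z : cRe (- z) = - cRe z.
Proof. by case: z => [a b]. Qed.

Lemma cImN z : cIm (- z) = - cIm z.
Proof. by case: z => [a b]. Qed.

Lemma complexP z w : cRe z = cRe w -> cIm z = cIm w -> z = w.
Proof. by case: z w => [a b] [c d] /= -> ->. Qed.

Lemma normcE2 z : normc z ^+ 2 = cRe z ^+ 2 + cIm z ^+ 2.
Proof. by case: z => a b; rewrite /= sqr_sqrtr// addr_ge0// sqr_ge0. Qed.

Lemma normc_ge0 z : 0 <= normc z.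
Proof. by case: z => a b; exact: sqrtr_ge0. Qed.

Lemma normr_Re_le z : `|cRe z| <= normc z.
Proof.
by rewrite -ler_sqr ?nnegrE ?normc_ge0// real_normK ?num_real// normcE2 lerDl sqr_ge0.
Qed.

Lemma normr_Im_le z : `|cIm z| <= normc z.
Proof.
by rewrite -ler_sqr ?nnegrE ?normc_ge0// real_normK ?num_real// normcE2 lerDr sqr_ge0.
Qed.

Lemma normc_le_ReIm z : normc z <= `|cRe z| + `|cIm z|.
Proof.
rewrite -ler_sqr ?nnegrE ?normc_ge0 ?addr_ge0// normcE2 sqrrD.
by rewrite !real_normK ?num_real// addrAC lerDl mulrn_wge0// mulr_ge0.
Qed.

Lemma normc_real (x : R) : normc x%:C = `|x|.
Proof. by rewrite /= expr0n/= addr0 sqrtr_sqr. Qed.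

Lemma normc_conj z : normc (z^*)%C = normc z.
Proof. by case: z => a b; rewrite /= sqrrN. Qed.

Lemma mulc_conj z : z * (z^*)%C = (normc z ^+ 2)%:C.
Proof. by apply: complexP; rewrite ?cReM ?cImM/= ?normcE2; case: z => a b /=; ring. Qed.

Lemma ler_normcD z w : normc (z + w) <= normc z + normc w.
Proof. exact: le_normcD. Qed.

Lemma normcB z w : normc (z - w) = normc (w - z).
Proof. by rewrite -normcN opprB. Qed.

Lemma normc_sqrD z w : normc (z + w) ^+ 2 <= 2 * normc z ^+ 2 + 2 * normc w ^+ 2.
Proof.
rewrite !normcE2 cReD cImD.
by have := sqr_ge0 (cRe z - cRe w); have := sqr_ge0 (cIm z - cIm w); nra.
Qed.

Lemma normc_expi (x : R) : normc (expi x) = 1.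
Proof. by rewrite /expi /= cos2Dsin2 sqrtr1. Qed.

Lemma expiD (x y : R) : expi (x + y) = expi x * expi y.
Proof. by apply: complexP; rewrite ?cReM ?cImM/= ?cosD ?sinD; ring. Qed.

Lemma expiN (x : R) : expi (- x) = ((expi x)^*)%C.
Proof. by rewrite /expi cosN sinN. Qed.

Lemma conjcM z w : ((z * w)^*)%C = (z^*)%C * (w^*)%C.
Proof. by case: z w => [a b] [c d]; apply: complexP => /=; ring. Qed.

Lemma realcM (x y : R) : (x * y)%:C = x%:C * y%:C.
Proof. by apply: complexP => /=; ring. Qed.

Lemma Rec (x : R) z : cRe (x%:C * z) = x * cRe z.
Proof. by case: z => a b /=; ring. Qed.

Lemma Imc (x : R) z : cIm (x%:C * z) = x * cIm z.
Proof. by case: z => a b /=; ring. Qed.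

Lemma cRecr z (x : R) : cRe (z * x%:C) = cRe z * x.
Proof. by rewrite mulrC Rec mulrC. Qed.

Lemma cImcr z (x : R) : cIm (z * x%:C) = cIm z * x.
Proof. by rewrite mulrC Imc mulrC. Qed.

End ComplexModulus.

Section ComplexMeasurable.
Context {R : realType} d (T : measurableType d).
Implicit Types f g : T -> R[i].

(** The domain is an arbitrary measurable type, so that functions of pairs and triples are covered;
    Fubini and parameter integrals need this. *)
Definition cmeas f : Prop :=
  measurable_fun setT (cRe \o f) /\ measurable_fun setT (cIm \o f).

Lemma cmeasP f : measurable_fun setT (fun x => cRe (f x)) ->
  measurable_fun setT (fun x => cIm (f x)) -> cmeas f.
Proof. by []. Qed.

Lemma cmeasD f g : cmeas f -> cmeas g -> cmeas (fun x => f x + g x).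
Proof.
move=> [f1 f2] [g1 g2]; apply: cmeasP.
  by under eq_fun do rewrite cReD; exact: measurable_funD.
by under eq_fun do rewrite cImD; exact: measurable_funD.
Qed.

Lemma cmeasN f : cmeas f -> cmeas (fun x => - f x).
Proof.
move=> [f1 f2]; apply: cmeasP.
  by under eq_fun do rewrite cReN; exact: measurableT_comp.
by under eq_fun do rewrite cImN; exact: measurableT_comp.
Qed.

Lemma cmeasB f g : cmeas f -> cmeas g -> cmeas (fun x => f x - g x).
Proof. by move=> mf mg; apply: cmeasD => //; exact: cmeasN. Qed.

Lemma cmeasM f g : cmeas f -> cmeas g -> cmeas (fun x => f x * g x).
Proof.
move=> [f1 f2] [g1 g2]; apply: cmeasP.
  by under eq_fun do rewrite cReM; apply: measurable_funB; exact: measurable_funM.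
by under eq_fun do rewrite cImM; apply: measurable_funD; exact: measurable_funM.
Qed.

Lemma cmeas_cst (z : R[i]) : cmeas (cst z).
Proof. by split; exact: measurable_cst. Qed.

Lemma cmeasJ f : cmeas f -> cmeas (fun x => (f x)^*%C).
Proof.
move=> [f1 f2]; apply: cmeasP.
  rewrite (_ : (fun x => _) = cRe \o f)//.
  by apply/funext => x /=; case: (f x).
rewrite (_ : (fun x => _) = \- (cIm \o f)); first exact: measurable_funN.
by apply/funext => x /=; case: (f x).
Qed.

Lemma cmeas_real (h : T -> R) : measurable_fun setT h -> cmeas (fun x => (h x)%:C).
Proof. by move=> mh; split => //=; exact: measurable_cst. Qed.

Lemma cmeas_expi (h : T -> R) : measurable_fun setT h -> cmeas (fun x => expi (h x)).
Proof.
move=> mh; split.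
  by apply: (measurableT_comp _ mh); apply: continuous_measurable_fun; exact: continuous_cos.
by apply: (measurableT_comp _ mh); apply: continuous_measurable_fun; exact: continuous_sin.
Qed.

Lemma measurable_normc2 f : cmeas f -> measurable_fun setT (fun x => normc (f x) ^+ 2).
Proof.
move=> [f1 f2]; under eq_fun do rewrite normcE2.
by apply: measurable_funD; exact: measurable_funX.
Qed.

Lemma measurable_normc f : cmeas f -> measurable_fun setT (fun x => normc (f x)).
Proof.
move=> /measurable_normc2 mf.
have -> : (fun x => normc (f x)) = Num.sqrt \o (fun x => normc (f x) ^+ 2).
  by apply/funext => x /=; rewrite sqrtr_sqr ger0_norm// normc_ge0.
by apply: (measurableT_comp _ mf); apply: continuous_measurable_fun; exact: sqrt_continuous.
Qed.

Lemma cmeas_sum (I : Type) (s : seq I) (F : I -> T -> R[i]) :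
  (forall i, cmeas (F i)) -> cmeas (fun x => \sum_(i <- s) F i x).
Proof.
move=> mF; elim: s => [|i s IH].
  by under eq_fun do rewrite big_nil; exact: cmeas_cst.
by under eq_fun do rewrite big_cons; exact: cmeasD.
Qed.

End ComplexMeasurable.

Lemma cmeas_comp {R : realType} d d' (T : measurableType d) (U : measurableType d')
    (f : U -> R[i]) (h : T -> U) :
  cmeas f -> measurable_fun setT h -> cmeas (fun x => f (h x)).
Proof. by move=> [f1 f2] mh; split; [exact: (measurableT_comp f1)|exact: (measurableT_comp f2)]. Qed.

(** * Integrals of real and complex functions *)

Section RealIntegral.
Context {R : realType}.
Local Notation mu := (@lebesgue_measure R).
Implicit Types f g h : R -> R.

Lemma aeS (P Q : R -> Prop) : (forall x, P x -> Q x) ->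
  {ae mu, forall x, P x} -> {ae mu, forall x, Q x}.
Proof. by move=> PQ; exact: (@filterS _ _ (ae_filter_ringOfSetsType mu) P Q PQ). Qed.

Lemma aeI (P Q S : R -> Prop) : (forall x, P x -> Q x -> S x) ->
  {ae mu, forall x, P x} -> {ae mu, forall x, Q x} -> {ae mu, forall x, S x}.
Proof. by move=> PQ; exact: (@filterS2 _ _ (ae_filter_ringOfSetsType mu) P Q S PQ). Qed.

Lemma aeT (P : R -> Prop) : (forall x, P x) -> {ae mu, forall x, P x}.
Proof. by move=> HP; apply: (aeS (fun x _ => HP x)); exact: (@filterT _ _ (ae_filter_ringOfSetsType mu)). Qed.

Definition rL1 f : Prop := mu.-integrable setT (EFin \o f).
Definition rI f : R := Rintegral mu setT f.

Lemma measurable_EFin f : measurable_fun setT f -> measurable_fun setT (EFin \o f).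
Proof. by move=> mf; exact/measurable_EFinP. Qed.

Lemma rL1_meas f : rL1 f -> measurable_fun setT f.
Proof. by case/integrableP => /measurable_EFinP. Qed.

Lemma rL1_le f g : measurable_fun setT f -> (forall x, `|f x| <= g x) ->
  rL1 g -> rL1 f.
Proof.
move=> mf fg; apply: le_integrable => //; first exact/measurable_EFinP.
by move=> x _ /=; rewrite lee_fin (le_trans (fg x))// ler_norm.
Qed.

Lemma rL1D f g : rL1 f -> rL1 g -> rL1 (fun x => f x + g x).
Proof. by move=> Lf Lg; exact: (integrableD measurableT Lf Lg). Qed.

Lemma rL1Z (c : R) f : rL1 f -> rL1 (fun x => c * f x).
Proof. by move=> Lf; exact: (integrableZl measurableT c Lf). Qed.

Lemma rL1_norm f : rL1 f -> rL1 (fun x => `|f x|).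
Proof. by move=> Lf; exact: (integrable_norm Lf). Qed.

Lemma rL10 : rL1 (fun _ => 0).
Proof. exact: integrable0. Qed.

Lemma rID f g : rL1 f -> rL1 g -> rI (fun x => f x + g x) = rI f + rI g.
Proof. by move=> Lf Lg; exact: RintegralD. Qed.

Lemma rIB f g : rL1 f -> rL1 g -> rI (fun x => f x - g x) = rI f - rI g.
Proof. by move=> Lf Lg; exact: RintegralB. Qed.

Lemma rIZ (c : R) f : rL1 f -> rI (fun x => c * f x) = c * rI f.
Proof. by move=> Lf; exact: RintegralZl. Qed.

Lemma rIN f : rL1 f -> rI (fun x => - f x) = - rI f.
Proof.
move=> Lf; rewrite -mulN1r -rIZ//; congr rI.
by apply/funext => x; rewrite mulN1r.
Qed.

Lemma rI_ge0 f : (forall x, 0 <= f x) -> 0 <= rI f.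
Proof. by move=> f0; apply: Rintegral_ge0 => x _; exact: f0. Qed.

Lemma rI_le f g : rL1 f -> rL1 g -> (forall x, f x <= g x) -> rI f <= rI g.
Proof. by move=> Lf Lg fg; apply: le_Rintegral => // x _; exact: fg. Qed.

Lemma rI_EFin f : rL1 f -> (\int[mu]_x (f x)%:E)%E = (rI f)%:E.
Proof. by move=> Lf; rewrite /rI /Rintegral fineK//; exact: (integrable_fin_num measurableT Lf). Qed.

Lemma rL1_ge0 f : measurable_fun setT f -> (forall x, 0 <= f x) ->
  (\int[mu]_x (f x)%:E < +oo)%E -> rL1 f.
Proof.
move=> mf f0 fy; apply/integrableP; split; first exact/measurable_EFinP.
by under eq_integral => x _ do rewrite /= ger0_norm//.
Qed.

Lemma ae_eq_rI f g : measurable_fun setT f -> measurable_fun setT g ->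
  ae_eq mu setT f g -> rI f = rI g.
Proof.
move=> mf mg fg; rewrite /rI /Rintegral; congr fine.
apply: ae_eq_integral => //; [exact/measurable_EFinP|exact/measurable_EFinP|].
by move: fg; apply: aeS => x fgx Dx /=; rewrite fgx.
Qed.

Lemma rI_cvg (f_ : nat -> R -> R) f g :
  (forall n, measurable_fun setT (f_ n)) -> measurable_fun setT f ->
  {ae mu, forall x, f_ n x @[n --> \oo] --> f x} ->
  rL1 g -> (forall n x, `|f_ n x| <= g x) ->
  rL1 f /\ rI (f_ n) @[n --> \oo] --> rI f.
Proof.
move=> mf_ mf ff Lg fg.
have [|||||Lf _ cv] := @dominated_convergence _ _ _ mu setT measurableT
    (fun n x => (f_ n x)%:E) (EFin \o f) (EFin \o g).
- by move=> n; exact: measurable_EFin (mf_ n).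
- exact: measurable_EFin mf.
- by move: ff; apply: aeS => x fx _; apply: cvg_EFin => //; exact: nearW.
- exact: Lg.
- by apply: aeT => x n _ /=; rewrite lee_fin.
split => //; have L_ n : rL1 (f_ n) by exact: rL1_le (mf_ n) (fg n) Lg.
by apply: fine_cvg; rewrite fineK//; apply: (integrable_fin_num measurableT Lf).
Qed.

End RealIntegral.

(** * Parameter integrals and Fubini's theorem with a product majorant *)

Section ParamIntegral.
Context {R : realType} d (T : measurableType d).
Local Notation mu := (@lebesgue_measure R).

(** No integrability is assumed: [Rintegral] is [fine] of the difference of two Tonelli integrals,
    and these operations keep measurability even where an integral is infinite. *)
Lemma measurable_rI (F : T * R -> R) : measurable_fun setT F ->
  measurable_fun setT (fun x => rI (fun y => F (x, y))).
Proof.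
move=> mF; rewrite /rI /Rintegral.
apply: (measurableT_comp (fine_measurable measurableT)).
have mE : measurable_fun setT (EFin \o F) by exact/measurable_EFinP.
have mp := measurable_funepos mE; have mn := measurable_funeneg mE.
have := @measurable_fun_fubini_tonelli_F _ _ _ _ R mu _ mp.
have := @measurable_fun_fubini_tonelli_F _ _ _ _ R mu _ mn.
rewrite /fubini_F => m2 m1.
rewrite (_ : (fun x => _) = (fun x => \int[mu]_y ((EFin \o F)^\+ (x, y)))
  \- (fun x => \int[mu]_y ((EFin \o F)^\- (x, y))))%E; last first.
  by apply/funext => x; rewrite integralE; congr (_ - _)%E;
    apply: eq_integral => y _; rewrite ?funeposE ?funenegE.
have m1' := m1 (fun z => funepos_ge0 _ z).
have m2' := m2 (fun z => funeneg_ge0 _ z).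
exact: (emeasurable_funB m1' m2').
Qed.

End ParamIntegral.

Section RealFubini.
Context {R : realType}.
Local Notation mu := (@lebesgue_measure R).
Variables (F : R * R -> R) (h k : R -> R).
Hypotheses (mF : measurable_fun setT F) (Lh : rL1 h) (Lk : rL1 k).
Hypothesis Fhk : forall x y, `|F (x, y)| <= h x * k y.

(** Only the product of [h] and [k] has a known sign, so the estimates below are made with their
    absolute values. *)
Let FhkN x y : `|F (x, y)| <= `|h x| * `|k y|.
Proof. by rewrite -normrM (le_trans (Fhk _ _))// ler_norm. Qed.

Lemma rL1_section1 x : rL1 (fun y => F (x, y)).
Proof.
apply: (@rL1_le _ _ (fun y => `|h x| * `|k y|)) => [|y|]; last by apply/rL1Z/rL1_norm.
  exact: (measurableT_comp mF (pair1_measurable x)).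
exact: FhkN.
Qed.

Lemma rL1_section2 y : rL1 (fun x => F (x, y)).
Proof.
apply: (@rL1_le _ _ (fun x => `|k y| * `|h x|)) => [|x|]; last by apply/rL1Z/rL1_norm.
  exact: (measurableT_comp mF (pair2_measurable y)).
by rewrite mulrC FhkN.
Qed.

Lemma rI_section1_le x : `|rI (fun y => F (x, y))| <= `|h x| * rI (fun y => `|k y|).
Proof.
rewrite -rIZ; last exact: rL1_norm.
apply: (le_trans (le_normr_Rintegral measurableT (rL1_section1 x))).
apply: rI_le => [||y]; [exact/rL1_norm/rL1_section1|exact/rL1Z/rL1_norm|exact: FhkN].
Qed.

Lemma rL1_rI1 : rL1 (fun x => rI (fun y => F (x, y))).
Proof.
apply: (@rL1_le _ _ (fun x => rI (fun y => `|k y|) * `|h x|)).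
- exact: measurable_rI.
- by move=> x; rewrite mulrC rI_section1_le.
- by apply/rL1Z/rL1_norm.
Qed.

(** The product majorant bounds the iterated integral of the absolute value of [F], which gives
    integrability for the product measure; Fubini then applies, and all sections are integrable. *)
Lemma rI_fubini :
  rI (fun x => rI (fun y => F (x, y))) = rI (fun y => rI (fun x => F (x, y))).
Proof.
have mE : measurable_fun setT (EFin \o F) by exact/measurable_EFinP.
have iF : (mu \x mu)%E.-integrable setT (EFin \o F).
  have L2 : rL1 (fun x => rI (fun y => `|k y|) * `|h x|) by apply/rL1Z/rL1_norm.
  apply/(@integrable12ltyP _ _ _ _ R mu mu (EFin \o F)); first exact: mE.
  apply: (@le_lt_trans _ _ (\int[mu]_x (rI (fun y => `|k y|) * `|h x|)%:E)%E).
    apply: ge0_le_integral => //.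
    - by move=> x _; exact: integral_ge0.
    - apply: (@measurable_fun_fubini_tonelli_F _ _ _ _ R mu (abse \o (EFin \o F))) => //.
        by apply: measurableT_comp => //.
      by move=> z; exact: abse_ge0.
    - exact: (measurable_EFin (rL1_meas L2)).
    - move=> x _; have L1 := rL1_norm (rL1_section1 x).
      have L3 : rL1 (fun y => `|h x| * `|k y|) by apply/rL1Z/rL1_norm.
      rewrite [leLHS](rI_EFin L1) lee_fin mulrC -rIZ; last by apply: rL1_norm.
      by apply: rI_le => // y; exact: FhkN.
  by rewrite (rI_EFin L2) ltry.
transitivity (fine (\int[mu]_x \int[mu]_y (EFin \o F) (x, y))).
  by congr fine; apply: eq_integral => x _; rewrite [RHS](rI_EFin (rL1_section1 x)).
rewrite (Fubini iF).
by congr fine; apply: eq_integral => y _; rewrite [LHS](rI_EFin (rL1_section2 y)).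
Qed.

End RealFubini.


Lemma cvg_dist_le {R : realType} (u e : nat -> R) (l : R) :
  (forall n, `|u n - l| <= e n) -> e n @[n --> \oo] --> 0 -> u n @[n --> \oo] --> l.
Proof.
move=> ue /cvgr0Pnorm_le e0; apply/cvgrPdist_le => eps eps0.
apply: filterS (e0 _ eps0) => n; apply: le_trans.
by rewrite distrC (le_trans (ue n))// ler_norm.
Qed.

Section ComplexLimits.
Context {R : realType}.
Implicit Types (u v : nat -> R[i]) (z w : R[i]).

(* Componentwise convergence: R[i] is never used as a topological space *)
Definition ccvg u z : Prop :=
  cRe (u n) @[n --> \oo] --> cRe z /\ cIm (u n) @[n --> \oo] --> cIm z.

Lemma ccvg_cst z : ccvg (fun=> z) z.
Proof. by split; exact: cvg_cst. Qed.

Lemma ccvg_unique u z w : ccvg u z -> ccvg u w -> z = w.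
Proof.
move=> [u1 u2] [v1 v2].
by apply: complexP; [exact: (cvg_unique _ u1 v1)|exact: (cvg_unique _ u2 v2)].
Qed.

Lemma ccvgD u v z w : ccvg u z -> ccvg v w -> ccvg (fun n => u n + v n) (z + w).
Proof.
move=> [u1 u2] [v1 v2]; split.
  rewrite (_ : (fun n => _) = fun n => cRe (u n) + cRe (v n)).
    by rewrite cReD; exact: (cvgD u1 v1).
  by apply/funext => n; rewrite cReD.
rewrite (_ : (fun n => _) = fun n => cIm (u n) + cIm (v n)).
  by rewrite cImD; exact: (cvgD u2 v2).
by apply/funext => n; rewrite cImD.
Qed.

Lemma ccvgM u v z w : ccvg u z -> ccvg v w -> ccvg (fun n => u n * v n) (z * w).
Proof.
move=> [u1 u2] [v1 v2]; split.
  rewrite (_ : (fun n => _) = fun n => cRe (u n) * cRe (v n) - cIm (u n) * cIm (v n)).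
    by rewrite cReM; exact: (cvgB (cvgM u1 v1) (cvgM u2 v2)).
  by apply/funext => n; rewrite cReM.
rewrite (_ : (fun n => _) = fun n => cRe (u n) * cIm (v n) + cIm (u n) * cRe (v n)).
  by rewrite cImM; exact: (cvgD (cvgM u1 v2) (cvgM u2 v1)).
by apply/funext => n; rewrite cImM.
Qed.

Lemma ccvg_real (h : nat -> R) (l : R) : h n @[n --> \oo] --> l ->
  ccvg (fun n => (h n)%:C) l%:C.
Proof. by move=> hl; split => //=; exact: cvg_cst. Qed.

Lemma ccvg_normc u z (e : nat -> R) : (forall n, normc (u n - z) <= e n) ->
  e n @[n --> \oo] --> 0 -> ccvg u z.
Proof.
move=> ue e0.
have H (f : R[i] -> R) : (forall w w', f (w - w') = f w - f w') ->
    (forall w, `|f w| <= normc w) -> f (u n) @[n --> \oo] --> f z.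
  move=> fB fn; apply: (cvg_dist_le _ e0) => n.
  by rewrite -fB (le_trans (fn _)).
split; apply: H => [w w'|w].
- by rewrite cReD cReN.
- exact: normr_Re_le.
- by rewrite cImD cImN.
- exact: normr_Im_le.
Qed.

Lemma ccvg_normc2 u z : ccvg u z -> normc (u n - z) ^+ 2 @[n --> \oo] --> 0.
Proof.
move=> [u1 u2].
have -> : (fun n => normc (u n - z) ^+ 2) =
    (fun n => (cRe (u n) - cRe z) ^+ 2 + (cIm (u n) - cIm z) ^+ 2).
  by apply/funext => n; rewrite normcE2 cReD cReN cImD cImN.
have -> : 0 = (cRe z - cRe z) ^+ 2 + (cIm z - cIm z) ^+ 2 :> R.
  by rewrite !subrr !expr0n addr0.
by apply: cvgD; apply: cvgM; apply: cvgB => //; exact: cvg_cst.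
Qed.

End ComplexLimits.

Section ComplexIntegral.
Context {R : realType}.
Local Notation mu := (@lebesgue_measure R).
Implicit Types f g : R -> R[i].

Definition cL1 f : Prop := rL1 (cRe \o f) /\ rL1 (cIm \o f).
Definition ci f : R[i] := cintegral setT f.

Lemma ciE f : ci f = rI (fun x => cRe (f x)) +i* rI (fun x => cIm (f x)).
Proof. by []. Qed.

Lemma cL1_meas f : cL1 f -> cmeas f.
Proof. by move=> [f1 f2]; split; exact: rL1_meas. Qed.

Lemma cL1_le f (h : R -> R) : cmeas f -> (forall x, normc (f x) <= h x) ->
  rL1 h -> cL1 f.
Proof.
move=> [f1 f2] fh Lh; split.
  by apply: (rL1_le f1 _ Lh) => x; exact: le_trans (normr_Re_le _) (fh x).
by apply: (rL1_le f2 _ Lh) => x; exact: le_trans (normr_Im_le _) (fh x).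
Qed.

Lemma rL1_normc f : cL1 f -> rL1 (fun x => normc (f x)).
Proof.
move=> Lf; have [f1 f2] := Lf.
apply: (@rL1_le _ _ (fun x => `|cRe (f x)| + `|cIm (f x)|)).
- exact/measurable_normc/cL1_meas.
- by move=> x; rewrite ger0_norm ?normc_ge0// normc_le_ReIm.
- by apply: rL1D; exact: rL1_norm.
Qed.

Lemma cL1D f g : cL1 f -> cL1 g -> cL1 (fun x => f x + g x).
Proof.
move=> Lf Lg; apply: (@cL1_le _ (fun x => normc (f x) + normc (g x))).
- by apply: cmeasD; exact: cL1_meas.
- by move=> x; exact: ler_normcD.
- by apply: rL1D; exact: rL1_normc.
Qed.

Lemma cL1M_bounded f g (M : R) : cL1 f -> cmeas g ->
  (forall x, normc (g x) <= M) -> cL1 (fun x => f x * g x).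
Proof.
move=> Lf mg gM; apply: (@cL1_le _ (fun x => M * normc (f x))).
- by apply: cmeasM => //; exact: cL1_meas.
- by move=> x; rewrite Normc.normcM mulrC ler_wpM2r// normc_ge0.
- exact/rL1Z/rL1_normc.
Qed.

Lemma cL1Z (z : R[i]) f : cL1 f -> cL1 (fun x => z * f x).
Proof.
move=> Lf; under eq_fun do rewrite mulrC.
by apply: (@cL1M_bounded f (cst z) (normc z)) => //; exact: cmeas_cst.
Qed.

Lemma cL1N f : cL1 f -> cL1 (fun x => - f x).
Proof. by move=> /(cL1Z (-1)); under eq_fun do rewrite mulN1r. Qed.

Lemma cL1B f g : cL1 f -> cL1 g -> cL1 (fun x => f x - g x).
Proof. by move=> Lf Lg; apply: cL1D => //; exact: cL1N. Qed.

Lemma cL1_real (h : R -> R) : rL1 h -> cL1 (fun x => (h x)%:C).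
Proof. by move=> Lh; split => //=; exact: rL10. Qed.

Lemma ciD f g : cL1 f -> cL1 g -> ci (fun x => f x + g x) = ci f + ci g.
Proof.
move=> [f1 f2] [g1 g2]; rewrite !ciE; apply: complexP => /=.
  by rewrite -rID//; congr rI; apply/funext => x; rewrite cReD.
by rewrite -rID//; congr rI; apply/funext => x; rewrite cImD.
Qed.

Lemma ciZ (z : R[i]) f : cL1 f -> ci (fun x => z * f x) = z * ci f.
Proof.
move=> [f1 f2]; rewrite !ciE; apply: complexP; rewrite ?cReM ?cImM/=.
  rewrite -!rIZ// -rIB; [|exact: rL1Z|exact: rL1Z].
  by congr rI; apply/funext => x; rewrite cReM.
rewrite -!rIZ// -rID; [|exact: rL1Z|exact: rL1Z].
by congr rI; apply/funext => x; rewrite cImM.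
Qed.

Lemma ciZr (z : R[i]) f : cL1 f -> ci (fun x => f x * z) = ci f * z.
Proof. by move=> Lf; rewrite mulrC -ciZ//; congr ci; apply/funext => x; rewrite mulrC. Qed.

Lemma ciN f : cL1 f -> ci (fun x => - f x) = - ci f.
Proof. by move=> Lf; rewrite -mulN1r -ciZ//; congr ci; apply/funext => x; rewrite mulN1r. Qed.

Lemma ciB f g : cL1 f -> cL1 g -> ci (fun x => f x - g x) = ci f - ci g.
Proof. by move=> Lf Lg; rewrite ciD ?ciN//; exact: cL1N. Qed.

Lemma ciJ f : cL1 f -> ci (fun x => (f x)^*%C) = ((ci f)^*)%C.
Proof.
move=> [f1 f2]; rewrite !ciE; apply: complexP => /=.
  by congr rI; apply/funext => x; case: (f x).
by rewrite -rIN//; congr rI; apply/funext => x /=; case: (f x).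
Qed.

Lemma rI_cst0 : rI (fun _ : R => 0) = 0.
Proof. by rewrite /rI /Rintegral integral0. Qed.

Lemma ci_real (h : R -> R) : ci (fun x => (h x)%:C) = (rI h)%:C.
Proof. by rewrite ciE; apply: complexP => //=; exact: rI_cst0. Qed.

(* Multiply by the conjugate of the integral to make the integral real *)
Lemma normc_ci_le f : cL1 f -> normc (ci f) <= rI (fun x => normc (f x)).
Proof.
move=> Lf; have [->|n0] := eqVneq (normc (ci f)) 0.
  by apply: rI_ge0 => x; exact: normc_ge0.
have npos : 0 < normc (ci f) by rewrite lt_neqAle eq_sym n0 normc_ge0.
rewrite -(ler_pM2l npos) -rIZ; last exact: rL1_normc.
have L1 := cL1Z ((ci f)^*)%C Lf.
have -> : normc (ci f) * normc (ci f) = rI (fun x => cRe ((ci f)^*%C * f x)).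
  rewrite (_ : rI _ = cRe (ci (fun x => (ci f)^*%C * f x)))//.
  by rewrite ciZ// [X in _ = cRe X]mulrC mulc_conj /= expr2.
apply: rI_le => [||x]; [exact: L1.1|exact/rL1Z/rL1_normc|].
rewrite (le_trans (ler_norm _))// (le_trans (normr_Re_le _))//.
by rewrite Normc.normcM normc_conj.
Qed.

Lemma ci_cvg (f_ : nat -> R -> R[i]) f (h : R -> R) :
  (forall n, cmeas (f_ n)) -> cmeas f ->
  {ae mu, forall x, ccvg (f_^~ x) (f x)} ->
  rL1 h -> (forall n x, normc (f_ n x) <= h x) ->
  cL1 f /\ ccvg (fun n => ci (f_ n)) (ci f).
Proof.
move=> mf_ [f1 f2] ff Lh fh.
have [|||L1 C1] := @rI_cvg R (fun n => cRe \o f_ n) (cRe \o f) h _ f1 _ Lh.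
- by move=> n; exact: (mf_ n).1.
- by move: ff; apply: aeS => x [].
- by move=> n x; exact: le_trans (normr_Re_le _) (fh n x).
have [|||L2 C2] := @rI_cvg R (fun n => cIm \o f_ n) (cIm \o f) h _ f2 _ Lh.
- by move=> n; exact: (mf_ n).2.
- by move: ff; apply: aeS => x [].
- by move=> n x; exact: le_trans (normr_Im_le _) (fh n x).
by [].
Qed.

Lemma ci_sum (I : Type) (s : seq I) (F : I -> R -> R[i]) : (forall i, cL1 (F i)) ->
  cL1 (fun x => \sum_(i <- s) F i x) /\
  ci (fun x => \sum_(i <- s) F i x) = \sum_(i <- s) ci (F i).
Proof.
move=> LF; elim: s => [|i s [L IH]].
  rewrite big_nil; under eq_fun do rewrite big_nil.
  by split; [exact: cL1_real rL10|rewrite (ci_real (cst 0)) rI_cst0].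
rewrite big_cons; under eq_fun do rewrite big_cons.
by split; [exact: cL1D|rewrite ciD// IH].
Qed.

End ComplexIntegral.

Section ComplexFubini.
Context {R : realType}.
Variables (F : R * R -> R[i]) (h k : R -> R).
Hypotheses (mF : cmeas F) (Lh : rL1 h) (Lk : rL1 k).
Hypothesis Fhk : forall x y, normc (F (x, y)) <= h x * k y.

Let F1 x y : `|(cRe \o F) (x, y)| <= h x * k y.
Proof. exact: le_trans (normr_Re_le _) (Fhk x y). Qed.

Let F2 x y : `|(cIm \o F) (x, y)| <= h x * k y.
Proof. exact: le_trans (normr_Im_le _) (Fhk x y). Qed.

Lemma ci_fubini :
  ci (fun x => ci (fun y => F (x, y))) = ci (fun y => ci (fun x => F (x, y))).
Proof.
rewrite ciE [RHS]ciE; congr (_ +i* _) => /=.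
  exact: (rI_fubini mF.1 Lh Lk F1).
exact: (rI_fubini mF.2 Lh Lk F2).
Qed.

End ComplexFubini.

Lemma cmeas_ci {R : realType} d (T : measurableType d) (F : T * R -> R[i]) :
  cmeas F -> cmeas (fun x => ci (fun y => F (x, y))).
Proof. by move=> [F1 F2]; split; [exact: (measurable_rI F1)|exact: (measurable_rI F2)]. Qed.

(** * Square-integrable functions *)

Section SquareIntegrable.
Context {R : realType}.
Local Notation mu := (@lebesgue_measure R).
Implicit Types f g : R -> R[i].

Definition cL2 f : Prop := cmeas f /\ rL1 (fun x => normc (f x) ^+ 2).
Definition n2 f : R := rI (fun x => normc (f x) ^+ 2).

Lemma n2_ge0 f : 0 <= n2 f.
Proof. by apply: rI_ge0 => x; exact: sqr_ge0. Qed.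

Lemma cLp1P f : cLp 1 f <-> cL1 f.
Proof.
by split => -[/Lfun1_integrable f1 /Lfun1_integrable f2]; split => //;
  exact/Lfun1_integrable.
Qed.

Lemma Lfun2P (h : R -> R) : h \in Lfun mu 2%:E <->
  measurable_fun setT h /\ rL1 (fun x => h x ^+ 2).
Proof.
split=> [Lh|[mh /integrableP[_ Lh]]].
  split; last exact: (Lfun2_integrable_sqr Lh).
  by have /sub_Lfun_mfun := Lh; rewrite inE.
rewrite inE; apply/andP; split; rewrite inE//= /finite_norm unlock.
apply: poweR_lty; apply: le_lt_trans Lh.
apply: ge0_le_integral => //.
- by move=> x _; exact: poweR_ge0.
- apply: (measurable_EFin (f := fun x => `|h x| `^ 2)).
  apply: (measurableT_comp (measurable_powR 2)); exact: measurableT_comp.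
- apply: (measurable_EFin (f := fun x => `|h x ^+ 2|)).
  by apply: measurableT_comp => //; exact: measurable_funX.
- by move=> x _ /=; rewrite lee_fin powR_mulrn// normrX.
Qed.

Lemma cL2P f : cLp 2%:E f <-> cL2 f.
Proof.
split=> [[/Lfun2P[m1 L1] /Lfun2P[m2 L2]]|[[m1 m2] L]].
  split => //; rewrite (_ : (fun x => _) = fun x => cRe (f x) ^+ 2 + cIm (f x) ^+ 2).
    exact: rL1D.
  by apply/funext => x; rewrite normcE2.
split; apply/Lfun2P; split => //.
  apply: (rL1_le _ _ L); first exact: measurable_funX.
  by move=> x /=; rewrite ger0_norm ?sqr_ge0// normcE2 lerDl sqr_ge0.
apply: (rL1_le _ _ L); first exact: measurable_funX.
by move=> x /=; rewrite ger0_norm ?sqr_ge0// normcE2 lerDr sqr_ge0.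
Qed.

Lemma L2normE f : cL2 f -> L2norm f = (Num.sqrt (n2 f))%:E.
Proof.
move=> [mf Lf]; rewrite /L2norm unlock.
rewrite (_ : (\int[mu]_x _)%E = (n2 f)%:E).
  by rewrite poweR_EFin -powR12_sqrt ?n2_ge0.
rewrite -(rI_EFin Lf); apply: eq_integral => x _.
by rewrite poweR_EFin powR_mulrn ?normr_ge0// real_normK ?num_real.
Qed.

Lemma cL2D f g : cL2 f -> cL2 g -> cL2 (fun x => f x + g x).
Proof.
move=> [mf Lf] [mg Lg]; split; first exact: cmeasD.
apply: (@rL1_le _ _ (fun x => 2 * normc (f x) ^+ 2 + 2 * normc (g x) ^+ 2)).
- by apply: measurable_normc2; exact: cmeasD.
- by move=> x; rewrite ger0_norm ?sqr_ge0// normc_sqrD.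
- by apply: rL1D; exact: rL1Z.
Qed.

(** Used in place of Minkowski's inequality: the factors 2 allow every estimate to stay with squared
    norms. *)
Lemma n2D f g : cL2 f -> cL2 g -> n2 (fun x => f x + g x) <= 2 * n2 f + 2 * n2 g.
Proof.
move=> Lf Lg; rewrite -!rIZ; [|exact: Lg.2|exact: Lf.2].
rewrite -rID; [|exact: rL1Z Lf.2|exact: rL1Z Lg.2].
apply: rI_le; first exact: (cL2D Lf Lg).2.
  by apply: rL1D; [exact: rL1Z Lf.2|exact: rL1Z Lg.2].
by move=> x; exact: normc_sqrD.
Qed.

Lemma cL2_le f g (M : R) : cmeas f -> (forall x, normc (f x) <= M * normc (g x)) ->
  cL2 g -> cL2 f.
Proof.
move=> mf fg [mg Lg]; split => //.
apply: (@rL1_le _ _ (fun x => M ^+ 2 * normc (g x) ^+ 2)); last exact: rL1Z.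
  exact: measurable_normc2.
move=> x; rewrite ger0_norm ?sqr_ge0// -exprMn.
by rewrite ler_sqr ?nnegrE ?normc_ge0// (le_trans (normc_ge0 _) (fg x)).
Qed.

Lemma cL2M_bounded f g (M : R) : cL2 f -> cmeas g ->
  (forall x, normc (g x) <= M) -> cL2 (fun x => g x * f x).
Proof.
move=> Lf mg gM; apply: (@cL2_le _ f M) => //.
  by apply: cmeasM => //; exact: Lf.1.
by move=> x; rewrite Normc.normcM ler_wpM2r// normc_ge0.
Qed.

Lemma cL2Z (z : R[i]) f : cL2 f -> cL2 (fun x => z * f x).
Proof. by move=> Lf; apply: (@cL2M_bounded f (cst z) (normc z)) => //; exact: cmeas_cst. Qed.

Lemma n2Z (z : R[i]) f : cL2 f -> n2 (fun x => z * f x) = normc z ^+ 2 * n2 f.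
Proof.
move=> [_ Lf]; rewrite -rIZ//; congr rI.
by apply/funext => x; rewrite Normc.normcM exprMn.
Qed.

Lemma cL2N f : cL2 f -> cL2 (fun x => - f x).
Proof. by move=> /(cL2Z (-1)); under eq_fun do rewrite mulN1r. Qed.

Lemma n2BC f g : n2 (fun x => f x - g x) = n2 (fun x => g x - f x).
Proof. by congr rI; apply/funext => x; rewrite normcB. Qed.

Lemma cL2B f g : cL2 f -> cL2 g -> cL2 (fun x => f x - g x).
Proof. by move=> Lf Lg; apply: cL2D => //; exact: cL2N. Qed.

Lemma cL20 : cL2 (fun=> 0).
Proof.
split; first exact: cmeas_cst.
rewrite (_ : (fun x => _) = fun _ => 0); first exact: rL10.
by apply/funext => x; rewrite Normc.normc0 expr0n.
Qed.

Lemma cL2_ae f g : cmeas g -> ae_eq mu setT f g -> cL2 f -> cL2 g.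
Proof.
move=> mg fg [mf Lf]; split => //; apply: rL1_ge0.
- exact: measurable_normc2.
- by move=> x; exact: sqr_ge0.
- rewrite (_ : (\int[mu]_x _)%E = (n2 f)%:E) ?ltry// -(rI_EFin Lf).
  apply: ae_eq_integral => //.
  + exact: (measurable_EFin (measurable_normc2 mg)).
  + exact: (measurable_EFin (measurable_normc2 mf)).
  + by move: fg; apply: aeS => x fgx Dx /=; rewrite fgx.
Qed.

Lemma ae_eq_n2 f g : cmeas f -> cmeas g -> ae_eq mu setT f g -> n2 f = n2 g.
Proof.
move=> mf mg fg; apply: ae_eq_rI; [exact: measurable_normc2|exact: measurable_normc2|].
by move: fg; apply: aeS => x fgx Dx /=; rewrite fgx.
Qed.

Lemma rL1_normcM f g : cL2 f -> cL2 g -> rL1 (fun x => normc (f x) * normc (g x)).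
Proof.
move=> [mf Lf] [mg Lg].
apply: (@rL1_le _ _ (fun x => normc (f x) ^+ 2 + normc (g x) ^+ 2)); last exact: rL1D.
  by apply: measurable_funM; exact: measurable_normc.
move=> x; rewrite ger0_norm ?mulr_ge0 ?normc_ge0//.
have := sqr_ge0 (normc (f x) - normc (g x)).
have := normc_ge0 (f x); have := normc_ge0 (g x); nra.
Qed.

Lemma cL2M f g : cL2 f -> cL2 g -> cL1 (fun x => f x * g x).
Proof.
move=> Lf Lg; apply: (cL1_le _ _ (rL1_normcM Lf Lg)).
  by apply: cmeasM; [exact: Lf.1|exact: Lg.1].
by move=> x; rewrite Normc.normcM.
Qed.

(** Integrating the square of s |f| - t |g| gives a quadratic inequality in s and t; choosing s and
    t proves the claim, the case of a null [g] apart. *)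
Lemma cauchy_schwarz f g : cL2 f -> cL2 g ->
  rI (fun x => normc (f x) * normc (g x)) ^+ 2 <= n2 f * n2 g.
Proof.
move=> Lf Lg; set c := rI _.
have c0 : 0 <= c by apply: rI_ge0 => x; rewrite mulr_ge0// normc_ge0.
have H (s t : R) : 2 * (s * t) * c <= s ^+ 2 * n2 f + t ^+ 2 * n2 g.
  rewrite -!rIZ; [|exact: Lg.2|exact: Lf.2|exact: rL1_normcM].
  rewrite -rID; [|exact: rL1Z Lf.2|exact: rL1Z Lg.2].
  apply: rI_le; first by apply/rL1Z/rL1_normcM.
    by apply: rL1D; [exact: rL1Z Lf.2|exact: rL1Z Lg.2].
  move=> x; have := sqr_ge0 (s * normc (f x) - t * normc (g x)).
  by rewrite sqrrB; lra.
have f0 := n2_ge0 f; have g0 := n2_ge0 g.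
have [gn|gp] := leP (n2 g) 0.
  have g00 : n2 g = 0 by apply/eqP; rewrite eq_le gn.
  have : c = 0; last by move=> ->; rewrite g00 expr0n mulr0.
  apply/eqP; rewrite eq_le c0 andbT leNgt; apply/negP => cp.
  (* This t makes the left side 2 (n2 f + 1), while the right side is n2 f because the term in [g]
     vanishes. *)
  have := H 1 ((n2 f + 1) / c); rewrite g00 mulr0 addr0 expr1n !mul1r.
  by rewrite -mulrA divfK ?gt_eqF//; nra.
(* With s = n2 g and t = c, both sides share the positive factor n2 g, and dividing it out leaves
   the claim. *)
have := H (n2 g) c.
have -> : n2 g ^+ 2 * n2 f + c ^+ 2 * n2 g = n2 g * (n2 f * n2 g + c ^+ 2) by ring.
have -> : 2 * (n2 g * c) * c = n2 g * (2 * c ^+ 2) by ring.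
by rewrite ler_pM2l//; lra.
Qed.

Lemma normc_ciM_le f g : cL2 f -> cL2 g ->
  normc (ci (fun x => f x * g x)) <= Num.sqrt (n2 f) * Num.sqrt (n2 g).
Proof.
move=> Lf Lg; rewrite -sqrtrM ?n2_ge0//.
apply: (le_trans (normc_ci_le (cL2M Lf Lg))).
have E : (fun x => normc (f x * g x)) = (fun x => normc (f x) * normc (g x)).
  by apply/funext => x; rewrite Normc.normcM.
rewrite E -[leLHS]ger0_norm; last by apply: rI_ge0 => x; rewrite mulr_ge0// normc_ge0.
by rewrite -sqrtr_sqr ler_sqrt ?mulr_ge0 ?n2_ge0// cauchy_schwarz.
Qed.

Lemma sqrt_cvg0 (u : nat -> R) : u n @[n --> \oo] --> 0 ->
  Num.sqrt (u n) @[n --> \oo] --> 0.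
Proof.
move=> u0; have := cvg_comp _ _ u0 (@sqrt_continuous R 0).
by rewrite sqrtr0.
Qed.

(** Cauchy-Schwarz makes the bilinear pairing, taken without conjugate, continuous in L^2. This is
    how identities pass from L^1 and L^2 functions to L^2 functions. *)
Lemma ccvg_ciM (f_ : nat -> R -> R[i]) f g : (forall n, cL2 (f_ n)) -> cL2 f ->
  cL2 g -> n2 (fun x => f_ n x - f x) @[n --> \oo] --> 0 ->
  ccvg (fun n => ci (fun x => f_ n x * g x)) (ci (fun x => f x * g x)).
Proof.
move=> Lf_ Lf Lg /sqrt_cvg0 fn.
apply: (@ccvg_normc _ _ _ (fun n => Num.sqrt (n2 (fun x => f_ n x - f x)) * Num.sqrt (n2 g))).
  move=> n; rewrite -ciB; [|exact: cL2M|exact: cL2M].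
  rewrite (_ : (fun x => _) = fun x => (f_ n x - f x) * g x).
    by apply: normc_ciM_le => //; exact: cL2B.
  by apply/funext => x; rewrite mulrBl.
rewrite -(mul0r (Num.sqrt (n2 g))).
by apply: cvgM => //; exact: cvg_cst.
Qed.

End SquareIntegrable.

(** * Functions with vanishing integrals over intervals *)

Section IntervalTest.
Context {R : realType}.
Local Notation mu := (@lebesgue_measure R).

Lemma lebesgue_itv_cc (c d : R) : c <= d -> mu `[c, d] = (d - c)%:E.
Proof.
rewrite le_eqVlt => /predU1P[->|cd]; rewrite lebesgue_measure_itv/= lte_fin.
  by rewrite ltxx subrr.
by rewrite cd.
Qed.

Lemma rI_itvE (f : R -> R) (A : set R) :
  rI (fun x => f x * \1_A x) = Rintegral mu A f.
Proof.
rewrite Rintegral_mkcond; congr rI; apply/funext => x.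
by rewrite patchE indicE; case: (x \in A); rewrite ?mulr1 ?mulr0.
Qed.

(** At a Lebesgue point the averages over the intervals of half-length 1/(n+1) converge to the value
    of [f], and all of these averages are zero. *)
Lemma ae_eq0_itv (f : R -> R) : locally_integrable setT f ->
  (forall c d, c < d -> rI (fun x => f x * \1_`[c, d] x) = 0) ->
  {ae mu, forall x, f x = 0}.
Proof.
move=> lf f0.
pose E (x : R) (n : nat) : set R := `[x - n.+1%:R^-1, x + n.+1%:R^-1]%classic.
have hE x : nicely_shrinking x (E x).
  split; first by move=> n; exact: measurable_itv.
  have r0 n : 0 < 2 * n.+1%:R^-1 :> R by rewrite mulr_gt0 ?invr_gt0.
  (* The closed interval lies in the open ball of radius 2/(n+1), whose measure is exactly twice
     that of the interval. *)
  exists (2, fun n => PosNum (r0 n)); split => [|/=|n y|n] /=.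
  - by [].
  - by rewrite -[X in _ --> X](mulr0 2); apply: cvgM; [exact: cvg_cst|exact: cvg_harmonic].
  - rewrite /E /= in_itv /= /ball /= => /andP[y1 y2].
    have i0 : 0 < n.+1%:R^-1 :> R by rewrite invr_gt0.
    by move: y1 y2 i0; set r := _^-1 => y1 y2 i0; rewrite ltr_norml; apply/andP; split; lra.
  - rewrite lebesgue_measure_ball; last exact: ltW.
    have i0 : 0 < n.+1%:R^-1 :> R by rewrite invr_gt0.
    rewrite /E; move: i0; set r := _^-1 => i0; rewrite lebesgue_itv_cc; last by lra.
    by rewrite -EFinM lee_fin; lra.
have := lebesgue_differentiation lf; apply: aeS => x /(nice_lebesgue_differentiation hE lf).
have [mf _ fK] := lf.
move=> cv; have : (fun n => (mu (E x n))^-1 * \int[mu]_(y in E x n) (f y)%:E)%E = cst 0%E.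
  apply/funext => n; rewrite (_ : (\int[mu]_(y in E x n) (f y)%:E)%E = 0%E) ?mule0//.
  have := f0 (x - n.+1%:R^-1) (x + n.+1%:R^-1).
  rewrite rI_itvE /Rintegral => fE.
  have i0 : 0 < n.+1%:R^-1 :> R by rewrite invr_gt0.
  have lt1 : x - n.+1%:R^-1 < x + n.+1%:R^-1.
    by move: i0; set r := _^-1 => i0; lra.
  have fin : (\int[mu]_(y in E x n) (f y)%:E)%E \is a fin_num.
    rewrite -integral_fin_num_abs; [|exact: measurable_itv|].
      by apply: fK => //; exact: segment_compact.
    by apply: (measurable_funS measurableT) => //; exact: measurable_EFin mf.
  by rewrite -[LHS]fineK// fE.
move=> E0; have := cv; rewrite E0 => cv0.
have : (f x)%:E = 0%E by exact: (cvg_unique (@ereal_hausdorff R) cv0 (cvg_cst 0%E)).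
move=> fx0; by case: fx0.
Qed.

Definition cind (c d x : R) : R[i] := (\1_`[c, d] x)%:C.

Lemma cmeas_cind c d : cmeas (cind c d).
Proof. by apply: cmeas_real; exact: measurable_indic. Qed.

Lemma cind_le1 c d x : normc (cind c d x) <= 1.
Proof. by rewrite normc_real ger0_norm// indicE; case: (_ \in _). Qed.

Lemma rL1_indic_itv c d : rL1 (\1_`[c, d] : R -> R).
Proof. exact: (@integrable_indic_itv R c d true false). Qed.

Lemma rI_indic_itv c d : c <= d -> rI (\1_`[c, d] : R -> R) = d - c.
Proof.
move=> cd; rewrite /rI /Rintegral integral_indic//.
rewrite [X in fine X](_ : _ = (d - c)%:E)//.
by rewrite setIT; exact: lebesgue_itv_cc.
Qed.

Lemma cL1_cind c d : cL1 (cind c d).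
Proof. exact/cL1_real/rL1_indic_itv. Qed.

Lemma cL2_bounded_itv (f : R -> R[i]) (M c d : R) : cmeas f ->
  (forall x, normc (f x) <= M * \1_`[c, d] x) -> cL1 f /\ cL2 f.
Proof.
move=> mf fM; split.
  by apply: (cL1_le mf fM); exact/rL1Z/rL1_indic_itv.
split => //; apply: (@rL1_le _ _ (fun x => M ^+ 2 * \1_`[c, d] x)).
- exact: measurable_normc2.
- move=> x; rewrite ger0_norm ?sqr_ge0//.
  rewrite (_ : M ^+ 2 * _ = (M * \1_`[c, d] x) ^+ 2).
    by rewrite ler_sqr ?nnegrE ?normc_ge0// (le_trans (normc_ge0 _) (fM x)).
  by rewrite indicE; case: (_ \in _); rewrite ?mulr1// !mulr0 expr0n.
- exact/rL1Z/rL1_indic_itv.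
Qed.

Lemma cL2_cind c d : cL2 (cind c d).
Proof.
apply: (@cL2_bounded_itv _ 1 c d _ _).2; first exact: cmeas_cind.
by move=> x; rewrite mul1r normc_real ger0_norm// indicE; case: (_ \in _).
Qed.

(** On a compact set |h| <= 1 + h^2, and the measure is finite. *)
Lemma cL2_locally_integrable (h : R -> R) : measurable_fun setT h ->
  rL1 (fun x => h x ^+ 2) -> locally_integrable setT h.
Proof.
move=> mh Lh; split => //; first exact: openT.
move=> K _ cK; have mK := compact_measurable cK.
apply: (@le_lt_trans _ _ (\int[mu]_(x in K) (1%:E + (h x ^+ 2)%:E))%E).
  apply: ge0_le_integral => //.
  - apply: (measurable_funS measurableT) => //.
    apply: (measurable_EFin (f := fun x => `|h x|)).
    exact: measurableT_comp.
  - apply: (measurable_funS measurableT) => //.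
    apply: (measurable_EFin (f := fun x => 1 + h x ^+ 2)).
    by apply: measurable_funD => //; exact: measurable_funX.
  - move=> x _; rewrite -EFinD lee_fin.
    by have := sqr_ge0 (`|h x| - 1); rewrite sqrrB real_normK ?num_real//; nra.
have mh2 : measurable_fun K (fun x => (h x ^+ 2)%:E).
  apply: (measurable_funS measurableT) => //.
  exact: (measurable_EFin (measurable_funX 2 mh)).
rewrite ge0_integralD//=; last by move=> x _; rewrite lee_fin sqr_ge0.
rewrite lte_add_pinfty//.
  by rewrite integral_cst// mul1e; exact: compact_finite_measure.
have /integrableP[_] := Lh; apply: le_lt_trans.
rewrite -[leRHS](_ : (\int[mu]_x (h x ^+ 2)%:E)%E = _); last first.
  by apply: eq_integral => x _ /=; rewrite ger0_norm ?sqr_ge0.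
apply: ge0_subset_integral => //.
  exact: (measurable_EFin (measurable_funX 2 mh)).
by move=> x _; rewrite lee_fin sqr_ge0.
Qed.

(** The common test behind the identities almost everywhere: uniqueness of the transform, inversion,
    and uniqueness of the Bochner integral all reduce to pairings with [cind]. *)
Lemma cL2_itv_eq0 (f : R -> R[i]) : cL2 f ->
  (forall c d, c < d -> ci (fun x => f x * cind c d x) = 0) ->
  ae_eq mu setT f (fun=> 0).
Proof.
move=> [[m1 m2] Lf] f0.
have L1 : locally_integrable setT (cRe \o f).
  apply: cL2_locally_integrable => //; apply: (rL1_le _ _ Lf).
    exact: measurable_funX.
  by move=> x /=; rewrite ger0_norm ?sqr_ge0// normcE2 lerDl sqr_ge0.
have L2 : locally_integrable setT (cIm \o f).
  apply: cL2_locally_integrable => //; apply: (rL1_le _ _ Lf).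
    exact: measurable_funX.
  by move=> x /=; rewrite ger0_norm ?sqr_ge0// normcE2 lerDr sqr_ge0.
have H1 : {ae mu, forall x, cRe (f x) = 0}.
  apply: (ae_eq0_itv L1) => c d cd; rewrite -[RHS]/(cRe (0 : R[i])) -(f0 _ _ cd) ciE; congr rI.
  by apply/funext => x; rewrite /cind cRecr.
have H2 : {ae mu, forall x, cIm (f x) = 0}.
  apply: (ae_eq0_itv L2) => c d cd; rewrite -[RHS]/(cIm (0 : R[i])) -(f0 _ _ cd) ciE; congr rI.
  by apply/funext => x; rewrite /cind cImcr.
by apply: (aeI _ H1 H2) => x r0 i0 _; exact: complexP.
Qed.

End IntervalTest.

(** * Completeness of L^2 *)

Section L2Complete.
Context {R : realType}.
Local Notation mu := (@lebesgue_measure R).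

Lemma cmeas_cvg (h_ : nat -> R -> R[i]) (g : R -> R[i]) :
  (forall k, cmeas (h_ k)) -> (forall x, ccvg (h_^~ x) (g x)) -> cmeas g.
Proof.
move=> mh hg; split.
  by apply: (@measurable_fun_cvg _ _ _ _ (fun k => cRe \o h_ k)) => [k|x _];
    [exact: (mh k).1|exact: (hg x).1].
by apply: (@measurable_fun_cvg _ _ _ _ (fun k => cIm \o h_ k)) => [k|x _];
  [exact: (mh k).2|exact: (hg x).2].
Qed.

(** Fatou's lemma for the squared moduli yields integrability and the bound together. It serves for
    completeness, for truncations and for removing the damping. *)
Lemma fatou_n2 (h_ : nat -> R -> R[i]) (g : R -> R[i]) (e : R) :
  (forall k, cL2 (h_ k)) -> (forall k, n2 (h_ k) <= e) ->
  (forall x, ccvg (h_^~ x) (g x)) -> cL2 g /\ n2 g <= e.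
Proof.
move=> Lh he hg.
have mg : cmeas g by apply: cmeas_cvg hg => k; exact: (Lh k).1.
have cv2 x : (normc (h_ n x) ^+ 2)%:E @[n --> \oo] --> (normc (g x) ^+ 2)%:E.
  apply: cvg_EFin; first exact: nearW.
  rewrite [X in _ --> X]normcE2 (_ : (_ \o _) = fun n => cRe (h_ n x) ^+ 2 + cIm (h_ n x) ^+ 2).
    by have [c1 c2] := hg x; exact: (cvgD (cvgM c1 c1) (cvgM c2 c2)).
  by apply/funext => n /=; rewrite normcE2.
have F := @fatou _ _ _ mu setT measurableT (fun n x => (normc (h_ n x) ^+ 2)%:E).
have {}F : (\int[mu]_x (normc (g x) ^+ 2)%:E <= e%:E)%E.
  rewrite (_ : (\int[mu]_x (normc (g x) ^+ 2)%:E)%E =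
      (\int[mu]_x limn_einf (fun n => (normc (h_ n x) ^+ 2)%:E))%E); last first.
    apply: eq_integral => x _; rewrite is_cvg_limn_einfE.
      by apply/esym/cvg_lim => //; exact: cv2.
    by apply/cvg_ex; eexists; exact: cv2.
  apply: (le_trans (F _ _)).
  - by move=> n; exact: (measurable_EFin (measurable_normc2 (Lh n).1)).
  - by move=> n x _; rewrite lee_fin sqr_ge0.
  rewrite limn_einf_lim; apply: lime_le.
    exact: is_cvg_einfs.
  apply: nearW => n; apply: ereal_inf_le; exists (n2 (h_ n))%:E; last by rewrite lee_fin.
  by exists n => //=; rewrite (rI_EFin (Lh n).2).
have Lg : cL2 g.
  split => //; apply: rL1_ge0; [exact: measurable_normc2|by move=> x; exact: sqr_ge0|].
  by apply: (le_lt_trans F); rewrite ltry.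
by split => //; rewrite -lee_fin -(rI_EFin Lg.2).
Qed.

Lemma cvg_geometric_diff (u : nat -> R) (C : R) :
  (forall k, `|u k.+1 - u k| <= C * 2^-1 ^+ k) -> cvgn u.
Proof.
move=> uC.
have C0 : 0 <= C by have := uC 0%N; rewrite expr0 mulr1; apply: le_trans.
have : cvgn (series (telescope u)).
  apply: normed_cvg; apply: (@series_le_cvg _ _ (geometric C 2^-1)) => //.
  - by move=> n; exact: normr_ge0.
  - by move=> n; rewrite /= mulr_ge0// exprn_ge0// invr_ge0.
  - by apply: is_cvg_geometric_series; rewrite ger0_norm ?invr_ge0// invf_lt1 ?ltr0n// ltr1n.
move=> /cvg_ex[l ul]; apply/cvg_ex; exists (u 0%N + l).
have c0 : (fun _ : nat => u 0%N) n @[n --> \oo] --> u 0%N by exact: cvg_cst.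
apply: cvg_trans (cvgD c0 ul); apply: near_eq_cvg; apply: nearW => n /=.
by rewrite [in RHS](eq_sum_telescope u n).
Qed.

(** Riesz-Fischer. Terms with rapidly decreasing consecutive distances converge almost everywhere,
    and Fatou turns the Cauchy bound into a bound on the distance to the limit. *)
Lemma L2_complete (f_ : nat -> R -> R[i]) : (forall n, cL2 (f_ n)) ->
  (forall e, 0 < e -> exists N, forall m n, (N <= m)%N -> (N <= n)%N ->
    n2 (fun x => f_ m x - f_ n x) <= e) ->
  exists g, cL2 g /\ n2 (fun x => f_ n x - g x) @[n --> \oo] --> 0.
Proof.
move=> Lf cauchy.
(* The rate 16^-k leaves room for a weight 4^k: the weighted squared distances still sum, and a
   bound on the sum gives pointwise distances of order 2^-k. *)
have e0 k : 0 < 16^-1 ^+ k :> R by rewrite exprn_gt0// invr_gt0.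
pose M k := sval (cid (cauchy _ (e0 k))).
have MP k : forall m n, (M k <= m)%N -> (M k <= n)%N ->
    n2 (fun x => f_ m x - f_ n x) <= 16^-1 ^+ k by exact: svalP (cid (cauchy _ (e0 k))).
(* The bound by [M k] gives the Cauchy estimate; the bound by [k] lets a shift of the index reach
   any threshold N. *)
pose psi k := maxn (M k) k.
pose h k := f_ (psi k).
have hd k : n2 (fun x => h k.+1 x - h k x) <= 4 * 16^-1 ^+ k.
  (* [M] need not be nondecreasing, so the two terms are compared through an index beyond both
     thresholds. *)
  pose j := maxn (M k) (M k.+1).
  have -> : (fun x => h k.+1 x - h k x) = (fun x => (h k.+1 x - f_ j x) + (f_ j x - h k x)).
    by apply/funext => x; rewrite addrA subrK.
  apply: (le_trans (n2D (cL2B (Lf _) (Lf _)) (cL2B (Lf _) (Lf _)))).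
  have H1 := MP k j (psi k) (leq_maxl _ _) (leq_maxl _ _).
  have H2 := MP k.+1 (psi k.+1) j (leq_maxl _ _) (leq_maxr _ _).
  have : 16^-1 ^+ k.+1 <= 16^-1 ^+ k :> R.
    by rewrite exprS ler_piMl ?exprn_ge0 ?invr_ge0// invf_le1 ?ler1n.
  by move: H1 H2; rewrite -/(h k) -/(h k.+1); lra.
pose a k x := 4 ^+ k * normc (h k.+1 x - h k x) ^+ 2.
have a0 k x : 0 <= a k x by rewrite mulr_ge0 ?exprn_ge0// normc_ge0.
have La k : rL1 (a k) by apply/rL1Z/(cL2B (Lf _) (Lf _)).2.
pose S x := (\sum_(k <oo) (a k x)%:E)%E.
have mS : measurable_fun setT S.
  apply: ge0_emeasurable_sum => k; first by move=> x _ _; rewrite lee_fin.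
  by move=> _; exact: (measurable_EFin (rL1_meas (La k))).
have IS : (\int[mu]_x S x < +oo)%E.
  rewrite integral_nneseries//; last 2 first.
  - by move=> k; exact: (measurable_EFin (rL1_meas (La k))).
  - by move=> k x _; rewrite lee_fin.
  apply: (@le_lt_trans _ _ (\sum_(k <oo) (geometric 4 (4^-1) k)%:E)%E).
    apply: lee_nneseries => [k _ _|k _].
      by apply: integral_ge0 => x _; rewrite lee_fin.
    rewrite (rI_EFin (La k)) lee_fin rIZ; last exact: (cL2B (Lf _) (Lf _)).2.
    apply: (@le_trans _ _ (4 ^+ k * (4 * 16^-1 ^+ k))).
      by rewrite ler_pM2l ?exprn_gt0// hd.
    rewrite /geometric /= mulrCA ler_pM2l// -exprMn.
    by rewrite (_ : 4 * 16^-1 = 4^-1 :> R) //; field.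
  have /cvg_lim -> // : (\sum_(0 <= k < n) (geometric 4 (4^-1) k)%:E)%E @[n --> \oo]
      --> ((4 * (1 - 4^-1)^-1)%:E : \bar R).
    rewrite (_ : (fun n => _) = EFin \o series (geometric 4 4^-1)); last first.
      by apply/funext => n /=; rewrite sumEFin.
    apply: cvg_EFin; first exact: nearW.
    by apply: cvg_geometric_series; rewrite ger0_norm ?invr_ge0// invf_lt1 ?ltr0n// ltr1n.
  by rewrite ltry.
pose A : set R := [set x | (S x < +oo)%E].
have mA : measurable A.
  by rewrite -[A]setTI; exact: emeasurable_fun_infty_o.
have aeA : {ae mu, forall x, A x}.
  have iS : mu.-integrable setT S.
    apply/integrableP; split => //; apply: le_lt_trans IS.
    rewrite le_eqVlt; apply/orP; left; apply/eqP; apply: eq_integral => x _.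
    by rewrite gee0_abs// nneseries_ge0// => k _ _; rewrite lee_fin.
  have := integrable_ae measurableT iS; apply: aeS => x /(_ I).
  by rewrite /A /= fin_numElt => /andP[].
(* Multiplying by the indicator of the set of full measure where the series is finite makes the
   convergence hold everywhere, as [fatou_n2] requires. *)
pose oA x : R[i] := (\1_A x)%:C.
have moA : cmeas oA by apply: cmeas_real; exact: measurable_indic.
have oA1 x : normc (oA x) <= 1.
  by rewrite normc_real ger0_norm// indicE; case: (_ \in _).
have cvA x : exists z, ccvg (fun k => oA x * h k x) z.
  have [xA|xA] := boolP (x \in A); last first.
    exists 0; rewrite /oA indicE (negbTE xA) (_ : (fun k => _) = fun=> 0).
      exact: ccvg_cst.
    by apply/funext => k; rewrite mul0r.
  rewrite /oA indicE xA (_ : (fun k => _) = fun k => h k x); last first.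
    by apply/funext => k; rewrite mul1r.
  have [s Ss] : exists s, S x = s%:E.
    have : S x \is a fin_num.
      rewrite ge0_fin_numE; first by move: xA; rewrite inE.
      by rewrite nneseries_ge0// => k _ _; rewrite lee_fin.
    by move=> /fineK <-; eexists.
  have as_ k : a k x <= s.
    rewrite -lee_fin -Ss /S (@nneseriesD1 _ (fun k => (a k x)%:E) k xpredT)//.
      by rewrite leeDl// nneseries_ge0// => j _ _; rewrite lee_fin.
    by move=> j _; rewrite lee_fin.
  have dk k : normc (h k.+1 x - h k x) <= Num.sqrt s * 2^-1 ^+ k.
    have s0 : 0 <= s by rewrite (le_trans (a0 0%N x)).
    have r0 : 0 <= Num.sqrt s * 2^-1 ^+ k by rewrite mulr_ge0 ?sqrtr_ge0// exprn_ge0// invr_ge0.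
    rewrite -ler_sqr ?nnegrE ?normc_ge0//.
    rewrite exprMn sqr_sqrtr// -exprM mulnC exprM.
    have p0 : 0 < 4 ^+ k :> R by rewrite exprn_gt0.
    rewrite -(ler_pM2l p0).
    rewrite (le_trans (as_ k))// mulrCA -exprMn.
    by rewrite (_ : 4 * 2^-1 ^+ 2 = 1) ?expr1n ?mulr1//; field.
  have /cvg_ex[l1 c1] : cvgn (fun k => cRe (h k x)).
    apply: (@cvg_geometric_diff _ (Num.sqrt s)) => k.
    by rewrite -cReN -cReD (le_trans (normr_Re_le _)).
  have /cvg_ex[l2 c2] : cvgn (fun k => cIm (h k x)).
    apply: (@cvg_geometric_diff _ (Num.sqrt s)) => k.
    by rewrite -cImN -cImD (le_trans (normr_Im_le _)).
  by exists (l1 +i* l2).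
pose g x := sval (cid (cvA x)).
have gP x : ccvg (fun k => oA x * h k x) (g x) by exact: svalP (cid (cvA x)).
have mg : cmeas g.
  by apply: cmeas_cvg gP => k; apply: cmeasM => //; exact: (Lf _).1.
(* For fixed n, the function below is the pointwise limit over k of [oA] times [f_ n] minus
   [h (k + N)], whose squared norms are at most e. *)
have key e : 0 < e -> exists N, forall n, (N <= n)%N ->
    cL2 (fun x => oA x * f_ n x - g x) /\ n2 (fun x => oA x * f_ n x - g x) <= e.
  move=> /cauchy[N HN]; exists N => n Nn.
  apply: (@fatou_n2 (fun k x => oA x * (f_ n x - h (k + N)%N x))).
  - by move=> k; apply: (cL2M_bounded (cL2B (Lf _) (Lf _)) moA oA1).
  - move=> k; apply: (le_trans _ (HN n (psi (k + N)%N) Nn _)); last first.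
      by rewrite (leq_trans (leq_addl k N))// leq_maxr.
    apply: rI_le; first exact: (cL2M_bounded (cL2B (Lf _) (Lf _)) moA oA1).2.
      exact: (cL2B (Lf _) (Lf _)).2.
    move=> x; rewrite Normc.normcM exprMn ler_piMl ?sqr_ge0//.
    by rewrite expr_le1// normc_ge0.
  - move=> x; have [c1 c2] := gP x.
    rewrite (_ : (fun k => _) = fun k => oA x * f_ n x + (-1) * (oA x * h (k + N)%N x)).
      rewrite (_ : _ - g x = oA x * f_ n x + (-1) * g x); last by rewrite mulN1r.
      apply: ccvgD; first exact: ccvg_cst.
      apply: ccvgM; first exact: ccvg_cst.
      by split; [move: c1|move: c2]; rewrite -(cvg_shiftn N).
    by apply/funext => k; ring.
have aeg n : ae_eq mu setT (fun x => oA x * f_ n x) (f_ n).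
  by move: aeA; apply: aeS => x Ax _; rewrite /oA indicE mem_set// mul1r.
have Lg : cL2 g.
  have [N /(_ N (leqnn N))[L _]] := key 1 ltr01.
  have -> : g = fun x => oA x * f_ N x - (oA x * f_ N x - g x).
    by apply/funext => x; ring.
  by apply: cL2B => //; exact: (cL2M_bounded (Lf _) moA oA1).
exists g; split => //; apply/cvgr0Pnorm_le => e /key[N HN].
exists N => // n /= Nn; rewrite ger0_norm ?n2_ge0//.
have [L] := HN n Nn; apply: le_trans.
rewrite le_eqVlt; apply/orP; left; apply/eqP; apply: ae_eq_n2.
- exact: (cL2B (Lf _) Lg).1.
- exact: L.1.
- by move: (aeg n); apply: aeS => x /[apply] ->.
Qed.

End L2Complete.

(** * Measure-preserving changes of variable: translations and reflection *)

Section ChangeOfVariable.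
Context {R : realType}.
Local Notation mu := (@lebesgue_measure R).

Definition preserves_mu (phi : R -> R) : Prop := measurable_fun setT phi /\
  forall A : set R, measurable A -> mu (phi @^-1` A) = mu A.

Lemma preserves_mu_oppr : preserves_mu (fun x => - x).
Proof.
split; first exact: oppr_measurable.
by move=> A mA; exact: lebesgue_measureN.
Qed.

(** The image measure agrees with the Lebesgue measure on half-open intervals, which determines
    it. *)
Lemma preserves_mu_addr (a : R) : preserves_mu (fun x => x + a).
Proof.
have mphi : measurable_fun setT (fun x : R => x + a).
  by apply: measurable_funD; [exact: measurable_id|exact: measurable_cst].
split=> // A mA; apply/esym.
apply: (@lebesgue_measure_unique R
  (pushforward mu (fun x => x + a : measurableTypeR R))) => //= _ [[c d]] _ <-.
rewrite /pushforward (_ : _ @^-1` _ = `]c - a, d - a]%classic).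
  rewrite !lebesgue_measure_itv/= !lte_fin ltrD2r.
  by case: ifP => // _; rewrite -!EFinB; congr EFin; ring.
by apply/seteqP; split => x /=; rewrite !in_itv/= ltrBlDr lerBrDr.
Qed.

Lemma preserves_mu_comp phi psi : preserves_mu phi -> preserves_mu psi ->
  preserves_mu (fun x => phi (psi x)).
Proof.
move=> [m1 p1] [m2 p2]; split; first exact: (measurableT_comp m1 m2).
move=> A mA; rewrite -(p1 A mA) -[RHS]p2//.
by rewrite -[X in measurable X]setTI; exact: m1.
Qed.

Variable phi : R -> R.
Hypothesis pphi : preserves_mu phi.

Lemma ge0_integral_preserves (h : R -> \bar R) : measurable_fun setT h ->
  (forall x, 0 <= h x)%E -> (\int[mu]_x h (phi x) = \int[mu]_x h x)%E.
Proof.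
move=> mh h0; have [mphi mp] := pphi.
have E := @ge0_integral_pushforward _ _ (measurableTypeR R) (measurableTypeR R) R
  phi mphi (@lebesgue_measure R) setT h measurableT mh.
transitivity (\int[mu]_(x in phi @^-1` setT) (h \o phi) x)%E; first by rewrite preimage_setT.
rewrite -[LHS]E; last by move=> y _; exact: h0.
by apply: eq_measure_integral => A mA _ /=; exact: mp.
Qed.

Lemma rI_preserves (f : R -> R) : measurable_fun setT f ->
  rI (fun x => f (phi x)) = rI f.
Proof.
move=> mf; have mE := measurable_EFin mf.
have E1 := ge0_integral_preserves (measurable_funepos mE) (fun x => funepos_ge0 _ x).
have E2 := ge0_integral_preserves (measurable_funeneg mE) (fun x => funeneg_ge0 _ x).
have F1 := integralE mu setT (fun x => (f (phi x))%:E).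
have F2 := integralE mu setT (EFin \o f).
rewrite /rI /Rintegral F1 [X in _ = fine X]F2 -E1 -E2.
by congr (fine (adde _ (oppe _))); apply: eq_integral => x _;
  rewrite ?funeposE ?funenegE.
Qed.

Lemma rL1_preserves (f : R -> R) : rL1 f -> rL1 (fun x => f (phi x)).
Proof.
move=> Lf; have mf := rL1_meas Lf; apply/integrableP; split.
  apply: measurable_EFin; exact: (measurableT_comp mf pphi.1).
have /integrableP[_] := Lf; apply: le_lt_trans.
have := @ge0_integral_preserves (fun x => `|f x|%:E) _ _ => <- //.
by apply: (measurable_EFin (f := fun x => `|f x|)); exact: measurableT_comp.
Qed.

Lemma ci_preserves (f : R -> R[i]) : cmeas f -> ci (fun x => f (phi x)) = ci f.
Proof.
by move=> [f1 f2]; rewrite !ciE (rI_preserves f1) (rI_preserves f2).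
Qed.

Lemma cL1_preserves (f : R -> R[i]) : cL1 f -> cL1 (fun x => f (phi x)).
Proof. by move=> [f1 f2]; split; exact: (rL1_preserves (f := _ \o f)). Qed.

Lemma cmeas_preserves (f : R -> R[i]) : cmeas f -> cmeas (fun x => f (phi x)).
Proof. by move=> mf; apply: cmeas_comp => //; exact: pphi.1. Qed.

Lemma cL2_preserves (f : R -> R[i]) : cL2 f -> cL2 (fun x => f (phi x)).
Proof. by move=> [mf Lf]; split; [exact: cmeas_preserves|exact: (rL1_preserves Lf)]. Qed.

Lemma n2_preserves (f : R -> R[i]) : cmeas f -> n2 (fun x => f (phi x)) = n2 f.
Proof. by move=> mf; apply: (rI_preserves (f := fun x => normc (f x) ^+ 2)); exact: measurable_normc2. Qed.

Lemma ae_preserves (P : R -> Prop) : {ae mu, forall x, P x} ->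
  {ae mu, forall x, P (phi x)}.
Proof.
move=> [N [mN N0 PN]]; exists (phi @^-1` N); split.
- by rewrite -[X in measurable X]setTI; exact: pphi.1.
- by rewrite pphi.2.
- by move=> x; exact: PN.
Qed.

End ChangeOfVariable.

(** * The Poisson kernel *)

Section PoissonKernel.
Context {R : realType}.
Local Notation mu := (@lebesgue_measure R).

Lemma is_derive_scale (c x : R) : is_derive x 1 (fun p : R => c * p) c.
Proof.
have := is_deriveZ (f := id) c (is_derive_id x 1).
by rewrite /GRing.scale/= mulr1.
Qed.

(** The primitive is the real part of exp((-e + iz) p) / (-e + iz). *)
Lemma is_derive_laplace (e z x : R) : 0 < e ->
  is_derive x 1 (fun p => expR (- (e * p)) *
      ((z * sin (z * p) - e * cos (z * p)) / (e ^+ 2 + z ^+ 2)))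
    (expR (- (e * x)) * cos (z * x)).
Proof.
move=> e0.
have D0 : e ^+ 2 + z ^+ 2 != 0.
  by rewrite gt_eqF// ltr_wpDr ?sqr_ge0// exprn_gt0.
have dN : is_derive x 1 (fun p => - (e * p)) (- e) by exact: is_deriveN (is_derive_scale e x).
have dE := @is_derive1_comp R expR (fun p => - (e * p)) _ _ _ (is_derive_expR (- (e * x))) dN.
have dS := @is_derive1_comp R sin (fun p => z * p) _ _ _ (is_derive_sin (z * x)) (is_derive_scale z x).
have dC := @is_derive1_comp R cos (fun p => z * p) _ _ _ (is_derive_cos (z * x)) (is_derive_scale z x).
have d1 := is_deriveB (is_deriveZ z dS) (is_deriveZ e dC).
have d2 := is_deriveZ (e ^+ 2 + z ^+ 2)^-1 d1.
have d3 := is_deriveM dE d2.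
rewrite (_ : (fun p => _) = (expR \o (fun p => - (e * p))) * ((e ^+ 2 + z ^+ 2)^-1 *:
    (z *: (sin \o *%R z) - e *: (cos \o *%R z)))); last first.
  by apply/funext => p; rewrite fctE /= [_ / _]mulrC.
apply: is_derive_eq d3 _.
rewrite /GRing.scale /= [X in _ + X * _ = _](_ : _ =
  (e ^+ 2 + z ^+ 2)^-1 * (z * sin (z * x) - e * cos (z * x)))//.
by field.
Qed.

Lemma is_derive_continuous (F : R -> R) (x D : R) : is_derive x 1 F D ->
  {for x, continuous F}.
Proof. by move=> dF; apply: differentiable_continuous; apply/derivable1_diffP; apply: ex_derive. Qed.

Lemma rI_FTC (f F : R -> R) (a b : R) : a <= b -> continuous f ->
  (forall x : R, is_derive x 1 F (f x)) -> rI (fun x => f x * \1_`[a, b] x) = F b - F a.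
Proof.
rewrite le_eqVlt => /predU1P[<-|ab] cf dF; rewrite rI_itvE.
  by rewrite set_itv1 Rintegral_set1 subrr.
rewrite /Rintegral (@continuous_FTC2 _ f F)//.
- by apply: continuous_subspaceT => x; exact: cf.
- split.
  + by move=> x _; apply: ex_derive.
  + by apply: cvg_at_right_filter; exact: is_derive_continuous (dF _).
  + by apply: cvg_at_left_filter; exact: is_derive_continuous (dF _).
- by move=> x _; rewrite derive1E; exact: derive_val.
Qed.

Lemma neq_ae (c : R) : {ae mu, forall x, x != c}.
Proof.
exists [set c]; split; [exact: measurable_set1|exact: lebesgue_measure_set1|].
by move=> x /= /negP; rewrite negbK => /eqP.
Qed.

Definition wexp (e p : R) : R := expR (- (e * `|p|)).

Definition poisson (e y : R) : R := 2 * e / (e ^+ 2 + y ^+ 2).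

Lemma wexp_gt0 e p : 0 < wexp e p. Proof. exact: expR_gt0. Qed.

Lemma wexp_le1 e p : 0 <= e -> wexp e p <= 1.
Proof. by move=> e0; rewrite /wexp expR_le1 oppr_le0 mulr_ge0. Qed.

Lemma measurable_wexp e : measurable_fun setT (wexp e).
Proof.
have h : measurable_fun setT (fun p : R => e * `|p|).
  by apply: measurable_funM; [exact: measurable_cst|exact: normr_measurable].
rewrite (_ : wexp e = expR \o (fun p => - (e * `|p|)))//.
apply: measurableT_comp; [exact: measurable_expR|]. exact: measurable_funN.
Qed.

Lemma continuous_expcos (e z : R) : 0 < e ->
  continuous (fun p => expR (- (e * p)) * cos (z * p)).
Proof.
move=> e0 x; have dN : is_derive x 1 (fun p => - (e * p)) (- e).
  exact: is_deriveN (is_derive_scale e x).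
have dE := @is_derive1_comp R expR (fun p => - (e * p)) _ _ _ (is_derive_expR (- (e * x))) dN.
have dC := @is_derive1_comp R cos (fun p => z * p) _ _ _ (is_derive_cos (z * x)) (is_derive_scale z x).
exact: is_derive_continuous (is_deriveM dE dC).
Qed.

(** Reflection doubles the half interval; the origin is then counted twice, so the integrands agree
    only almost everywhere. *)
Lemma rI_even_itv (g : R -> R) (N : R) : 0 <= N -> measurable_fun setT g ->
  (forall x, g (- x) = g x) -> rL1 (fun x => g x * \1_`[0, N] x) ->
  rI (fun x => g x * \1_`[- N, N] x) = 2 * rI (fun x => g x * \1_`[0, N] x).
Proof.
move=> N0 mg ge Lg.
pose h x := g x * \1_`[0, N] x.
have mh : measurable_fun setT h by exact: rL1_meas Lg.
rewrite -/h [RHS](_ : _ = rI h + rI (fun x => h (- x))); last first.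
  by rewrite (rI_preserves preserves_mu_oppr)// mulr_natl mulr2n.
rewrite -rID//; last exact: (rL1_preserves preserves_mu_oppr).
apply: ae_eq_rI.
- by apply: measurable_funM => //; exact: measurable_indic.
- apply: measurable_funD => //.
  by apply: rL1_meas; exact: (rL1_preserves preserves_mu_oppr).
- apply: aeS (neq_ae 0) => x x0 _; rewrite /h ge -mulrDr; congr (_ * _).
  rewrite !indicE !mem_setE !in_itv/=.
  have [xn|xp|xe] := ltgtP x 0; last by rewrite xe eqxx in x0.
  - have -> : (0 <= - x) = true by rewrite oppr_ge0 ltW.
    have -> : (x <= N) = true by rewrite (le_trans (ltW xn)).
    by rewrite /= add0r andbT lerNl.
  - have -> : (0 <= - x) = false by rewrite oppr_ge0 leNgt xp.
    have -> : (- N <= x) = true by rewrite (le_trans _ (ltW xp))// oppr_le0.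
    by rewrite /= addr0.
Qed.

(** The Poisson kernel is the boundary contribution at 0, where the primitive equals -e / (e^2 +
    z^2); the other summand is the boundary term at N. *)
Lemma rI_wexpcos_itv (e z N : R) : 0 < e -> 0 <= N ->
  rI (fun p => (wexp e p * cos (z * p)) * \1_`[- N, N] p) =
  poisson e z + 2 * (expR (- (e * N)) *
      ((z * sin (z * N) - e * cos (z * N)) / (e ^+ 2 + z ^+ 2))).
Proof.
move=> e0 N0.
have E : (fun p => (wexp e p * cos (z * p)) * \1_`[0, N] p) =
    (fun p => (expR (- (e * p)) * cos (z * p)) * \1_`[0, N] p).
  apply/funext => p; rewrite indicE mem_setE in_itv/=.
  by have [p0|p0] := leP 0 p; rewrite ?mulr0// /wexp ger0_norm.
rewrite rI_even_itv//.
- rewrite E (rI_FTC N0 (@continuous_expcos e z e0) (fun x => @is_derive_laplace e z x e0)).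
  rewrite /poisson !mulr0 oppr0 expR0 sin0 cos0 mulr0 sub0r mulr1 mul1r mulrBr addrC.
  by congr (_ + _); rewrite mulNr mulrN opprK mulrA.
- apply: measurable_funM; first exact: measurable_wexp.
  by apply: continuous_measurable_fun => x; exact: is_derive_continuous
    (@is_derive1_comp R cos (fun p => z * p) _ _ _ (is_derive_cos (z * x)) (is_derive_scale z x)).
- by move=> x; rewrite /wexp normrN mulrN cosN.
- rewrite E; apply: (rL1_le _ _ (rL1_indic_itv 0 N)).
    apply: measurable_funM; last exact: measurable_indic.
    exact: (continuous_measurable_fun (@continuous_expcos e z e0)).
  move=> x; rewrite indicE mem_setE in_itv/=.
  have [x0|x0] := leP 0 x; rewrite ?mulr0 ?normr0//=.
  case: (x <= N); rewrite ?mulr0 ?normr0//= mulr1 normrM.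
  rewrite ger0_norm ?expR_ge0// mulr_ile1 ?expR_ge0//.
    by rewrite expR_le1 oppr_le0 mulr_ge0// ltW.
  by rewrite ler_norml cos_geN1 cos_le1.
Qed.

Lemma indic_itvN_cvg (x : R) : \1_`[- n%:R, n%:R] x @[n --> \oo] --> (1 : R).
Proof.
have [N xN] : exists N : nat, `|x| <= N%:R.
  by exists (Num.bound `|x|); rewrite ltW// archi_boundP.
apply: cvg_near_cst; exists N => // n /= Nn.
by rewrite indicE mem_set//= in_itv/= -ler_norml (le_trans xN)// ler_nat.
Qed.

(** A form of monotone convergence read off [fatou_n2]: the nonnegative [g] is the squared modulus
    of its square root, and the truncations converge pointwise. *)
Lemma rL1_limit (g : R -> R) (M : R) : measurable_fun setT g -> (forall x, 0 <= g x) ->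
  (forall n : nat, rL1 (fun x => g x * \1_`[- n%:R, n%:R] x) /\
     rI (fun x => g x * \1_`[- n%:R, n%:R] x) <= M) ->
  rL1 g /\ rI g <= M.
Proof.
move=> mg g0 H.
have ms : measurable_fun setT (fun x => Num.sqrt (g x)).
  by apply: (measurableT_comp _ mg); apply: continuous_measurable_fun; exact: sqrt_continuous.
pose h (n : nat) x : R[i] := (Num.sqrt (g x) * \1_`[- n%:R, n%:R] x)%:C.
have hE n x : normc (h n x) ^+ 2 = g x * \1_`[- n%:R, n%:R] x.
  rewrite normc_real real_normK ?num_real// exprMn sqr_sqrtr//.
  by rewrite indicE; case: (_ \in _); rewrite ?expr1n// expr0n.
have gE x : normc (Num.sqrt (g x))%:C ^+ 2 = g x.
  by rewrite normc_real real_normK ?num_real// sqr_sqrtr.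
have [||x|[_ L] I] := @fatou_n2 R h (fun x => (Num.sqrt (g x))%:C) M.
- move=> n; split; last by under eq_fun do rewrite hE; exact: (H n).1.
  by apply: cmeas_real; apply: measurable_funM => //; exact: measurable_indic.
- by move=> n; rewrite /n2; under eq_fun do rewrite hE; exact: (H n).2.
- apply: ccvg_real; rewrite -[X in _ --> X]mulr1; apply: cvgM; first exact: cvg_cst.
  exact: indic_itvN_cvg.
by move: L I; rewrite /n2; under eq_fun do rewrite gE.
Qed.

End PoissonKernel.

Section PoissonIntegral.
Context {R : realType}.
Local Notation mu := (@lebesgue_measure R).

Lemma measurable_cosZ (z : R) : measurable_fun setT (fun p : R => cos (z * p)).
Proof.
apply: (measurableT_comp (f := @cos R)); first exact: (continuous_measurable_fun (@continuous_cos R)).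
by apply: measurable_funM; [exact: measurable_cst|exact: measurable_id].
Qed.

Lemma measurable_sinZ (z : R) : measurable_fun setT (fun p : R => sin (z * p)).
Proof.
apply: (measurableT_comp (f := @sin R)); first exact: (continuous_measurable_fun (@continuous_sin R)).
by apply: measurable_funM; [exact: measurable_cst|exact: measurable_id].
Qed.

Lemma rL1_bounded_itv (f : R -> R) (M c d : R) : measurable_fun setT f ->
  (forall x, x \in `[c, d] -> `|f x| <= M) -> rL1 (fun x => f x * \1_`[c, d] x).
Proof.
move=> mf fM; apply: (rL1_le _ _ (rL1Z M (rL1_indic_itv c d))).
  by apply: measurable_funM => //; exact: measurable_indic.
move=> x; rewrite indicE; have [xcd|_] := boolP (x \in _); last by rewrite !mulr0 normr0.
by rewrite !mulr1 fM//; move: xcd; rewrite mem_setE.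
Qed.

Lemma rL1_wexp (e : R) : 0 < e -> rL1 (wexp e).
Proof.
move=> e0; apply: (@rL1_limit _ _ (poisson e 0) _ _ _).1.
- exact: measurable_wexp.
- by move=> x; exact/ltW/wexp_gt0.
move=> n; split.
  apply: (@rL1_bounded_itv _ 1); first exact: measurable_wexp.
  by move=> x _; rewrite ger0_norm ?(ltW (wexp_gt0 _ _))// wexp_le1// ltW.
have := rI_wexpcos_itv 0 e0 (ler0n R n).
rewrite (_ : (fun p => wexp e p * cos (0 * p) * _) =
  (fun p => wexp e p * \1_`[- n%:R, n%:R] p)); last first.
  by apply/funext => p; rewrite mul0r cos0 mulr1.
move=> ->; rewrite !mul0r cos0 sub0r mulr1 mulNr mulrN gerDl mulrN oppr_le0.
by rewrite !mulr_ge0 ?expR_ge0 ?invr_ge0 ?addr_ge0 ?sqr_ge0// ltW.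
Qed.

Lemma rI_wexpcos (e z : R) : 0 < e -> rI (fun p => wexp e p * cos (z * p)) = poisson e z.
Proof.
move=> e0.
have mf : measurable_fun setT (fun p => wexp e p * cos (z * p)).
  by apply: measurable_funM; [exact: measurable_wexp|exact: measurable_cosZ].
have [|//||_ cv] := @rI_cvg R (fun n p => (wexp e p * cos (z * p)) * \1_`[- n%:R, n%:R] p)
    (fun p => wexp e p * cos (z * p)) (wexp e) _ mf _ (rL1_wexp e0).
- by move=> n; apply: measurable_funM => //; exact: measurable_indic.
- apply: aeT => x; rewrite -[X in _ --> X]mulr1; apply: cvgM; first exact: cvg_cst.
  exact: indic_itvN_cvg.
- move=> n x; rewrite !normrM (ger0_norm (ltW (wexp_gt0 _ _))) -mulrA.
  rewrite ler_piMr ?(ltW (wexp_gt0 _ _))// mulr_ile1//.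
    by rewrite ler_norml cos_geN1 cos_le1.
  by rewrite indicE; case: (_ \in _); rewrite ?normr1 ?normr0.
suff cv2 : rI (fun p => (wexp e p * cos (z * p)) * \1_`[- n%:R, n%:R] p)
    @[n --> \oo] --> poisson e z by exact: (cvg_unique _ cv cv2).
have D0 : 0 < e ^+ 2 + z ^+ 2.
  by rewrite ltr_wpDr ?sqr_ge0// exprn_gt0.
(* The boundary term at n is a bounded factor times exp(-e n), a geometric sequence. *)
apply: (@cvg_dist_le _ _ (fun n => expR (- e) ^+ n * (2 * ((`|z| + e) / (e ^+ 2 + z ^+ 2))))).
  move=> n; rewrite rI_wexpcos_itv// [poisson e z + _]addrC addrK !normrM.
  rewrite (ger0_norm (expR_ge0 _)) -[- (e * n%:R)]mulNr expRM_natr.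
  rewrite [`|2|]ger0_norm// mulrCA ler_wpM2l ?exprn_ge0 ?expR_ge0// ler_wpM2l//.
  rewrite normfV (ger0_norm (ltW D0)) ler_wpM2r ?invr_ge0 ?(ltW D0)//.
  rewrite (le_trans (ler_normB _ _))// lerD// normrM ?(gtr0_norm e0).
    by rewrite ler_piMr// ler_norml sin_geN1 sin_le1.
  by rewrite ler_piMr ?(ltW e0)// ler_norml cos_geN1 cos_le1.
rewrite -[X in _ --> X](mul0r (2 * ((`|z| + e) / (e ^+ 2 + z ^+ 2)))).
apply: cvgM; last exact: cvg_cst.
by apply: cvg_expr; rewrite ger0_norm ?expR_ge0// expR_lt1 oppr_lt0.
Qed.

Lemma rI_wexpsin (e z : R) : 0 < e -> rI (fun p => wexp e p * sin (z * p)) = 0.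
Proof.
move=> e0.
have mf : measurable_fun setT (fun p => wexp e p * sin (z * p)).
  by apply: measurable_funM; [exact: measurable_wexp|exact: measurable_sinZ].
have Lf : rL1 (fun p => wexp e p * sin (z * p)).
  apply: (rL1_le mf _ (rL1_wexp e0)) => x.
  rewrite normrM (ger0_norm (ltW (wexp_gt0 _ _))) ler_piMr ?(ltW (wexp_gt0 _ _))//.
  by rewrite ler_norml sin_geN1 sin_le1.
have := rI_preserves preserves_mu_oppr mf.
rewrite (_ : (fun x => _) = (fun x => - (wexp e x * sin (z * x)))).
  by rewrite rIN//; lra.
by apply/funext => x; rewrite /wexp normrN mulrN sinN mulrN.
Qed.

Lemma poisson_gt0 (e y : R) : 0 < e -> 0 < poisson e y.
Proof.
by move=> e0; rewrite /poisson divr_gt0 ?mulr_gt0// ltr_wpDr ?sqr_ge0// exprn_gt0.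
Qed.

Lemma is_derive_atanZ (e c x : R) : 0 < e ->
  is_derive x 1 (fun y => 2 * atan (e^-1 * y + c / e)) (poisson e (x + c)).
Proof.
move=> e0.
have d1 := is_deriveD (is_derive_scale e^-1 x) (is_derive_cst (c / e) x 1).
have d2 := @is_derive1_comp R (@atan R) (fun y => e^-1 * y + c / e) _ _ _
  (is_derive1_atan (e^-1 * x + c / e)) d1.
apply: is_derive_eq (is_deriveZ 2 d2) _.
have D0 : 0 < e ^+ 2 + (x + c) ^+ 2 by rewrite ltr_wpDr ?sqr_ge0// exprn_gt0.
have E0 : e != 0 by rewrite gt_eqF.
rewrite /GRing.scale /= addr0 /poisson.
have -> : 1 + (e^-1 * x + c / e) ^+ 2 = (e ^+ 2 + (x + c) ^+ 2) / e ^+ 2 by field.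
by field; rewrite gt_eqF.
Qed.

Lemma continuous_poisson (e c : R) : 0 < e -> continuous (fun x => poisson e (x + c)).
Proof.
move=> e0 x.
have D0 : e ^+ 2 + (x + c) ^+ 2 != 0 by rewrite gt_eqF// ltr_wpDr ?sqr_ge0// exprn_gt0.
have xc : (y + c) @[y --> x] --> x + c by apply: cvgD; [exact: cvg_id|exact: cvg_cst].
rewrite /poisson; apply: cvgM; first exact: cvg_cst.
apply: cvgV => //; apply: cvgD; first exact: cvg_cst.
exact: (cvgM xc xc).
Qed.

Lemma measurable_poisson (e : R) : 0 < e -> measurable_fun setT (poisson e).
Proof.
move=> e0; have := continuous_measurable_fun (@continuous_poisson e 0 e0).
by congr measurable_fun; apply/funext => x; rewrite addr0.
Qed.

Lemma rI_poisson_itv (e c a b : R) : 0 < e -> a <= b ->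
  rI (fun x => poisson e (x + c) * \1_`[a, b] x) =
  2 * (atan ((b + c) / e) - atan ((a + c) / e)).
Proof.
move=> e0 ab; rewrite (rI_FTC ab (@continuous_poisson e c e0) (fun x => @is_derive_atanZ e c x e0)).
by rewrite mulrBr ![e^-1 * _]mulrC -!mulrDl.
Qed.

Lemma poisson_le (e y : R) : 0 < e -> poisson e y <= 2 / e.
Proof.
move=> e0; rewrite /poisson ler_pdivrMr; last by rewrite ltr_wpDr ?sqr_ge0// exprn_gt0.
rewrite (_ : 2 / e * _ = 2 * e + 2 / e * y ^+ 2); last by field; rewrite gt_eqF.
by rewrite lerDl mulr_ge0 ?sqr_ge0// divr_ge0// ltW.
Qed.

Lemma poissonN (e y : R) : poisson e (- y) = poisson e y.
Proof. by rewrite /poisson sqrrN. Qed.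

(** The primitive is 2 atan(y / e), and the arctangent varies by less than pi. This bound is the
    source of the constant 2 pi in Plancherel's inequality. *)
Lemma rL1_poisson (e : R) : 0 < e -> rL1 (poisson e) /\ rI (poisson e) <= 2 * pi.
Proof.
move=> e0; apply: rL1_limit.
- exact: measurable_poisson.
- by move=> x; exact/ltW/poisson_gt0.
- move=> n; split.
    apply: (@rL1_bounded_itv _ (2 / e)); first exact: measurable_poisson.
    by move=> x _; rewrite ger0_norm ?poisson_le// ltW// poisson_gt0.
  have nn : - n%:R <= n%:R :> R by rewrite (@le_trans _ _ 0)// oppr_le0.
  have := @rI_poisson_itv e 0 _ _ e0 nn.
  rewrite (_ : (fun x => poisson e (x + 0) * _) =
    (fun x => poisson e x * \1_`[- n%:R, n%:R] x)).
    move=> ->; rewrite ler_pM2l//.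
    have := atan_gtNpi2 ((- n%:R + 0) / e :> R); have := atan_ltpi2 ((n%:R + 0) / e :> R).
    by lra.
  by apply/funext => x; rewrite addr0.
Qed.

End PoissonIntegral.

(** * The Fourier transform *)

Section FourierL1.
Context {R : realType}.
Local Notation mu := (@lebesgue_measure R).
Implicit Types f g : R -> R[i].

Lemma fourierL1E f p : fourierL1 f p = ci (fun x => f x * expi (- (x * p))).
Proof. by []. Qed.

Lemma cL1_expi f (h : R -> R) : cL1 f -> measurable_fun setT h ->
  cL1 (fun x => f x * expi (h x)).
Proof.
move=> Lf mh; apply: (@cL1M_bounded _ f (fun x => expi (h x)) 1) => //.
  exact: cmeas_expi.
by move=> x; rewrite normc_expi.
Qed.

Lemma cL1_expiNM f (c : R) : cL1 f -> cL1 (fun x => f x * expi (- (x * c))).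
Proof.
move=> Lf; apply: cL1_expi => //; apply: measurable_funN.
by apply: measurable_funM; [exact: measurable_id|exact: measurable_cst].
Qed.

Lemma measurable_mulpair : measurable_fun setT (fun z : R * R => z.1 * z.2).
Proof. by apply: measurable_funM; [exact: measurable_fst|exact: measurable_snd]. Qed.

Lemma cmeas_expipair : cmeas (fun z : R * R => expi (- (z.1 * z.2))).
Proof. by apply: cmeas_expi; apply: measurable_funN; exact: measurable_mulpair. Qed.

Lemma cmeas_fourierL1 f : cmeas f -> cmeas (fourierL1 f).
Proof.
move=> mf.
have mF : cmeas (fun z : R * R => f z.2 * expi (- (z.2 * z.1))).
  apply: cmeasM; first by apply: (cmeas_comp mf); exact: measurable_snd.
  apply: cmeas_expi; apply: measurable_funN.
  by apply: measurable_funM; [exact: measurable_snd|exact: measurable_fst].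
exact: (cmeas_ci mF).
Qed.

Lemma normc_fourierL1_le f p : cL1 f -> normc (fourierL1 f p) <= rI (fun x => normc (f x)).
Proof.
move=> Lf; rewrite fourierL1E (le_trans (normc_ci_le (cL1_expiNM _ Lf)))//.
rewrite (_ : (fun x => normc _) = (fun x => normc (f x)))//.
by apply/funext => x; rewrite Normc.normcM normc_expi mulr1.
Qed.

(** The multiplication formula: both sides are iterated integrals of f(x) g(p) e^(-ixp), with
    product majorant |f(x)| |g(p)|. No conjugate occurs. *)
Lemma fourierL1_duality f g : cL1 f -> cL1 g ->
  ci (fun p => fourierL1 f p * g p) = ci (fun x => f x * fourierL1 g x).
Proof.
move=> Lf Lg.
pose F (z : R * R) := f z.1 * (g z.2 * expi (- (z.1 * z.2))).
have mF : cmeas F.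
  apply: cmeasM; first by apply: (cmeas_comp (cL1_meas Lf)); exact: measurable_fst.
  apply: cmeasM; last exact: cmeas_expipair.
  by apply: (cmeas_comp (cL1_meas Lg)); exact: measurable_snd.
have H := @ci_fubini R F (fun x => normc (f x)) (fun p => normc (g p)) mF
  (rL1_normc Lf) (rL1_normc Lg).
rewrite (_ : ci (fun x => f x * fourierL1 g x) = ci (fun x => ci (fun y => F (x, y)))).
  rewrite H; last by move=> x y; rewrite /F /= !Normc.normcM normc_expi mulr1.
  congr ci; apply/funext => p; rewrite fourierL1E -ciZr; last exact: cL1_expiNM.
  by congr ci; apply/funext => x; rewrite /F /=; ring.
congr ci; apply/funext => x; rewrite fourierL1E /F /= ciZ.
  by congr (_ * ci _); apply/funext => y; rewrite [y * x]mulrC.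
by under eq_fun do rewrite [x * _]mulrC; exact: cL1_expiNM.
Qed.

(** A damped character. Its transform is the Poisson kernel centred at q, so pairing it with the
    transform of [f] gives, by duality, the Poisson mean of [f] at q. *)
Definition pker (e q p : R) : R[i] := (wexp e p)%:C * expi (q * p).

Lemma cL1_pker e q : 0 < e -> cL1 (pker e q).
Proof.
move=> e0; apply: cL1_expi; first exact/cL1_real/rL1_wexp.
by apply: measurable_funM; [exact: measurable_cst|exact: measurable_id].
Qed.

Lemma fourierL1_pker e q y : 0 < e -> fourierL1 (pker e q) y = (poisson e (y - q))%:C.
Proof.
move=> e0; rewrite fourierL1E.
rewrite (_ : (fun x => _) = fun x => (wexp e x)%:C * expi ((q - y) * x)); last first.
  apply/funext => x; rewrite /pker -mulrA -expiD; congr (_ * expi _); ring.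
rewrite ciE; apply: complexP => /=.
  rewrite (_ : (fun x => _) = (fun x => wexp e x * cos ((q - y) * x))).
    by rewrite rI_wexpcos// -poissonN opprB.
  by apply/funext => x; rewrite mul0r subr0.
rewrite (_ : (fun x => _) = (fun x => wexp e x * sin ((q - y) * x))).
  exact: rI_wexpsin.
by apply/funext => x; rewrite mul0r addr0.
Qed.

(** Integrating in x first, the kernel contributes a mass of at most 2 pi. Tonelli is applied in the
    extended reals because integrability of the outer function is part of the conclusion. *)
Lemma rL1_poisson_conv (e : R) (g : R -> R) : 0 < e -> rL1 g -> (forall x, 0 <= g x) ->
  rL1 (fun x => rI (fun y => g y * poisson e (y - x))) /\
  rI (fun x => rI (fun y => g y * poisson e (y - x))) <= 2 * pi * rI g.
Proof.
move=> e0 Lg g0; have [LP IP] := rL1_poisson e0.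
have mg := rL1_meas Lg.
pose F (z : R * R) := g z.2 * poisson e (z.2 - z.1).
have mF : measurable_fun setT F.
  apply: measurable_funM; first by apply: (measurableT_comp mg); exact: measurable_snd.
  apply: (measurableT_comp (measurable_poisson e0)).
  by apply: measurable_funB; [exact: measurable_snd|exact: measurable_fst].
have F0 z : 0 <= F z by rewrite mulr_ge0// ltW// poisson_gt0.
have L1 x : rL1 (fun y => F (x, y)).
  apply: (rL1_le _ _ (rL1Z (2 / e) Lg)).
    exact: (measurableT_comp mF (pair1_measurable x)).
  move=> y; rewrite ger0_norm// /F /= mulrC ler_wpM2r//.
  exact: poisson_le.
have pr (y : R) : preserves_mu (fun x : R => - x + y).
  exact: (preserves_mu_comp (preserves_mu_addr y) preserves_mu_oppr).
have L2 y : rL1 (fun x => F (x, y)).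
  apply: (rL1Z (g y) (f := fun x => poisson e (y - x))).
  have := rL1_preserves (pr y) LP.
  by congr rL1; apply/funext => x; rewrite addrC.
have I2 y : rI (fun x => F (x, y)) <= 2 * pi * g y.
  rewrite (_ : (fun x => F (x, y)) = fun x => g y * poisson e (y - x))// rIZ; last first.
    have := rL1_preserves (pr y) LP.
    by congr rL1; apply/funext => x; rewrite addrC.
  rewrite mulrC ler_wpM2r//.
  have := rI_preserves (pr y) (measurable_poisson e0).
  rewrite (_ : (fun x => poisson e (- x + y)) = fun x => poisson e (y - x)).
    by move=> ->.
  by apply/funext => x; rewrite addrC.
have mK : measurable_fun setT (fun x => rI (fun y => F (x, y))) by exact: measurable_rI.
have B : (\int[mu]_x (rI (fun y => F (x, y)))%:E <= (2 * pi * rI g)%:E)%E.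
  rewrite (_ : (\int[mu]_x (rI (fun y => F (x, y)))%:E)%E =
    (\int[mu]_x \int[mu]_y (F (x, y))%:E)%E); last first.
    by apply: eq_integral => x _; rewrite -(rI_EFin (L1 x)).
  have mE : measurable_fun setT (EFin \o F) by exact/measurable_EFinP.
  have E0 z : (0 <= (EFin \o F) z)%E by rewrite lee_fin.
  rewrite [leLHS](@fubini_tonelli _ _ _ _ R mu mu (EFin \o F) mE E0).
  have Lg2 := rL1Z (2 * pi) Lg.
  rewrite -rIZ// -(rI_EFin Lg2).
  apply: ge0_le_integral => //.
  - by move=> x _; apply: integral_ge0 => y _; exact: E0.
  - exact: (@measurable_fun_fubini_tonelli_G _ _ _ _ R mu (EFin \o F) mE E0).
  - exact: (measurable_EFin (rL1_meas Lg2)).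
  - by move=> y _; rewrite [leLHS](rI_EFin (L2 y)) lee_fin.
have LK : rL1 (fun x => rI (fun y => F (x, y))).
  apply: rL1_ge0 => //; first by move=> x; exact: rI_ge0.
  by apply: (le_lt_trans B); rewrite ltry.
by split => //; rewrite -lee_fin -(rI_EFin LK).
Qed.

End FourierL1.

(** * Plancherel's inequality on L^1 and L^2 *)

Section PlancherelBound.
Context {R : realType}.
Local Notation mu := (@lebesgue_measure R).
Implicit Types f g : R -> R[i].

Lemma preserves_mu_subr (x : R) : preserves_mu (fun y : R => y - x).
Proof. exact: preserves_mu_addr. Qed.

(* Duality turns the damped norm of the Fourier transform into the double
   integral of f(x) conj(f(y)) P(y - x), P being the Poisson kernel, which AM-GM
   and Tonelli bound by the mass of P *)
Lemma fourierL1_damped_le f (e : R) : cL1 f -> cL2 f -> 0 < e ->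
  rI (fun p => wexp e p * normc (fourierL1 f p) ^+ 2) <= 2 * pi * n2 f.
Proof.
move=> L1 L2 e0.
have mF := cmeas_fourierL1 (cL1_meas L1).
have [LP IP] := rL1_poisson e0.
(* Paired with the transform of [f], this function gives the damped norm; its own transform is the
   conjugate of a Poisson mean of [f]. *)
pose phi p := (wexp e p)%:C * ((fourierL1 f p)^*)%C.
have Lw : cL1 (fun p => (wexp e p)%:C) by exact/cL1_real/rL1_wexp.
have Lphi : cL1 phi.
  apply: (@cL1M_bounded _ _ _ (rI (fun x => normc (f x)))) => //; first exact: cmeasJ.
  by move=> p; rewrite normc_conj normc_fourierL1_le.
have phiE x : fourierL1 phi x = ((ci (fun y => f y * (poisson e (y - x))%:C))^*)%C.
  rewrite -[in RHS](_ : (fun y => f y * fourierL1 (pker e x) y) =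
      fun y => f y * (poisson e (y - x))%:C); last first.
    by apply/funext => y; rewrite fourierL1_pker.
  rewrite -fourierL1_duality//; last exact: cL1_pker.
  rewrite -ciJ; last first.
    under eq_fun do rewrite mulrC.
    apply: (@cL1M_bounded _ _ _ (rI (fun x => normc (f x)))) => //; first exact: cL1_pker.
    by move=> p; rewrite normc_fourierL1_le.
  rewrite fourierL1E; congr ci; apply/funext => p.
  rewrite /phi /pker !conjcM [p * x]mulrC expiN.
  have -> : (((wexp e p)%:C)^*)%C = (wexp e p)%:C by apply: complexP => //=; rewrite oppr0.
  by rewrite mulrCA mulrA.
pose g x := normc (f x).
have Lg := rL1_normc L1.
have g0 x : 0 <= g x by exact: normc_ge0.
have LgP x : rL1 (fun y => g y * poisson e (y - x)).
  apply: (rL1_le _ _ (rL1Z (2 / e) Lg)).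
    apply: measurable_funM; first exact: rL1_meas Lg.
    by apply: (measurableT_comp (measurable_poisson e0)); exact: (preserves_mu_subr x).1.
  move=> y; rewrite ger0_norm; last by rewrite mulr_ge0// ltW// poisson_gt0.
  by rewrite mulrC ler_wpM2r// poisson_le.
have Lg2P x : rL1 (fun y => g y ^+ 2 * poisson e (y - x)).
  apply: (rL1_le _ _ (rL1Z (2 / e) L2.2)).
    apply: measurable_funM; first exact: rL1_meas L2.2.
    by apply: (measurableT_comp (measurable_poisson e0)); exact: (preserves_mu_subr x).1.
  move=> y; rewrite ger0_norm; last by rewrite mulr_ge0 ?sqr_ge0// ltW// poisson_gt0.
  by rewrite mulrC ler_wpM2r ?sqr_ge0// poisson_le.
have phi_le x : normc (fourierL1 phi x) <= rI (fun y => g y * poisson e (y - x)).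
  have LfP : cL1 (fun y => f y * (poisson e (y - x))%:C).
    apply: (@cL1M_bounded _ _ _ (2 / e)) => //.
      apply: cmeas_real; apply: (measurableT_comp (measurable_poisson e0)).
      exact: (preserves_mu_subr x).1.
    by move=> y; rewrite normc_real ger0_norm ?poisson_le// ltW// poisson_gt0.
  rewrite phiE normc_conj (le_trans (normc_ci_le LfP))//.
  rewrite (_ : (fun y => normc _) = (fun y => g y * poisson e (y - x)))//.
  apply/funext => y; rewrite Normc.normcM normc_real ger0_norm//.
  by rewrite ltW// poisson_gt0.
pose K x := rI (fun y => g y ^+ 2 * poisson e (y - x)).
have [LK IK] := rL1_poisson_conv e0 L2.2 (fun x => sqr_ge0 _).
have IPx x : rI (fun y => poisson e (y - x)) <= 2 * pi.
  by rewrite (rI_preserves (preserves_mu_subr x) (measurable_poisson e0)).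
(* AM-GM splits g(x) g(y) into halves of the squares: the first carries half of the mass 2 pi, and
   the integral of [K] is at most 2 pi n2 f, so each part ends up contributing pi n2 f. *)
have amgm x : normc (f x) * normc (fourierL1 phi x) <= pi * g x ^+ 2 + 2^-1 * K x.
  apply: (le_trans (ler_wpM2l (g0 x) (phi_le x))).
  rewrite -rIZ//.
  have LPx := rL1_preserves (preserves_mu_subr x) LP.
  apply: (@le_trans _ _ (rI (fun y => (2^-1 * g x ^+ 2) * poisson e (y - x) +
      2^-1 * (g y ^+ 2 * poisson e (y - x))))).
    apply: rI_le; first exact: rL1Z.
      by apply: rL1D; exact: rL1Z.
    move=> y; have P0 := ltW (poisson_gt0 (y - x) e0).
    move: P0; set P := poisson _ _ => P0.
    rewrite mulrA [2^-1 * (_ * P)]mulrA -mulrDl ler_wpM2r//.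
    by have := sqr_ge0 (g x - g y); rewrite sqrrB -/(g x); lra.
  rewrite rID; [|exact: rL1Z|exact: rL1Z].
  rewrite (rIZ _ LPx) (rIZ _ (Lg2P x)) lerD2r.
  have := IPx x; have := sqr_ge0 (g x); nra.
have Lphi2 : cL1 (fun x => f x * fourierL1 phi x).
  apply: (@cL1M_bounded _ _ _ (rI (fun x => normc (phi x)))) => //.
    exact/cmeas_fourierL1/cL1_meas.
  by move=> x; exact: normc_fourierL1_le.
have -> : rI (fun p => wexp e p * normc (fourierL1 f p) ^+ 2) =
    normc (ci (fun x => f x * fourierL1 phi x)).
  rewrite -fourierL1_duality//.
  rewrite (_ : (fun p => fourierL1 f p * phi p) =
      fun p => (wexp e p * normc (fourierL1 f p) ^+ 2)%:C).
    rewrite ci_real normc_real ger0_norm//.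
    by apply: rI_ge0 => p; rewrite mulr_ge0 ?sqr_ge0// ltW// wexp_gt0.
  by apply/funext => p; rewrite /phi mulrCA mulc_conj realcM.
apply: (le_trans (normc_ci_le Lphi2)).
apply: (@le_trans _ _ (rI (fun x => pi * g x ^+ 2 + 2^-1 * K x))).
  apply: rI_le; first exact: rL1_normc.
    by apply: rL1D; apply: rL1Z; [exact: L2.2|exact: LK].
  by move=> x; rewrite Normc.normcM.
rewrite rID; [|exact: rL1Z L2.2|exact: rL1Z LK].
rewrite (rIZ _ L2.2) (rIZ _ LK).
by move: IK; rewrite -/(n2 f) -[rI (fun x => rI _)]/(rI K) => IK; lra.
Qed.

Lemma wexp_cvg1 (p : R) : wexp (k.+1%:R^-1) p @[k --> \oo] --> (1 : R).
Proof.
have H : - (k.+1%:R^-1 * `|p|) @[k --> \oo] --> (0 : R).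
  rewrite -[X in _ --> X]oppr0; apply: cvgN.
  rewrite -[X in _ --> X](mul0r `|p|); apply: cvgM; [exact: cvg_harmonic|exact: cvg_cst].
have := cvg_comp _ _ H (@continuous_expR R 0).
by rewrite expR0.
Qed.

(** The damped bound does not depend on the damping, so Fatou lets the damping tend to 0; square
    integrability of the transform comes out at the same time. *)
Lemma fourierL1_n2 f : cL1 f -> cL2 f ->
  cL2 (fourierL1 f) /\ n2 (fourierL1 f) <= 2 * pi * n2 f.
Proof.
move=> L1 L2.
have mF := cmeas_fourierL1 (cL1_meas L1).
have e0 k : 0 < k.+1%:R^-1 :> R by rewrite invr_gt0.
pose h (k : nat) p := (wexp (k.+1%:R^-1) p)%:C * fourierL1 f p.
(* Squaring the modulus doubles the exponent of the weight, hence the damping parameter 2 / (k+1)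
   below. *)
have hE k p : normc (h k p) ^+ 2 =
    wexp (2 * k.+1%:R^-1) p * normc (fourierL1 f p) ^+ 2.
  rewrite Normc.normcM exprMn normc_real ger0_norm ?(ltW (wexp_gt0 _ _))//.
  by rewrite /wexp expr2 -expRD; congr (expR _ * _); ring.
have mh k : cmeas (h k) by apply: cmeasM => //; apply: cmeas_real; exact: measurable_wexp.
have Lh k : rL1 (fun p => normc (h k p) ^+ 2).
  under eq_fun do rewrite hE.
  apply: (rL1_le _ _ (rL1Z (rI (fun x => normc (f x)) ^+ 2)
    (rL1_wexp (mulr_gt0 (ltr0Sn R 1) (e0 k))))).
    by apply: measurable_funM; [exact: measurable_wexp|exact: measurable_normc2].
  move=> p; rewrite ger0_norm; last by rewrite mulr_ge0 ?sqr_ge0// ltW// wexp_gt0.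
  rewrite mulrC ler_wpM2r ?(ltW (wexp_gt0 _ _))//.
  rewrite ler_sqr ?nnegrE ?normc_ge0//; first exact: normc_fourierL1_le.
  by apply: rI_ge0 => x; exact: normc_ge0.
apply: (@fatou_n2 R h) => [k|k|p]; first by split.
  rewrite /n2; under eq_fun do rewrite hE.
  by apply: fourierL1_damped_le => //; rewrite mulr_gt0.
rewrite -[X in ccvg _ X]mul1r; apply: ccvgM; last exact: ccvg_cst.
by apply: ccvg_real; exact: wexp_cvg1.
Qed.

End PlancherelBound.

(** * The Fourier transform on L^2 as a relation *)

Section FourierL2.
Context {R : realType}.
Local Notation mu := (@lebesgue_measure R).
Implicit Types f g phi chi : R -> R[i].

Lemma L2norm_cvg0 (u : nat -> R -> R[i]) : (forall n, cL2 (u n)) ->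
  (L2norm (u n) @[n --> \oo] --> 0%E) <-> (n2 (u n) @[n --> \oo] --> 0).
Proof.
move=> Lu; rewrite (_ : (fun n => L2norm (u n)) = EFin \o (fun n => Num.sqrt (n2 (u n)))).
  split=> [/fine_cvg /= H|/sqrt_cvg0 H]; last by apply: cvg_EFin => //; exact: nearW.
  rewrite (_ : (fun n => n2 (u n)) = (fun n => Num.sqrt (n2 (u n)) * Num.sqrt (n2 (u n)))).
    by rewrite -[X in _ --> X](mul0r 0); apply: cvgM.
  by apply/funext => n; rewrite -expr2 sqr_sqrtr ?n2_ge0.
by apply/funext => n; rewrite L2normE.
Qed.

(* [is_fourier] with real-valued squared norms, see [is_fourierP] *)
Definition isF f g : Prop := [/\ cL2 f, cL2 g & exists f_ : nat -> R -> R[i],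
  [/\ forall n, cL1 (f_ n) /\ cL2 (f_ n),
      n2 (fun x => f_ n x - f x) @[n --> \oo] --> 0 &
      n2 (fun p => fourierL1 (f_ n) p - g p) @[n --> \oo] --> 0]].

Lemma is_fourierP f g : is_fourier f g <-> isF f g.
Proof.
split=> [[/cL2P Lf /cL2P Lg [f_ [L12 c1 c2]]]|[Lf Lg [f_ [L12 c1 c2]]]].
  split => //; exists f_.
  have L n : cL1 (f_ n) /\ cL2 (f_ n) by have [/cLp1P ? /cL2P ?] := L12 n.
  split => //; first by apply/L2norm_cvg0 => // n; exact: cL2B (L n).2 Lf.
  by apply/L2norm_cvg0 => // n; exact: cL2B (fourierL1_n2 (L n).1 (L n).2).1 Lg.
split; [exact/cL2P|exact/cL2P|exists f_; split].
- by move=> n; have [? ?] := L12 n; split; [exact/cLp1P|exact/cL2P].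
- by apply/L2norm_cvg0 => // n; exact: cL2B (L12 n).2 Lf.
- by apply/L2norm_cvg0 => // n; exact: cL2B (fourierL1_n2 (L12 n).1 (L12 n).2).1 Lg.
Qed.

Lemma fourierL1B f g p : cL1 f -> cL1 g ->
  fourierL1 (fun x => f x - g x) p = fourierL1 f p - fourierL1 g p.
Proof.
move=> Lf Lg; rewrite !fourierL1E -ciB; [|exact: cL1_expiNM|exact: cL1_expiNM].
by congr ci; apply/funext => x; rewrite mulrBl.
Qed.

Lemma fourierL1D f g p : cL1 f -> cL1 g ->
  fourierL1 (fun x => f x + g x) p = fourierL1 f p + fourierL1 g p.
Proof.
move=> Lf Lg; rewrite !fourierL1E -ciD; [|exact: cL1_expiNM|exact: cL1_expiNM].
by congr ci; apply/funext => x; rewrite mulrDl.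
Qed.

Lemma fourierL1Z (c : R[i]) f p : cL1 f ->
  fourierL1 (fun x => c * f x) p = c * fourierL1 f p.
Proof.
move=> Lf; rewrite !fourierL1E -ciZ; last exact: cL1_expiNM.
by congr ci; apply/funext => x; rewrite mulrA.
Qed.

Lemma isF_L1 f : cL1 f -> cL2 f -> isF f (fourierL1 f).
Proof.
move=> L1 L2; split => //; first exact: (fourierL1_n2 L1 L2).1.
exists (fun=> f); split => //.
- rewrite (_ : (fun n => _) = fun=> 0); first exact: cvg_cst.
  apply/funext => n; rewrite /n2 (_ : (fun x => _) = fun=> 0) ?rI_cst0//.
  by apply/funext => x; rewrite subrr Normc.normc0 expr0n.
- rewrite (_ : (fun n => _) = fun=> 0); first exact: cvg_cst.
  apply/funext => n; rewrite /n2 (_ : (fun x => _) = fun=> 0) ?rI_cst0//.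
  by apply/funext => x; rewrite subrr Normc.normc0 expr0n.
Qed.

(** The multiplication formula passes to the limit in two stages: first in the approximations of [f]
    against a fixed [p_ n], then in [p_ n]. *)
Lemma isF_dual f g phi chi : isF f g -> isF phi chi ->
  ci (fun p => g p * phi p) = ci (fun x => f x * chi x).
Proof.
move=> [Lf Lg [f_ [L12 c1 c2]]] [Lp Lc [p_ [M12 d1 d2]]].
have LF n : cL2 (fourierL1 (f_ n)) by exact: (fourierL1_n2 (L12 n).1 (L12 n).2).1.
have LP n : cL2 (fourierL1 (p_ n)) by exact: (fourierL1_n2 (M12 n).1 (M12 n).2).1.
have H n : ci (fun p => g p * p_ n p) = ci (fun x => f x * fourierL1 (p_ n) x).
  have e1 := ccvg_ciM LF Lg (M12 n).2 c2.
  have e2 := ccvg_ciM (fun m => (L12 m).2) Lf (LP n) c1.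
  apply: (ccvg_unique e1).
  rewrite (_ : (fun m => _) = (fun m => ci (fun x => f_ m x * fourierL1 (p_ n) x)))//.
  by apply/funext => m; rewrite fourierL1_duality//; [exact: (L12 m).1|exact: (M12 n).1].
have e1 := ccvg_ciM (fun m => (M12 m).2) Lp Lg d1.
have e2 := ccvg_ciM LP Lc Lf d2.
have c a b : ci (fun x => a x * b x) = ci (fun x => b x * a x) :> R[i].
  by congr ci; apply/funext => x; rewrite mulrC.
rewrite [LHS]c [RHS]c; apply: (ccvg_unique e1).
rewrite (_ : (fun m => _) = (fun m => ci (fun x => fourierL1 (p_ m) x * f x)))//.
by apply/funext => m; rewrite c H c.
Qed.

Definition ftrunc f (n : nat) x : R[i] := f x * cind (- n%:R) n%:R x.

Lemma cL12_ftrunc f n : cL2 f -> cL1 (ftrunc f n) /\ cL2 (ftrunc f n).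
Proof.
move=> Lf; split; first exact: cL2M Lf (cL2_cind _ _).
rewrite /ftrunc; under eq_fun do rewrite mulrC.
exact: (cL2M_bounded Lf (cmeas_cind _ _) (cind_le1 _ _)).
Qed.

Lemma n2_ftrunc f : cL2 f -> n2 (fun x => ftrunc f n x - f x) @[n --> \oo] --> 0.
Proof.
move=> Lf.
have [|||||_] := @rI_cvg R (fun n x => normc (ftrunc f n x - f x) ^+ 2) (fun=> 0)
    (fun x => normc (f x) ^+ 2); last by rewrite rI_cst0.
- move=> n; apply: measurable_normc2.
  exact: (cL2B (cL12_ftrunc n Lf).2 Lf).1.
- exact: measurable_cst.
- apply: aeT => x; apply: ccvg_normc2.
  rewrite -[X in ccvg _ X]mulr1; apply: ccvgM; first exact: ccvg_cst.
  by apply: ccvg_real; exact: indic_itvN_cvg.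
- exact: Lf.2.
- move=> n x; rewrite ger0_norm ?sqr_ge0// /ftrunc /cind indicE.
  case: (_ \in _); rewrite ?mulr1 ?mulr0 ?subrr ?Normc.normc0 ?expr0n ?sqr_ge0//.
  by rewrite sub0r normcN.
Qed.

Lemma n2_triangle (h f g : R -> R[i]) : cL2 h -> cL2 f -> cL2 g ->
  n2 (fun x => f x - g x) <= 2 * n2 (fun x => f x - h x) + 2 * n2 (fun x => g x - h x).
Proof.
move=> Lh Lf Lg; rewrite (n2BC g h).
rewrite (_ : (fun x => f x - g x) = (fun x => (f x - h x) + (h x - g x))).
  by apply: n2D; exact: cL2B.
by apply/funext => x; rewrite addrA subrK.
Qed.

(** Truncations converge in L^2, so by Plancherel's inequality their transforms form a Cauchy
    sequence, whose limit is the transform. *)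
Lemma isF_exists f : cL2 f -> exists g, isF f g.
Proof.
move=> Lf.
have L12 n := cL12_ftrunc n Lf.
have LF n := (fourierL1_n2 (L12 n).1 (L12 n).2).1.
have [|e e0|g [Lg cg]] := @L2_complete R (fun n => fourierL1 (ftrunc f n)) => //.
  have C0 : 0 < 8 * pi :> R by rewrite mulr_gt0// pi_gt0.
  (* The tolerance absorbs the factor 2 pi of Plancherel and the factor 2 + 2 of [n2_triangle]. *)
  have d0 : 0 < e / (8 * pi) by rewrite divr_gt0.
  have [N _ HN] := (cvgr0Pnorm_le _).1 (n2_ftrunc Lf) _ d0.
  exists N => m n Nm Nn.
  rewrite (_ : (fun x => _) = fourierL1 (fun x => ftrunc f m x - ftrunc f n x)); last first.
    by apply/funext => p; rewrite fourierL1B; [|exact: (L12 m).1|exact: (L12 n).1].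
  apply: (le_trans (fourierL1_n2 (cL1B (L12 m).1 (L12 n).1) (cL2B (L12 m).2 (L12 n).2)).2).
  have T := n2_triangle Lf (L12 m).2 (L12 n).2.
  have := HN m Nm; have := HN n Nn; rewrite !ger0_norm ?n2_ge0//.
  set A := n2 _; set B := n2 _ => HA HB.
  have {}T : n2 (fun x => ftrunc f m x - ftrunc f n x) <= 4 * (e / (8 * pi)).
    by apply: (le_trans T); rewrite -/A -/B; lra.
  have -> : e = 2 * pi * (4 * (e / (8 * pi))).
    move: C0; generalize (pi : R) => P C0; field.
    by rewrite gt_eqF//; move: C0; rewrite pmulr_rgt0.
  by rewrite ler_wpM2l// mulr_ge0// pi_ge0.
by exists g; split => //; exists (ftrunc f); split => //; exact: n2_ftrunc.
Qed.

(** Equality almost everywhere does not by itself provide the measurability that [cL2] contains, so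
    it is asked of the new representatives. *)
Lemma isF_ae f g f' g' : isF f g -> cmeas f' -> cmeas g' ->
  ae_eq mu setT f f' -> ae_eq mu setT g g' -> isF f' g'.
Proof.
move=> [Lf Lg [f_ [L12 c1 c2]]] mf' mg' ff gg.
have Lf' := cL2_ae mf' ff Lf; have Lg' := cL2_ae mg' gg Lg.
split => //; exists f_; split => //.
  rewrite (_ : (fun n => _) = (fun n => n2 (fun x => f_ n x - f x)))//.
  apply/funext => n; apply: ae_eq_n2; [exact: (cL2B (L12 n).2 Lf').1|exact: (cL2B (L12 n).2 Lf).1|].
  by move: ff; apply: aeS => x /[apply] ->.
rewrite (_ : (fun n => _) = (fun n => n2 (fun x => fourierL1 (f_ n) x - g x)))//.
have LF n := (fourierL1_n2 (L12 n).1 (L12 n).2).1.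
apply/funext => n; apply: ae_eq_n2; [exact: (cL2B (LF n) Lg').1|exact: (cL2B (LF n) Lg).1|].
by move: gg; apply: aeS => x /[apply] ->.
Qed.

Lemma n2_cvgD (u v : nat -> R -> R[i]) f g : (forall n, cL2 (u n)) -> (forall n, cL2 (v n)) ->
  cL2 f -> cL2 g -> n2 (fun x => u n x - f x) @[n --> \oo] --> 0 ->
  n2 (fun x => v n x - g x) @[n --> \oo] --> 0 ->
  n2 (fun x => (u n x + v n x) - (f x + g x)) @[n --> \oo] --> 0.
Proof.
move=> Lu Lv Lf Lg c1 c2.
apply: (@cvg_dist_le _ _ (fun n => 2 * n2 (fun x => u n x - f x) + 2 * n2 (fun x => v n x - g x))).
  move=> n; rewrite subr0 ger0_norm ?n2_ge0//.
  rewrite (_ : (fun x => _) = fun x => (u n x - f x) + (v n x - g x)).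
    by apply: n2D; exact: cL2B.
  by apply/funext => x; ring.
rewrite -[X in _ --> X](_ : 2 * 0 + 2 * 0 = 0); last by rewrite mulr0 addr0.
by apply: cvgD; apply: cvgM => //; exact: cvg_cst.
Qed.

Lemma isFD f g f' g' : isF f g -> isF f' g' ->
  isF (fun x => f x + f' x) (fun p => g p + g' p).
Proof.
move=> [Lf Lg [f_ [L12 c1 c2]]] [Lf' Lg' [h_ [M12 d1 d2]]].
split; [exact: cL2D|exact: cL2D|].
exists (fun n x => f_ n x + h_ n x); split.
- move=> n; split; first exact: cL1D (L12 n).1 (M12 n).1.
  exact: cL2D (L12 n).2 (M12 n).2.
- by apply: n2_cvgD => // n; [exact: (L12 n).2|exact: (M12 n).2].
- rewrite (_ : (fun n => _) = fun n => n2 (fun p =>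
      (fourierL1 (f_ n) p + fourierL1 (h_ n) p) - (g p + g' p))).
    apply: n2_cvgD => // n.
      exact: (fourierL1_n2 (L12 n).1 (L12 n).2).1.
    exact: (fourierL1_n2 (M12 n).1 (M12 n).2).1.
  apply/funext => n; congr n2; apply/funext => p.
  by rewrite fourierL1D; [|exact: (L12 n).1|exact: (M12 n).1].
Qed.

Lemma n2_cvgZ (c : R[i]) (u : nat -> R -> R[i]) f : (forall n, cL2 (u n)) ->
  cL2 f -> n2 (fun x => u n x - f x) @[n --> \oo] --> 0 ->
  n2 (fun x => c * u n x - c * f x) @[n --> \oo] --> 0.
Proof.
move=> Lu Lf c1.
rewrite (_ : (fun n => _) = fun n => normc c ^+ 2 * n2 (fun x => u n x - f x)).
  by rewrite -[X in _ --> X](mulr0 (normc c ^+ 2)); apply: cvgM => //; exact: cvg_cst.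
apply/funext => n; rewrite -n2Z; last exact: cL2B.
by congr n2; apply/funext => x; rewrite mulrBr.
Qed.

Lemma isFZ (c : R[i]) f g : isF f g -> isF (fun x => c * f x) (fun p => c * g p).
Proof.
move=> [Lf Lg [f_ [L12 c1 c2]]]; split; [exact: cL2Z|exact: cL2Z|].
exists (fun n x => c * f_ n x); split.
- by move=> n; split; [exact: cL1Z (L12 n).1|exact: cL2Z (L12 n).2].
- by apply: n2_cvgZ => // n; exact: (L12 n).2.
- rewrite (_ : (fun n => _) = fun n => n2 (fun p => c * fourierL1 (f_ n) p - c * g p)).
    by apply: n2_cvgZ => // n; exact: (fourierL1_n2 (L12 n).1 (L12 n).2).1.
  apply/funext => n; congr n2; apply/funext => p.
  by rewrite fourierL1Z//; exact: (L12 n).1.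
Qed.

Lemma isFB f g f' g' : isF f g -> isF f' g' ->
  isF (fun x => f x - f' x) (fun p => g p - g' p).
Proof.
move=> Hf /(isFZ (-1)) Hf'; have := isFD Hf Hf'.
by under eq_fun do rewrite mulN1r; under [X in isF _ X]eq_fun do rewrite mulN1r.
Qed.

Lemma isF0 : isF (fun=> 0) (fun=> 0).
Proof.
have [g Hg] := isF_exists cL20.
by have := isFZ 0 Hg; under eq_fun do rewrite mul0r; under [X in isF _ X]eq_fun do rewrite mul0r.
Qed.

Lemma isF_sum (I : Type) (s : seq I) (F G : I -> R -> R[i]) :
  (forall i, isF (F i) (G i)) ->
  isF (fun x => \sum_(i <- s) F i x) (fun p => \sum_(i <- s) G i p).
Proof.
move=> H; elim: s => [|i s IH].
  rewrite (_ : (fun x => \sum_(i <- [::]) F i x) = fun=> 0).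
    rewrite (_ : (fun x => _) = fun=> 0); first exact: isF0.
    by apply/funext => x; rewrite big_nil.
  by apply/funext => x; rewrite big_nil.
rewrite (_ : (fun x => \sum_(j <- (i :: s)) F j x) = fun x => F i x + \sum_(j <- s) F j x).
  rewrite (_ : (fun x => \sum_(j <- (i :: s)) G j x) = fun x => G i x + \sum_(j <- s) G j x).
    exact: isFD.
  by apply/funext => x; rewrite big_cons.
by apply/funext => x; rewrite big_cons.
Qed.

(** By duality the integral of a transform of [f] over an interval is the pairing of [f] with the
    transform of the indicator, which is the same for [g] and [g']. *)
Lemma isF_unique f g g' : isF f g -> isF f g' -> ae_eq mu setT g g'.
Proof.
move=> H H'; have [_ Lg _] := H; have [_ Lg' _] := H'.
have : ae_eq mu setT (fun p => g p - g' p) (fun=> 0).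
  apply: cL2_itv_eq0; first exact: cL2B.
  move=> c d _.
  have Hc := isF_L1 (cL1_cind c d) (cL2_cind c d).
  rewrite (_ : (fun x => _) = (fun x => g x * cind c d x - g' x * cind c d x)).
    rewrite ciB; [|exact: cL2M Lg (cL2_cind _ _)|exact: cL2M Lg' (cL2_cind _ _)].
    by rewrite (isF_dual H Hc) (isF_dual H' Hc) subrr.
  by apply/funext => x; rewrite mulrBl.
by apply: aeS => x /[apply] /eqP; rewrite subr_eq0 => /eqP.
Qed.

Lemma isF_fourier f : cL2 f -> isF f (fourier f).
Proof.
move=> /isF_exists[g /is_fourierP Hg]; apply/is_fourierP.
by have := @xgetPex _ (fun=> 0) [set g | is_fourier f g] (ex_intro _ g Hg).
Qed.

End FourierL2.

(** * Fourier inversion *)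

Section FourierInversion.
Context {R : realType}.
Local Notation mu := (@lebesgue_measure R).
Implicit Types f g : R -> R[i].

Lemma atan_scale_cvg_gt0 (t : R) : 0 < t ->
  atan (t / k.+1%:R^-1) @[k --> \oo] --> pi / 2.
Proof.
move=> t0; apply: (cvg_comp _ _ _ (@cvgy_atan R)); apply/cvgryPge => A.
exists (Num.bound (A / t)) => // k /= Nk.
rewrite invrK -ler_pdivrMl// mulrC.
have [A0|A0] := leP (A / t) 0; first by rewrite (le_trans A0).
have H := ltW (archi_boundP (ltW A0)).
by rewrite (le_trans H)// ler_nat (leq_trans Nk).
Qed.

Lemma atan_scale_cvg_lt0 (t : R) : t < 0 ->
  atan (t / k.+1%:R^-1) @[k --> \oo] --> - (pi / 2).
Proof.
move=> t0; have nt0 : 0 < - t by rewrite oppr_gt0.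
apply: cvg_trans (cvgN (atan_scale_cvg_gt0 nt0)).
apply: near_eq_cvg; apply: nearW => k /=.
by rewrite fctE mulNr atanN opprK.
Qed.

(** Each arctangent tends to plus or minus pi / 2 according to the sign of its argument. The two
    excluded points are the ends of the interval, where the limit would be pi. *)
Lemma poisson_itv_cvg (a b y : R) : a < b -> y != - a -> y != - b ->
  2 * (atan ((b + y) / k.+1%:R^-1) - atan ((a + y) / k.+1%:R^-1)) @[k --> \oo]
    --> 2 * pi * \1_`[- b, - a] y.
Proof.
move=> ab ya yb.
have [by0|by0] := ltP 0 (b + y); have [ay0|ay0] := ltP 0 (a + y).
- have -> : \1_`[- b, - a] y = 0 :> R.
    have ya1 : - a < y by rewrite -subr_gt0 opprK addrC.
    by rewrite indicE mem_setE in_itv/= [y <= - a]leNgt ya1 andbF.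
  rewrite mulr0 -[X in _ --> X](mulr0 2) -[X in 2 * X](subrr (pi / 2)).
  by apply: cvgM; [exact: cvg_cst|apply: cvgB; exact: atan_scale_cvg_gt0].
- have ya1 : y <= - a by rewrite -subr_le0 opprK addrC.
  have by1 : - b <= y by rewrite -subr_ge0 opprK addrC ltW.
  have -> : \1_`[- b, - a] y = 1 :> R.
    by rewrite indicE mem_setE in_itv/= by1 ya1.
  have ay1 : a + y < 0.
    rewrite lt_neqAle ay0 andbT; apply: contra ya => /eqP H.
    by rewrite -(addrK a y) [y + a]addrC H sub0r.
  rewrite mulr1 [pi in X in _ --> X]splitr -[X in 2 * (_ + X)]opprK.
  apply: cvgM; first exact: cvg_cst.
  by apply: cvgB; [exact: atan_scale_cvg_gt0|exact: atan_scale_cvg_lt0].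
- have : a + y < b + y by rewrite ltrD2r.
  by move=> /(lt_trans ay0); rewrite ltNge by0.
- have by1 : b + y < 0.
    rewrite lt_neqAle by0 andbT; apply: contra yb => /eqP H.
    by rewrite -(addrK b y) [y + b]addrC H sub0r.
  have ay1 : a + y < 0 by apply: lt_trans by1; rewrite ltrD2r.
  have -> : \1_`[- b, - a] y = 0 :> R.
    have yb1 : y < - b by rewrite -subr_lt0 opprK addrC.
    by rewrite indicE mem_setE in_itv/= [- b <= y]leNgt yb1.
  rewrite mulr0 -[X in _ --> X](mulr0 2) -[X in 2 * X](subrr (- (pi / 2))).
  apply: cvgM; first exact: cvg_cst.
  by apply: cvgB; exact: atan_scale_cvg_lt0.
Qed.

Definition fcind (c d : R) : R -> R[i] := fourierL1 (cind c d).

Lemma isF_cind c d : isF (cind c d) (fcind c d).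
Proof. exact: isF_L1 (cL1_cind c d) (cL2_cind c d). Qed.

(** Duality moves one transform onto the other factors; a second use of duality, with
    [pker e (- y)], gives the Poisson integral of the indicator of [a, b]. *)
Lemma ci_fcindM_damped (c d a b e : R) : a < b -> 0 < e ->
  ci (fun x => fcind c d x * fcind a b x * (wexp e x)%:C) =
  ci (fun y => cind c d y * (2 * (atan ((b + y) / e) - atan ((a + y) / e)))%:C).
Proof.
move=> ab e0.
have mF := cmeas_fourierL1 (cL1_meas (cL1_cind a b)).
have bF p := normc_fourierL1_le p (cL1_cind a b).
have Lg : cL1 (fun x => (wexp e x)%:C * fcind a b x).
  by apply: (cL1M_bounded _ mF bF); exact/cL1_real/rL1_wexp.
have := fourierL1_duality (cL1_cind c d) Lg.
rewrite (_ : (fun p => _) = (fun x => fcind c d x * fcind a b x * (wexp e x)%:C)); last first.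
  by apply/funext => x; rewrite [(wexp e x)%:C * _]mulrC mulrA.
move=> ->; congr ci; apply/funext => y; congr (_ * _).
rewrite fourierL1E.
rewrite (_ : (fun x => _) = (fun x => fcind a b x * pker e (- y) x)); last first.
  apply/funext => x; rewrite /pker mulNr [y * x]mulrC.
  by rewrite [(wexp e x)%:C * _]mulrC -mulrA.
rewrite fourierL1_duality; [|exact: cL1_cind|exact: cL1_pker].
rewrite -(@rI_poisson_itv _ e y a b e0 (ltW ab)) -ci_real.
congr ci; apply/funext => x.
by rewrite fourierL1_pker// /cind -realcM mulrC opprK.
Qed.

(** Removes the damping on both sides by dominated convergence. On the left the majorant is a
    product of two L^2 functions, integrable by Cauchy-Schwarz; on the right it is 2 pi on
    [c, d]. *)
Lemma ci_fcindM (c d a b : R) : a < b ->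
  ci (fun x => fcind c d x * fcind a b x) =
  ci (fun y => cind c d y * (2 * pi * \1_`[- b, - a] y)%:C).
Proof.
move=> ab.
have LF c1 d1 := (fourierL1_n2 (cL1_cind c1 d1) (cL2_cind c1 d1)).1.
have LFF : cL1 (fun x => fcind c d x * fcind a b x) by apply: cL2M; exact: LF.
have e0 k : 0 < k.+1%:R^-1 :> R by rewrite invr_gt0.
have [|||||_ C1] := @ci_cvg R
   (fun k x => fcind c d x * fcind a b x * (wexp k.+1%:R^-1 x)%:C)
   (fun x => fcind c d x * fcind a b x)
   (fun x => normc (fcind c d x * fcind a b x)).
- move=> k; apply: cmeasM; first exact: cL1_meas LFF.
  by apply: cmeas_real; exact: measurable_wexp.
- exact: cL1_meas LFF.
- apply: aeT => x; rewrite -[X in ccvg _ X]mulr1.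
  apply: ccvgM; first exact: ccvg_cst.
  by apply: ccvg_real; exact: wexp_cvg1.
- exact: rL1_normc LFF.
- move=> k x; rewrite Normc.normcM ler_piMr ?normc_ge0//.
  by rewrite normc_real ger0_norm ?wexp_le1// ltW// wexp_gt0.
have [|||||_ C2] := @ci_cvg R
   (fun k y => cind c d y * (2 * (atan ((b + y) / k.+1%:R^-1) - atan ((a + y) / k.+1%:R^-1)))%:C)
   (fun y => cind c d y * (2 * pi * \1_`[- b, - a] y)%:C)
   (fun y => 2 * pi * \1_`[c, d] y).
- move=> k; apply: cmeasM; first exact: cmeas_cind.
  have mat (a1 : R) : measurable_fun setT (fun y : R => atan ((a1 + y) / k.+1%:R^-1)).
    apply: (measurableT_comp (f := @atan R)).
      exact: (continuous_measurable_fun (@continuous_atan R)).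
    apply: measurable_funM; last exact: measurable_cst.
    by apply: measurable_funD; [exact: measurable_cst|exact: measurable_id].
  apply: cmeas_real; apply: measurable_funM; first exact: measurable_cst.
  by apply: measurable_funB; exact: mat.
- apply: cmeasM; first exact: cmeas_cind.
  apply: cmeas_real; apply: measurable_funM; first exact: measurable_cst.
  exact: measurable_indic.
- apply: (aeI _ (neq_ae (- a)) (neq_ae (- b))) => y ya yb.
  by apply: ccvgM; [exact: ccvg_cst|apply: ccvg_real; exact: poisson_itv_cvg].
- exact/rL1Z/rL1_indic_itv.
- move=> k y; rewrite Normc.normcM !normc_real mulrC [`|\1_ _ _|]ger0_norm//.
  apply: ler_wpM2r => //.
  set s := atan _; set t := atan _.
  have s1 : - (pi / 2) < s < pi / 2 by rewrite atan_gtNpi2 atan_ltpi2.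
  have t1 : - (pi / 2) < t < pi / 2 by rewrite atan_gtNpi2 atan_ltpi2.
  by rewrite ler_norml; move: s1 t1 => /andP[? ?] /andP[? ?]; apply/andP; split; lra.
apply: (ccvg_unique C1).
rewrite (_ : (fun n => _) = (fun n => ci (fun y => cind c d y *
   (2 * (atan ((b + y) / n.+1%:R^-1) - atan ((a + y) / n.+1%:R^-1)))%:C)))//.
by apply/funext => k; exact: ci_fcindM_damped.
Qed.

Lemma cindN (c d x : R) : cind c d (- x) = cind (- d) (- c) x.
Proof. by rewrite /cind !indicE !mem_setE !in_itv/= lerNr lerNl andbC. Qed.

(** Inversion for indicators: integrated over [a, b], the transform of [fcind c d] becomes a pairing
    of two transforms, which [ci_fcindM] evaluates. *)
Lemma isF_fcind (c d : R) : isF (fcind c d) (fun x => (2 * pi)%:C * cind c d (- x)).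
Proof.
have [_ LF _] := isF_cind c d.
have [h H] := isF_exists LF; have [_ Lh _] := H.
have Lc : cL2 (fun x => (2 * pi)%:C * cind c d (- x)).
  by apply: cL2Z; exact: (cL2_preserves preserves_mu_oppr (cL2_cind c d)).
apply: (isF_ae H _ Lc.1); [exact: LF.1|by apply: aeT|].
have : ae_eq mu setT (fun x => h x - (2 * pi)%:C * cind c d (- x)) (fun=> 0).
  apply: cL2_itv_eq0; first exact: cL2B.
  move=> a b ab.
  rewrite (_ : (fun x => _) = (fun x => h x * cind a b x - (2 * pi)%:C * cind c d (- x) * cind a b x)).
    rewrite ciB; [|exact: cL2M Lh (cL2_cind _ _)|exact: cL2M Lc (cL2_cind _ _)].
    rewrite (isF_dual H (isF_cind a b)) ci_fcindM//.
    rewrite -(ci_preserves preserves_mu_oppr); last first.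
      apply: cmeasM; first exact: cmeas_cind.
      by apply: cmeas_real; apply: measurable_funM; [exact: measurable_cst|exact: measurable_indic].
    apply/eqP; rewrite subr_eq0; apply/eqP; congr ci; apply/funext => x.
    have := cindN (- b) (- a) x; rewrite !opprK /cind => <-.
    by rewrite realcM mulrCA mulrA.
  by apply/funext => x; rewrite mulrBl.
by apply: aeS => x /[apply] /eqP; rewrite subr_eq0 => /eqP.
Qed.

(** Duality twice: the integral of the second transform over an interval becomes the pairing of [g]
    with [fcind], then that of [f] with the transform of [fcind], known from [isF_fcind]. *)
Lemma isF_inversion f g : isF f g -> isF g (fun x => (2 * pi)%:C * f (- x)).
Proof.
move=> H; have [Lf Lg _] := H.
have [h Hh] := isF_exists Lg; have [_ Lh _] := Hh.
have Lfn : cL2 (fun x => (2 * pi)%:C * f (- x)).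
  by apply: cL2Z; exact: (cL2_preserves preserves_mu_oppr Lf).
apply: (isF_ae Hh _ Lfn.1); [exact: Lg.1|by apply: aeT|].
have : ae_eq mu setT (fun x => h x - (2 * pi)%:C * f (- x)) (fun=> 0).
  apply: cL2_itv_eq0; first exact: cL2B.
  move=> c d cd.
  rewrite (_ : (fun x => _) = (fun x => h x * cind c d x - (2 * pi)%:C * f (- x) * cind c d x)).
    rewrite ciB; [|exact: cL2M Lh (cL2_cind _ _)|exact: cL2M Lfn (cL2_cind _ _)].
    rewrite (isF_dual Hh (isF_cind c d)) (isF_dual H (isF_fcind c d)).
    rewrite -(ci_preserves preserves_mu_oppr); last first.
      apply: cmeasM; first exact: Lf.1.
      by apply: cmeasM; [exact: cmeas_cst|exact: (cmeas_preserves preserves_mu_oppr (cmeas_cind c d))].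
    apply/eqP; rewrite subr_eq0; apply/eqP; congr ci; apply/funext => x.
    by rewrite opprK mulrCA mulrA.
  by apply/funext => x; rewrite mulrBl.
by apply: aeS => x /[apply] /eqP; rewrite subr_eq0 => /eqP.
Qed.

Lemma twopi_neq0 : (2 * pi)%:C != 0 :> R[i].
Proof.
have p0 : 0 < 2 * pi :> R by apply: mulr_gt0; [exact: ltr0Sn|exact: pi_gt0].
by apply/negP => /eqP /(congr1 cRe) /= p1; move: p0; rewrite p1 ltxx.
Qed.

Lemma isF_injective f f' g : isF f g -> isF f' g -> ae_eq mu setT f f'.
Proof.
move=> /isF_inversion H /isF_inversion H'.
have E : {ae mu, forall x, f (- x) = f' (- x)}.
  have := isF_unique H H'; apply: aeS => x /(_ I) /(mulfI twopi_neq0) //.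
have := ae_preserves preserves_mu_oppr E.
by apply: aeS => x; rewrite opprK.
Qed.

Lemma isF_reflect f g : isF f g -> isF (fun x => f (- x)) (fun p => g (- p)).
Proof.
move=> [Lf Lg [f_ [L12 c1 c2]]].
have po := @preserves_mu_oppr R.
have Ln (h : R -> R[i]) := @cL2_preserves R _ po h.
split; [exact: Ln|exact: Ln|].
exists (fun n x => f_ n (- x)); split.
- by move=> n; split; [exact: (cL1_preserves po (L12 n).1)|exact: Ln (L12 n).2].
- rewrite (_ : (fun n => _) = (fun n => n2 (fun x => f_ n x - f x))); first exact: c1.
  apply/funext => n; rewrite -[RHS](n2_preserves po)//.
  exact: (cL2B (L12 n).2 Lf).1.
- rewrite (_ : (fun n => _) = (fun n => n2 (fun p => fourierL1 (f_ n) p - g p))); first exact: c2.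
  apply/funext => n; rewrite -[RHS](n2_preserves po); last first.
    exact: (cL2B (fourierL1_n2 (L12 n).1 (L12 n).2).1 Lg).1.
  congr n2; apply/funext => p; congr (_ - _); rewrite !fourierL1E.
  rewrite -[LHS](ci_preserves po).
    by congr ci; apply/funext => x; rewrite opprK mulNr mulrN.
  exact/cL1_meas/cL1_expiNM/(cL1_preserves po (L12 n).1).
Qed.

(** The inverse transform as an absolutely convergent integral: for integrable [g] it has a definite
    value at every point, whereas [inv_fourier] gives an arbitrary representative. *)
Definition ifourier g x : R[i] := ((2 * pi)^-1)%:C * ci (fun p => g p * expi (x * p)).

Lemma inv2piC : ((2 * pi)^-1)%:C * (2 * pi)%:C = 1 :> R[i].
Proof.
have p0 : (2 * pi : R) != 0.
  by apply: lt0r_neq0; apply: mulr_gt0; [exact: ltr0Sn|exact: pi_gt0].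
by rewrite -realcM (mulVf p0).
Qed.

(** By inversion, a preimage of [g] is its own transform, reflected and divided by 2 pi. *)
Lemma isF_inv_exists g : cL2 g -> exists f, isF f g.
Proof.
move=> /isF_exists[h /isF_inversion /isF_reflect /(isFZ ((2 * pi)^-1)%:C) H].
exists (fun x => ((2 * pi)^-1)%:C * h (- x)).
by move: H; under [X in isF _ X]eq_fun do rewrite opprK mulrA inv2piC mul1r.
Qed.

Lemma isF_ifourier g : cL1 g -> cL2 g -> isF (ifourier g) g.
Proof.
move=> L1 L2; have := isFZ ((2 * pi)^-1)%:C (isF_reflect (isF_inversion (isF_L1 L1 L2))).
under [X in isF _ X -> _]eq_fun do rewrite opprK mulrA inv2piC mul1r.
congr (isF _ g); apply/funext => x; rewrite /ifourier fourierL1E; congr (_ * ci _).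
by apply/funext => p; rewrite mulrN opprK [p * x]mulrC.
Qed.

Lemma isF_inv_fourier g : cL2 g -> isF (inv_fourier g) g.
Proof.
move=> /isF_inv_exists[f /is_fourierP Hf]; apply/is_fourierP.
by have := @xgetPex _ (fun=> 0) [set f | is_fourier f g] (ex_intro _ f Hf).
Qed.

End FourierInversion.

Section ExpiLipschitz.
Context {R : realType}.

Lemma lipschitz_of_derive (f df : R -> R) (a b : R) : (forall x : R, is_derive x 1 f (df x)) ->
  (forall x, `|df x| <= 1) -> `|f a - f b| <= `|a - b|.
Proof.
move=> fdf df1; wlog ba : a b / b <= a.
  by move=> H; have [/H//|/ltW/H] := leP b a; rewrite distrC [`|a - b|]distrC.
have [c _ ->] := @MVT_segment R f df b a ba (fun x _ => fdf x)
  (continuous_subspaceT (fun x => is_derive_continuous (fdf x))).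
by rewrite normrM ler_piMl.
Qed.

(** The constant 2 comes from treating the real and imaginary parts separately. *)
Lemma normc_expiB_le (a b : R) : normc (expi a - expi b) <= 2 * `|a - b|.
Proof.
rewrite (le_trans (normc_le_ReIm _))// mulr_natl mulr2n lerD//=.
  apply: (lipschitz_of_derive _ _ (fun x => is_derive_cos x)) => x.
  by rewrite normrN ler_norml sin_geN1 sin_le1.
apply: (lipschitz_of_derive _ _ (fun x => is_derive_sin x)) => x.
by rewrite ler_norml cos_geN1 cos_le1.
Qed.

End ExpiLipschitz.

(** * The Duhamel integrand in frequency *)

Section BoundedCompactSupport.
Context {R : realType}.
Local Notation mu := (@lebesgue_measure R).
Implicit Types f g V : R -> R[i].

(** One pointwise inequality encodes both the bound and the support, and its right side serves
    directly as an integrable majorant. *)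
Definition bcs (M c d : R) f : Prop :=
  cmeas f /\ forall x, normc (f x) <= M * \1_`[c, d] x.

Lemma bcs_cL12 M c d f : bcs M c d f -> cL1 f /\ cL2 f.
Proof. by move=> [mf fM]; exact: cL2_bounded_itv fM. Qed.

Lemma bcs_le M c d f x : 0 <= M -> bcs M c d f -> normc (f x) <= M.
Proof.
move=> M0 [_ /(_ x)/le_trans]; apply.
by rewrite ler_piMr// indicE; case: (_ \in _).
Qed.

Lemma bcs_out M c d f x : bcs M c d f -> x \notin `[c, d]%classic -> f x = 0.
Proof.
move=> [_ /(_ x) H] xcd; apply: Normc.eq0_normc; apply/eqP.
by rewrite eq_le normc_ge0 andbT (le_trans H)// indicE (negbTE xcd) mulr0.
Qed.

Lemma bcsM_unit M c d f (u : R -> R[i]) : bcs M c d f -> cmeas u ->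
  (forall x, normc (u x) = 1) -> bcs M c d (fun x => u x * f x).
Proof.
move=> [mf fM] mu1 u1; split; first exact: cmeasM.
by move=> x; rewrite Normc.normcM u1 mul1r.
Qed.

Lemma Cn_continuous n f : Cn n f -> continuous (cRe \o f) /\ continuous (cIm \o f).
Proof.
have H (h : R -> R) : (forall j, (j < n)%N -> forall x, derivable (derive1n j h) x 1) /\
    continuous (derive1n n h) -> continuous h.
  case: n => [[_]//|n [H _] x].
  by apply: differentiable_continuous; apply/derivable1_diffP; exact: (H 0%N).
by move=> Hf; split; apply: H; apply: Hf; [left|right].
Qed.

(** The extreme value theorem bounds the real and imaginary parts on the compact interval; the bound
    is the sum of the two maxima. *)
Lemma Cn_bcs n f (c d : R) : c <= d -> Cn n f -> supp f `<=` `[c, d] ->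
  exists2 M, 0 <= M & bcs M c d f.
Proof.
move=> cd /Cn_continuous[c1 c2] sf.
have mf : cmeas f by split; exact: continuous_measurable_fun.
have f0 x : x \notin `[c, d]%classic -> f x = 0.
  rewrite notin_setE => xcd; apply: contra_notP xcd => /eqP fx.
  by apply: sf; apply: subset_closure.
have ne : `[c, d]%classic !=set0 by exists c; rewrite /= in_itv/= lexx.
have bnd (h : R -> R) : continuous h -> exists2 B, 0 <= B & forall x, x \in `[c, d]%classic -> `|h x| <= B.
  move=> ch.
  have [x0 _ Hx0] := @compact_EVT_max _ R (fun x => `|h x|) `[c, d] ne (@segment_compact R c d)
    (continuous_subspaceT (fun x => cvg_norm (ch x))).
  by exists `|h x0| => // x xcd; exact: Hx0.
have [B1 B10 H1] := bnd _ c1; have [B2 B20 H2] := bnd _ c2.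
exists (B1 + B2); first exact: addr_ge0.
split => // x; rewrite indicE; have [xcd|xcd] := boolP (x \in _).
  by rewrite mulr1 (le_trans (normc_le_ReIm _))// lerD//; [exact: H1|exact: H2].
by rewrite mulr0 f0// Normc.normc0.
Qed.

(** [S1] multiplies the chosen representative [fourier f], which agrees with [g] only almost
    everywhere, so [isF_ae] makes the exchange. *)
Lemma isF_S1 (t : R) f g : isF f g ->
  isF (S1 t f) (fun p => expi (- (t * p ^+ 2)) * g p).
Proof.
move=> Hf; have [Lf Lg _] := Hf.
have mu1 : cmeas (fun p : R => expi (- (t * p ^+ 2))).
  apply: cmeas_expi; apply: measurable_funN.
  by apply: measurable_funM; [exact: measurable_cst|exact: exprn_measurable].
have u1 (p : R) : normc (expi (- (t * p ^+ 2))) <= 1 by rewrite normc_expi.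
have HF := isF_fourier Lf; have [_ LF _] := HF.
have H := isF_inv_fourier (cL2M_bounded LF mu1 u1).
apply: (isF_ae H).
- by have [[]] := H.
- exact: (cL2M_bounded Lg mu1 u1).1.
- exact: aeT.
- by have := isF_unique HF Hf; apply: aeS => p /[apply] ->.
Qed.

(** The integrand is nonzero only if y lies in the first interval and p - y in the second, so p lies
    in their sum; the integration runs over a length d1 - c1. *)
Lemma convolution_bcs M1 c1 d1 f M2 c2 d2 g : 0 <= M1 -> 0 <= M2 -> c1 <= d1 ->
  bcs M1 c1 d1 f -> bcs M2 c2 d2 g ->
  bcs (M1 * M2 * (d1 - c1)) (c1 + c2) (d1 + d2) (convolution f g).
Proof.
move=> M10 M20 cd1 Hf Hg; have [mf fM] := Hf; have [mg gM] := Hg.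
have mF : cmeas (fun z : R * R => f z.2 * g (z.1 - z.2)).
  apply: cmeasM; first by apply: (cmeas_comp mf); exact: measurable_snd.
  apply: (cmeas_comp mg); apply: measurable_funB; [exact: measurable_fst|exact: measurable_snd].
split; first exact: (cmeas_ci mF).
move=> p.
pose H := M1 * M2 * \1_`[c1 + c2, d1 + d2] p.
have bnd y : normc (f y * g (p - y)) <= H * \1_`[c1, d1] y.
  rewrite Normc.normcM; have := fM y; have := gM (p - y); rewrite /H !indicE !mem_setE !in_itv/=.
  have [y1|y1] := boolP (c1 <= y <= d1); rewrite ?mulr1 ?mulr0; last first.
    move=> _ fy0; have -> : normc (f y) = 0 by apply/eqP; rewrite eq_le fy0 normc_ge0.
    by rewrite mul0r.
  have [p1|p1] := boolP (c2 <= p - y <= d2); rewrite ?mulr1 ?mulr0; last first.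
    move=> gy0 _; have -> : normc (g (p - y)) = 0 by apply/eqP; rewrite eq_le gy0 normc_ge0.
    by rewrite mulr0 !mulr_ge0.
  have -> : c1 + c2 <= p <= d1 + d2.
    by move: y1 p1 => /andP[? ?] /andP[? ?]; apply/andP; split; lra.
  by rewrite mulr1 => gM2 fM1; apply: ler_pM; rewrite ?normc_ge0.
have L : cL1 (fun y => f y * g (p - y)).
  apply: (cL1_le _ bnd); last exact/rL1Z/rL1_indic_itv.
  apply: cmeasM => //; apply: (cmeas_comp mg).
  by apply: measurable_funB; [exact: measurable_cst|exact: measurable_id].
rewrite /convolution; apply: (le_trans (normc_ci_le L)).
apply: (@le_trans _ _ (rI (fun y => H * \1_`[c1, d1] y))).
  by apply: rI_le => //; [exact: rL1_normc|exact/rL1Z/rL1_indic_itv].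
rewrite rIZ; last exact: rL1_indic_itv.
by rewrite rI_indic_itv// /H mulrAC.
Qed.

(** The convolution theorem, valid at every x: translate the inner variable and apply Fubini. Of the
    two factors 1 / (2 pi) on the left, one is absorbed by [ifourier] on the right. *)
Lemma ifourierM M1 c1 d1 f M2 c2 d2 g x : 0 <= M1 -> 0 <= M2 -> 
  bcs M1 c1 d1 f -> bcs M2 c2 d2 g ->
  ifourier f x * ifourier g x = ((2 * pi)^-1)%:C * ifourier (convolution f g) x.
Proof.
move=> M10 M20 Hf Hg; have [mf fM] := Hf; have [mg gM] := Hg.
have [Lf _] := bcs_cL12 Hf; have [Lg _] := bcs_cL12 Hg.
have me : measurable_fun setT (fun p : R => x * p).
  by apply: measurable_funM; [exact: measurable_cst|exact: measurable_id].
have Lfe := cL1_expi Lf me; have Lge := cL1_expi Lg me.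
rewrite /ifourier; set k := ((2 * pi)^-1)%:C.
rewrite mulrACA -[k * k * _]mulrA; congr (k * (k * _)).
rewrite -ciZr//.
pose F (z : R * R) := f z.1 * g (z.2 - z.1) * expi (x * z.2).
have mF : cmeas F.
  apply: cmeasM.
    apply: cmeasM; first by apply: (cmeas_comp mf); exact: measurable_fst.
    apply: (cmeas_comp mg); apply: measurable_funB; [exact: measurable_snd|exact: measurable_fst].
  by apply: cmeas_expi; apply: measurable_funM; [exact: measurable_cst|exact: measurable_snd].
have bF y p : normc (F (y, p)) <=
    (M1 * M2 * \1_`[c1, d1] y) * \1_`[c1 + c2, d1 + d2] p.
  rewrite /F /= !Normc.normcM normc_expi mulr1.
  have := fM y; have := gM (p - y); rewrite !indicE !mem_setE !in_itv/=.
  have [y1|y1] := boolP (c1 <= y <= d1); rewrite ?mulr1 ?mulr0; last first.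
    move=> _ fy0; have -> : normc (f y) = 0 by apply/eqP; rewrite eq_le fy0 normc_ge0.
    by rewrite !mul0r.
  have [p1|p1] := boolP (c2 <= p - y <= d2); rewrite ?mulr1 ?mulr0; last first.
    move=> gy0 _; have -> : normc (g (p - y)) = 0 by apply/eqP; rewrite eq_le gy0 normc_ge0.
    by rewrite mulr0 !mulr_ge0.
  have -> : c1 + c2 <= p <= d1 + d2.
    by move: y1 p1 => /andP[? ?] /andP[? ?]; apply/andP; split; lra.
  by rewrite mulr1 => gM2 fM1; apply: ler_pM; rewrite ?normc_ge0.
have FE := @ci_fubini R F _ _ mF (rL1Z (M1 * M2) (rL1_indic_itv c1 d1))
  (rL1_indic_itv (c1 + c2) (d1 + d2)) bF.
transitivity (ci (fun y => ci (fun p => F (y, p)))).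
  congr ci; apply/funext => y.
  rewrite -[in LHS](ci_preserves (preserves_mu_subr y)); last exact: cL1_meas Lge.
  rewrite -ciZ; last exact: (cL1_preserves (preserves_mu_subr y) Lge).
  congr ci; apply/funext => p; rewrite /F /=.
  have -> : expi (x * p) = expi (x * y) * expi (x * (p - y)) :> R[i].
    by rewrite -expiD; congr expi; ring.
  by rewrite !mulrA; congr (_ * _); rewrite -!mulrA; congr (_ * _); rewrite mulrC.
rewrite FE; congr ci; apply/funext => p.
have L : cL1 (fun y => f y * g (p - y)).
  apply: (cL1_le _ _ (rL1Z M2 (rL1_normc Lf))).
    apply: cmeasM => //; apply: (cmeas_comp mg).
    by apply: measurable_funB; [exact: measurable_cst|exact: measurable_id].
  move=> y; rewrite Normc.normcM mulrC; apply: ler_wpM2r; first exact: normc_ge0.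
  exact: (bcs_le _ M20 Hg).
exact: (ciZr (expi (x * p)) L).
Qed.

Lemma isF_bcs_ae M c d f g : bcs M c d g -> isF f g -> ae_eq mu setT f (ifourier g).
Proof. by move=> /bcs_cL12[L1 L2] H; exact: isF_injective H (isF_ifourier L1 L2). Qed.

Lemma cmeas_B V g : cmeas V -> cmeas g -> cmeas (B V g).
Proof. by move=> mV mg; apply: cmeasM => //; apply: cmeasM => //; exact: cmeas_cst. Qed.

(** Almost everywhere [V] and [g] equal their explicit inverse transforms, whose product is computed
    pointwise by [ifourierM]. *)
Lemma isF_B M1 c1 d1 V Vhat M2 c2 d2 g ghat : 0 <= M1 -> 0 <= M2 -> c1 <= d1 ->
  bcs M1 c1 d1 Vhat -> bcs M2 c2 d2 ghat -> isF V Vhat -> isF g ghat ->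
  isF (B V g) (fun p => - (0 +i* 1) * ((2 * pi)^-1)%:C * convolution Vhat ghat p).
Proof.
move=> M10 M20 cd1 HV Hg FV Fg.
have [LV _ _] := FV; have [Lg _ _] := Fg.
have Hc := convolution_bcs M10 M20 cd1 HV Hg.
have [Lc1 Lc2] := bcs_cL12 Hc.
have H := isFZ (- (0 +i* 1) * ((2 * pi)^-1)%:C) (isF_ifourier Lc1 Lc2).
have [_ LH _] := H.
apply: (isF_ae H (cmeas_B LV.1 Lg.1) LH.1); last exact: aeT.
apply: (aeI _ (isF_bcs_ae HV FV) (isF_bcs_ae Hg Fg)) => x /(_ I) Vx /(_ I) gx _.
by rewrite /B Vx gx -[RHS]mulrA (ifourierM _ M10 M20 HV Hg) -[LHS]mulrA.
Qed.

End BoundedCompactSupport.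

Section DuhamelSymbol.
Context {R : realType}.
Local Notation mu := (@lebesgue_measure R).
Variables (Vhat uhat : R -> R[i]) (M1 c1 d1 M2 c2 d2 : R).
Hypotheses (M10 : 0 <= M1) (M20 : 0 <= M2) (cd1 : c1 <= d1).
Hypotheses (HV : bcs M1 c1 d1 Vhat) (Hu : bcs M2 c2 d2 uhat).

Let kappa : R[i] := - (0 +i* 1) * ((2 * pi)^-1)%:C.

Definition duhamel (t tau p : R) : R[i] :=
  expi (- ((t - tau) * p ^+ 2)) * (kappa * Wtilde Vhat uhat tau p).

Lemma cmeas_expi_sqr (t : R) : cmeas (fun p : R => expi (- (t * p ^+ 2))).
Proof.
apply: cmeas_expi; apply: measurable_funN.
by apply: measurable_funM; [exact: measurable_cst|exact: exprn_measurable].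
Qed.

Lemma bcs_propagated (tau : R) : bcs M2 c2 d2 (fun q => expi (- (tau * q ^+ 2)) * uhat q).
Proof. by apply: bcsM_unit => //; [exact: cmeas_expi_sqr|move=> x; exact: normc_expi]. Qed.

Lemma isF_duhamel (V u0 : R -> R[i]) (t tau : R) : isF V Vhat -> isF u0 uhat ->
  isF (S1 (t - tau) (B V (S1 tau u0))) (duhamel t tau).
Proof.
move=> FV Fu; apply: isF_S1.
exact: (isF_B M10 M20 cd1 HV (bcs_propagated tau) FV (isF_S1 tau Fu)).
Qed.

Lemma duhamel_bcs (t tau : R) :
  bcs (normc kappa * (M1 * M2 * (d1 - c1))) (c1 + c2) (d1 + d2) (duhamel t tau).
Proof.
have [mW WM] := convolution_bcs M10 M20 cd1 HV (bcs_propagated tau).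
apply: bcsM_unit; [|exact: cmeas_expi_sqr|by move=> x; exact: normc_expi].
split; first by apply: cmeasM => //; exact: cmeas_cst.
by move=> p; rewrite Normc.normcM -[leRHS]mulrA ler_wpM2l ?normc_ge0//; exact: WM.
Qed.

Lemma cL1_convM (p : R) (g : R -> R[i]) (N : R) : cmeas g -> (forall y, normc (g y) <= N) ->
  cL1 (fun y => Vhat y * (g y * uhat (p - y))).
Proof.
move=> mg gN; have [LV _] := bcs_cL12 HV.
apply: (@cL1M_bounded _ _ _ (N * M2)) => //.
  apply: cmeasM => //; apply: (cmeas_comp Hu.1).
  by apply: measurable_funB; [exact: measurable_cst|exact: measurable_id].
move=> y; rewrite Normc.normcM; apply: ler_pM; rewrite ?normc_ge0//.
exact: (bcs_le _ M20 Hu).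
Qed.

(** Once both exponentials stand under the integral in y, the phase is affine in the time variable
    with slope p^2 - (p - y)^2 = y (2p - y), bounded on the supports. *)
Lemma duhamel_lipschitz (t : R) : exists2 L, 0 <= L & forall tau sig p,
  normc (duhamel t tau p - duhamel t sig p) <=
    L * `|tau - sig| * \1_`[c1 + c2, d1 + d2] p.
Proof.
(* [P] and [Y] bound |p| and |y| on the supports, so [K] bounds the slope of the phase; the further
   factor 2 comes from [normc_expiB_le]. *)
pose P : R := `|c1 + c2| + `|d1 + d2|; pose Y : R := `|c1| + `|d1|.
have P0 : 0 <= P by rewrite addr_ge0.
have Y0 : 0 <= Y by rewrite addr_ge0.
pose K : R := Y * (2 * P + Y).
have K0 : 0 <= K by rewrite mulr_ge0// addr_ge0// mulr_ge0.
exists (normc kappa * (2 * K * M2 * M1 * (d1 - c1))).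
  have dc : 0 <= d1 - c1 by rewrite subr_ge0.
  by apply: mulr_ge0; [exact: normc_ge0|do 4!(apply: mulr_ge0 => //)].
have dc : 0 <= d1 - c1 by rewrite subr_ge0.
move=> tau sig p.
have [pI|pI] := boolP (p \in `[c1 + c2, d1 + d2]%classic); last first.
  rewrite (bcs_out (duhamel_bcs t tau) pI) (bcs_out (duhamel_bcs t sig) pI) subrr.
  by rewrite Normc.normc0 indicE (negbTE pI) mulr0.
rewrite indicE pI mulr1.
pose th s y := - ((t - s) * p ^+ 2) + - (s * (p - y) ^+ 2).
have mth s : measurable_fun setT (th s).
  apply: measurable_funD; first exact: measurable_cst.
  apply: measurable_funN; apply: measurable_funM; first exact: measurable_cst.
  apply: measurable_funX; apply: measurable_funB; [exact: measurable_cst|exact: measurable_id].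
have Lth s : cL1 (fun y => Vhat y * (expi (th s y) * uhat (p - y))).
  apply: (@cL1_convM _ _ 1); first exact: cmeas_expi.
  by move=> y; rewrite normc_expi.
have E s : duhamel t s p = kappa * ci (fun y => Vhat y * (expi (th s y) * uhat (p - y))).
  rewrite /duhamel mulrCA; congr (_ * _); rewrite /Wtilde /convolution -/(ci _).
  rewrite -ciZ; last first.
    apply: (@cL1_convM p (fun y => expi (- (s * (p - y) ^+ 2))) 1).
      apply: cmeas_expi; apply: measurable_funN; apply: measurable_funM; first exact: measurable_cst.
      by apply: measurable_funX; apply: measurable_funB; [exact: measurable_cst|exact: measurable_id].
    by move=> y; rewrite normc_expi.
  by congr ci; apply/funext => y; rewrite /th expiD; ring.
rewrite !E -mulrBr -ciB// Normc.normcM -[leRHS]mulrA ler_wpM2l ?normc_ge0//.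
apply: (le_trans (normc_ci_le (cL1B (Lth _) (Lth _)))).
have LR : rL1 (fun y => (2 * K * M2 * M1 * `|tau - sig|) * \1_`[c1, d1] y).
  exact/rL1Z/rL1_indic_itv.
apply: (@le_trans _ _ (rI (fun y => (2 * K * M2 * M1 * `|tau - sig|) * \1_`[c1, d1] y))).
  apply: rI_le => //; first exact/rL1_normc/(cL1B (Lth _) (Lth _)).
  move=> y; rewrite -mulrBr -mulrBl !Normc.normcM.
  have [yI|yI] := boolP (y \in `[c1, d1]%classic); last first.
    by rewrite (bcs_out HV yI) Normc.normc0 mul0r indicE (negbTE yI) mulr0.
  rewrite indicE yI mulr1.
  have thB : normc (expi (th tau y) - expi (th sig y)) <= 2 * K * `|tau - sig|.
    apply: (le_trans (normc_expiB_le _ _)); rewrite -mulrA ler_wpM2l//.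
    have -> : th tau y - th sig y = (y * (2 * p - y)) * (tau - sig) by rewrite /th; ring.
    rewrite normrM ler_wpM2r// normrM.
    have pP : `|p| <= P.
      move: pI; rewrite mem_setE in_itv/= /P => /andP[h1 h2].
      have := ler_norm (d1 + d2); have := ler_norm (- (c1 + c2)); rewrite normrN.
      have := normr_ge0 (d1 + d2); have := normr_ge0 (c1 + c2) => n1 n2 n3 n4.
      by rewrite ler_norml; apply/andP; split; lra.
    have yY : `|y| <= Y.
      move: yI; rewrite mem_setE in_itv/= /Y => /andP[h1 h2].
      have := ler_norm d1; have := ler_norm (- c1); rewrite normrN.
      have := normr_ge0 d1; have := normr_ge0 c1 => n1 n2 n3 n4.
      by rewrite ler_norml; apply/andP; split; lra.
    apply: ler_pM => //; apply: (le_trans (ler_normB _ _)); apply: lerD => //.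
    by rewrite normrM ger0_norm// ler_wpM2l.
  have V1 := bcs_le y M10 HV; have U1 := bcs_le (p - y) M20 Hu.
  have n1 := normc_ge0 (Vhat y); have n2 := normc_ge0 (uhat (p - y)).
  rewrite (_ : 2 * K * M2 * M1 * `|tau - sig| = M1 * (2 * K * `|tau - sig| * M2)); last by ring.
  by apply: ler_pM; rewrite ?mulr_ge0 ?normc_ge0//; apply: ler_pM; rewrite ?normc_ge0.
rewrite rIZ; last exact: rL1_indic_itv.
rewrite rI_indic_itv// le_eqVlt; apply/orP; left; apply/eqP; ring.
Qed.

(** Joint measurability in time and frequency, for Fubini: the convolution is a parameter integral
    of a function measurable on the triple (tau, p, y). *)
Lemma cmeas_duhamel (t : R) : cmeas (fun z : R * R => duhamel t z.1 z.2).
Proof.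
have m1 : measurable_fun setT (fun z : R * R => z.1) by exact: measurable_fst.
have m2 : measurable_fun setT (fun z : R * R => z.2) by exact: measurable_snd.
apply: cmeasM.
  apply: cmeas_expi; apply: measurable_funN; apply: measurable_funM.
    by apply: measurable_funB => //; exact: measurable_cst.
  exact: measurable_funX.
apply: cmeasM; first exact: cmeas_cst.
have mW : cmeas (fun w : (R * R) * R => Vhat w.2 *
    (expi (- (w.1.1 * (w.1.2 - w.2) ^+ 2)) * uhat (w.1.2 - w.2))).
  have w11 : measurable_fun setT (fun w : (R * R) * R => w.1.1).
    by apply: (measurableT_comp m1); exact: measurable_fst.
  have w12 : measurable_fun setT (fun w : (R * R) * R => w.1.2).
    by apply: (measurableT_comp m2); exact: measurable_fst.
  have w2 : measurable_fun setT (fun w : (R * R) * R => w.2) by exact: measurable_snd.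
  have wB : measurable_fun setT (fun w : (R * R) * R => w.1.2 - w.2).
    exact: measurable_funB.
  apply: cmeasM; first exact: (cmeas_comp HV.1).
  apply: cmeasM; last exact: (cmeas_comp Hu.1).
  apply: cmeas_expi; apply: measurable_funN; apply: measurable_funM => //.
  exact: measurable_funX.
exact: (cmeas_ci mW).
Qed.

Lemma cintegralE (D : set R) (f : R -> R[i]) :
  cintegral D f = ci (fun x => f x * (\1_D x)%:C).
Proof.
rewrite ciE /cintegral; congr (_ +i* _); rewrite -rI_itvE; congr rI;
  by apply/funext => x; rewrite ?cRecr ?cImcr.
Qed.

Lemma Wtilde_out (tau p : R) : p \notin `[c1 + c2, d1 + d2]%classic ->
  Wtilde Vhat uhat tau p = 0.
Proof. exact: bcs_out (convolution_bcs M10 M20 cd1 HV (bcs_propagated tau)). Qed.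

Lemma W_out (t p : R) : p \notin `[c1 + c2, d1 + d2]%classic -> W Vhat uhat t p = 0.
Proof.
move=> pI; rewrite /W cintegralE (_ : (fun tau => _) = fun=> 0).
  by rewrite (ci_real (fun=> 0)) rI_cst0 mulr0.
by apply/funext => tau; rewrite Wtilde_out// !mul0r.
Qed.

Lemma cintegral_duhamel (t p : R) : cintegral `[0, t] (fun tau => duhamel t tau p) =
  ((2 * pi)^-1)%:C * (W Vhat uhat t p * expi (- (t * p ^+ 2))).
Proof.
rewrite /W !cintegralE; set g := fun tau : R => _ * (\1_`[0, t] tau)%:C.
set h := fun tau : R => _ * (\1_`[0, t] tau)%:C.
have -> : g = fun tau => (kappa * expi (- (t * p ^+ 2))) * h tau.
  apply/funext => tau; rewrite /g /h /duhamel.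
  have -> : expi (- ((t - tau) * p ^+ 2)) = expi (- (t * p ^+ 2)) * expi (tau * p ^+ 2) :> R[i].
    by rewrite -expiD; congr expi; ring.
  by ring.
rewrite ciZ; first by rewrite /kappa; ring.
rewrite /h; apply: (cL1_le _ _ (rL1Z (M1 * M2 * (d1 - c1)) (rL1_indic_itv 0 t))).
  apply: cmeasM; last exact: cmeas_cind.
  (* Measurability in tau is inherited from [duhamel], of which this is a multiple by a constant in
     tau, since [kappa] is nonzero. *)
  have -> : (fun tau => Wtilde Vhat uhat tau p * expi (tau * p ^+ 2)) =
     fun tau => (kappa^-1 * expi (t * p ^+ 2)) * duhamel t tau p.
    apply/funext => tau; rewrite /duhamel.
    have -> : expi (tau * p ^+ 2) = expi (t * p ^+ 2) * expi (- ((t - tau) * p ^+ 2)) :> R[i].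
      by rewrite -expiD; congr expi; ring.
    have k0 : kappa != 0.
      rewrite /kappa mulf_neq0//.
        by rewrite oppr_eq0; apply/negP => /eqP /(congr1 cIm) /= /eqP; rewrite oner_eq0.
      by apply/negP => /eqP k0; have := @inv2piC R; rewrite k0 mul0r => /eqP; rewrite eq_sym oner_eq0.
    rewrite -[RHS]mulrA [kappa^-1 * _]mulrC; set x := expi _; set y := expi (- _); set w := Wtilde _ _ _ _.
    rewrite (_ : x * (y * (kappa * w)) * kappa^-1 = (w * (x * y)) * (kappa * kappa^-1)); last by ring.
    by rewrite mulfV// mulr1.
  apply: cmeasM; first exact: cmeas_cst.
  exact: (cmeas_comp (cmeas_duhamel t) (pair2_measurable p)).
move=> tau; rewrite !Normc.normcM normc_expi mulr1 normc_real ger0_norm//.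
rewrite ler_wpM2r//.
have [_ /(_ p)/le_trans] := convolution_bcs M10 M20 cd1 HV (bcs_propagated tau); apply.
by rewrite ler_piMr ?mulr_ge0 ?subr_ge0// indicE; case: (_ \in _).
Qed.

End DuhamelSymbol.

(** * Bochner integrals in H^1 *)

Section SobolevNorm.
Context {R : realType}.
Local Notation mu := (@lebesgue_measure R).
Implicit Types f g : R -> R[i].

(* Neither function is assumed measurable: the integral of a nonnegative
   function is a supremum over simple functions below it *)
Lemma ge0_integral_mono (D : set R) (h k : R -> \bar R) :
  (forall x, D x -> 0 <= h x)%E -> (forall x, D x -> h x <= k x)%E ->
  (\int[mu]_(x in D) h x <= \int[mu]_(x in D) k x)%E.
Proof.
move=> h0 hk; have k0 x : D x -> (0 <= k x)%E by move=> Dx; exact: le_trans (h0 x Dx) (hk x Dx).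
rewrite integral_mkcond [leRHS]integral_mkcond.
have p0 (l : R -> \bar R) : (forall x, D x -> 0 <= l x)%E -> forall x, (0 <= (l \_ D) x)%E.
  by move=> l0 x; rewrite patchE; case: ifPn => // /set_mem; exact: l0.
rewrite ge0_integralTE; last exact: p0.
rewrite ge0_integralTE; last exact: p0.
apply: ereal_sup_le => _ [s /= sh <-]; exists s => //= x.
by apply: (le_trans (sh x)); rewrite !patchE; case: ifPn => // /set_mem; exact: hk.
Qed.

Lemma measurable_weight : measurable_fun setT (fun p : R => 1 + p ^+ 2).
Proof. by apply: measurable_funD; [exact: measurable_cst|exact: exprn_measurable]. Qed.

Lemma weight_ge1 (p : R) : 1 <= 1 + p ^+ 2.
Proof. by rewrite lerDl sqr_ge0. Qed.

Lemma measurable_weighted g : cmeas g ->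
  measurable_fun setT (fun p : R => (1 + p ^+ 2) * normc (g p) ^+ 2).
Proof. by move=> mg; apply: measurable_funM; [exact: measurable_weight|exact: measurable_normc2]. Qed.

Lemma sobolev_norm1E f g : isF f g -> sobolev_norm 1 f =
  ((((2 * pi)^-1)%:E * \int[mu]_p ((1 + p ^+ 2) * normc (g p) ^+ 2)%:E) `^ 2^-1)%E.
Proof.
move=> H; have [Lf Lg _] := H.
have HF := isF_fourier Lf; have [_ LF _] := HF.
rewrite /sobolev_norm; congr ((_ * _) `^ _)%E.
under eq_integral do rewrite expr1.
apply: ae_eq_integral => //.
- exact: (measurable_EFin (measurable_weighted LF.1)).
- exact: (measurable_EFin (measurable_weighted Lg.1)).
- by have := isF_unique HF H; apply: aeS => p /[apply] ->.
Qed.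

Lemma sobolev_norm_ge0 s f : (0 <= sobolev_norm s f)%E.
Proof. exact: poweR_ge0. Qed.

Lemma inv2pi_ge0 : 0 <= (2 * pi)^-1 :> R.
Proof. by rewrite invr_ge0; apply: mulr_ge0; [exact: ler0n|exact: pi_ge0]. Qed.

(** The H^1 norm of a function whose transform is the indicator of [c, d]. *)
Definition sobK (c d : R) : R :=
  Num.sqrt ((2 * pi)^-1 * rI (fun p : R => (1 + p ^+ 2) * \1_`[c, d] p)).

Lemma rL1_weight_itv (c d : R) : rL1 (fun p : R => (1 + p ^+ 2) * \1_`[c, d] p).
Proof.
apply: (@rL1_bounded_itv _ _ (1 + (`|c| + `|d|) ^+ 2)); first exact: measurable_weight.
move=> p; rewrite in_itv/= => /andP[cp pd].
rewrite ger0_norm; last by rewrite (le_trans _ (weight_ge1 p)).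
rewrite lerD2l -real_normK ?num_real// ler_sqr ?nnegrE ?addr_ge0//.
have := ler_norm d; have := ler_norm (- c); rewrite normrN.
have := normr_ge0 d; have := normr_ge0 c => n1 n2 n3 n4.
by rewrite ler_norml; apply/andP; split; lra.
Qed.

(** Converts uniform bounds on compactly supported symbols into H^1 bounds; every H^1 estimate of
    the step functions goes through it. *)
Lemma sobolev_norm_le f g (M c d : R) : 0 <= M -> isF f g -> bcs M c d g ->
  (sobolev_norm 1 f <= (M * sobK c d)%:E)%E.
Proof.
move=> M0 H [mg gM].
have LJ := rL1Z (M ^+ 2) (rL1_weight_itv c d).
set J := rI (fun p : R => (1 + p ^+ 2) * \1_`[c, d] p) in LJ *.
have B : (\int[mu]_p ((1 + p ^+ 2) * normc (g p) ^+ 2)%:E <= (M ^+ 2 * J)%:E)%E.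
  rewrite /J -rIZ; last exact: rL1_weight_itv.
  rewrite -(rI_EFin LJ); apply: ge0_le_integral => //.
  - by move=> p _; rewrite lee_fin mulr_ge0 ?sqr_ge0// (le_trans _ (weight_ge1 p)).
  - exact: (measurable_EFin (measurable_weighted mg)).
  - exact: (measurable_EFin (rL1_meas LJ)).
  - move=> p _; rewrite lee_fin [leRHS]mulrCA ler_wpM2l ?(le_trans _ (weight_ge1 p))//.
    have -> : M ^+ 2 * \1_`[c, d] p = (M * \1_`[c, d] p) ^+ 2.
      by rewrite exprMn indicE; case: (_ \in _); rewrite ?expr1n// expr0n.
    by rewrite ler_sqr ?nnegrE ?normc_ge0// (le_trans (normc_ge0 _) (gM p)).
have J0 : 0 <= J.
  by apply: rI_ge0 => p; rewrite mulr_ge0// (le_trans _ (weight_ge1 p)).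
have MK : (M * sobK c d)%:E = ((((2 * pi)^-1)%:E * (M ^+ 2 * J)%:E) `^ 2^-1)%E.
  rewrite -EFinM poweR_EFin powR12_sqrt; last first.
    by apply: mulr_ge0; [exact: inv2pi_ge0|rewrite mulr_ge0// sqr_ge0].
  rewrite mulrCA sqrtrM ?sqr_ge0// sqrtr_sqr ger0_norm//.
rewrite MK (sobolev_norm1E H); apply: gt0_ler_poweR.
- by rewrite invr_ge0.
- rewrite in_itv/= leey andbT mule_ge0 ?lee_fin ?inv2pi_ge0//.
  by apply: integral_ge0 => p _; rewrite lee_fin mulr_ge0 ?sqr_ge0// (le_trans _ (weight_ge1 p)).
- rewrite in_itv/= leey andbT mule_ge0 ?lee_fin ?inv2pi_ge0//.
  by rewrite mulr_ge0// sqr_ge0.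
- by apply: lee_wpmul2l => //; rewrite lee_fin inv2pi_ge0.
Qed.

Lemma sobolev1_bcs f g (M c d : R) : 0 <= M -> isF f g -> bcs M c d g -> sobolev 1 f.
Proof.
move=> M0 H Hg; split; first by apply/cL2P; have [] := H.
by apply: (le_lt_trans (sobolev_norm_le M0 H Hg)); rewrite ltry.
Qed.

(* Cauchy-Schwarz on [c, d], the weight 1 + p^2 being at least 1 *)
Lemma sobolev_norm_ge f g (c d : R) : isF f g -> c < d ->
  ((rI (fun p => normc (g p) * \1_`[c, d] p) / Num.sqrt (2 * pi * (d - c)))%:E
    <= sobolev_norm 1 f)%E.
Proof.
move=> H cd; have [Lf Lg _] := H.
have dc : 0 < d - c by rewrite subr_gt0.
have tp : 0 < 2 * pi :> R by apply: mulr_gt0; [exact: ltr0Sn|exact: pi_gt0].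
set r := rI _.
have r0 : 0 <= r by apply: rI_ge0 => p; rewrite mulr_ge0// normc_ge0.
have CS : r ^+ 2 <= n2 g * (d - c).
  have := cauchy_schwarz Lg (cL2_cind c d).
  have -> : n2 (cind c d) = d - c.
    rewrite -(rI_indic_itv (ltW cd)); congr rI; apply/funext => p.
    by rewrite normc_real real_normK ?num_real// indicE; case: (_ \in _); rewrite ?expr1n// expr0n.
  suff -> : (fun x => normc (g x) * normc (cind c d x)) = (fun p => normc (g p) * \1_`[c, d] p) by [].
  by apply/funext => p; rewrite normc_real ger0_norm.
rewrite (sobolev_norm1E H).
have -> : (r / Num.sqrt (2 * pi * (d - c)))%:E =
    ((((2 * pi)^-1)%:E * (r ^+ 2 / (d - c))%:E) `^ 2^-1)%E.
  rewrite -EFinM poweR_EFin powR12_sqrt; last first.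
    by apply: mulr_ge0; [exact: inv2pi_ge0|rewrite divr_ge0 ?sqr_ge0// ltW].
  rewrite mulrCA -invfM; congr EFin; rewrite [RHS]sqrtrM ?sqr_ge0// sqrtr_sqr [`|r|]ger0_norm// sqrtrV//.
  by apply: mulr_ge0; [exact: ltW|exact: ltW].
apply: gt0_ler_poweR.
- by rewrite invr_ge0.
- rewrite in_itv/= leey andbT mule_ge0 ?lee_fin ?inv2pi_ge0//.
  by rewrite divr_ge0 ?sqr_ge0// ltW.
- rewrite in_itv/= leey andbT mule_ge0 ?lee_fin ?inv2pi_ge0//.
  by apply: integral_ge0 => p _; rewrite lee_fin mulr_ge0 ?sqr_ge0// (le_trans _ (weight_ge1 p)).
- apply: lee_wpmul2l; first by rewrite lee_fin inv2pi_ge0.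
  apply: (@le_trans _ _ (n2 g)%:E); first by rewrite lee_fin ler_pdivrMr.
  rewrite -(rI_EFin Lg.2); apply: ge0_le_integral => //.
  + by move=> p _; rewrite lee_fin sqr_ge0.
  + exact: (measurable_EFin (measurable_normc2 Lg.1)).
  + exact: (measurable_EFin (measurable_weighted Lg.1)).
  + by move=> p _; rewrite lee_fin ler_peMl ?sqr_ge0// weight_ge1.
Qed.

End SobolevNorm.

(** * Simple functions and their transforms *)

Section SimpleFunctions.
Context {R : realType}.
Local Notation mu := (@lebesgue_measure R).

Lemma normc_sum_le (I : Type) (s : seq I) (F : I -> R[i]) :
  normc (\sum_(i <- s) F i) <= \sum_(i <- s) normc (F i).
Proof.
elim: s => [|i s IH]; first by rewrite !big_nil Normc.normc0.
by rewrite !big_cons (le_trans (ler_normcD _ _))// lerD2l.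
Qed.

Lemma indic01 (A : set R) x : 0 <= (\1_A x : R) <= 1.
Proof. by rewrite indicE; case: (_ \in _); rewrite ?lexx ler01. Qed.

Lemma indic_sub (A B : set R) x : A `<=` B -> (\1_A x : R) <= \1_B x.
Proof.
move=> AB; rewrite !indicE ler_nat; have [xA|//] := boolP (x \in A).
by rewrite (mem_set (AB _ (set_mem xA))).
Qed.

Lemma rL1_indic_sub (A : set R) (c d : R) : measurable A -> A `<=` `[c, d] ->
  rL1 (\1_A : R -> R).
Proof.
move=> mA AB; apply: (rL1_le _ _ (rL1_indic_itv c d)); first exact: measurable_indic.
move=> x; rewrite ger0_norm; last by have /andP[] := indic01 A x.
exact: indic_sub.
Qed.

Variables (t : R) (s : simpleH1 (R := R)).
Hypothesis ss : simple_on `[0, t] s.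
Variable chat : 'I_(simple_size s) -> R -> R[i].
Hypothesis hc : forall i, isF (simple_coef (s := s) i) (chat i).

Definition simple_symbol (tau p : R) : R[i] :=
  \sum_i (\1_(simple_set (s := s) i) tau)%:C * chat i p.

Lemma isF_simple_val tau : isF (simple_val s tau) (simple_symbol tau).
Proof. by apply: isF_sum => i; exact: isFZ. Qed.

Lemma rL1_simple_set i : rL1 (\1_(simple_set (s := s) i) : R -> R).
Proof. by have [mA AB _] := ss i; exact: rL1_indic_sub mA AB. Qed.

(** The sum is finite and each coefficient is constant in tau, so integrating the symbol in tau
    replaces each indicator by the measure of its set. *)
Lemma isF_simple_int : isF (simple_int s) (fun p => ci (fun tau => simple_symbol tau p)).
Proof.
rewrite (_ : (fun p => _) = fun p => \sum_i (fine (mu (simple_set (s := s) i)))%:C * chat i p).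
  by apply: isF_sum => i; exact: isFZ.
apply/funext => p; rewrite /simple_symbol.
have L i : cL1 (fun tau => (\1_(simple_set (s := s) i) tau)%:C * chat i p).
  by under eq_fun do rewrite mulrC; apply: cL1Z; exact/cL1_real/rL1_simple_set.
rewrite (ci_sum _ L).2; apply: eq_bigr => i _.
rewrite ciZr; last exact/cL1_real/rL1_simple_set.
rewrite ci_real; congr (_%:C * _); rewrite /rI /Rintegral integral_indic; last first.
- by have [] := ss i.
- exact: measurableT.
- by rewrite setIT.
Qed.

Lemma simple_symbol_out tau p : tau \notin `[0, t]%classic -> simple_symbol tau p = 0.
Proof.
move=> tI; rewrite /simple_symbol big1// => i _.
have [_ AB _] := ss i; rewrite indicE.
have [tA|_] := boolP (tau \in _); last by rewrite mul0r.
by move: tI; rewrite (mem_set (AB _ (set_mem tA))).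
Qed.

Lemma cmeas_simple_symbol : cmeas (fun z : R * R => simple_symbol z.1 z.2).
Proof.
apply: cmeas_sum => i; apply: cmeasM.
  apply: cmeas_real; apply: measurableT_comp; last exact: measurable_fst.
  by apply: measurable_indic; have [] := ss i.
apply: cmeas_comp; last exact: measurable_snd.
by have [_ [m _] _] := hc i.
Qed.

(** A majorant of product form in tau and p, as Fubini requires. *)
Lemma simple_symbol_le tau p :
  normc (simple_symbol tau p) <= \1_`[0, t] tau * \sum_i normc (chat i p).
Proof.
rewrite (le_trans (normc_sum_le _ _))// mulr_sumr; apply: ler_sum => i _.
rewrite Normc.normcM normc_real ger0_norm; last by have /andP[] := indic01 (simple_set (s := s) i) tau.
by rewrite ler_wpM2r ?normc_ge0// indic_sub//; have [] := ss i.
Qed.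

End SimpleFunctions.

(** * Uniqueness of the Bochner integral *)

Section BochnerUnique.
Context {R : realType}.
Local Notation mu := (@lebesgue_measure R).
Variables (t : R) (F Phi : R -> R -> R[i]) (M A B : R).
Hypotheses (M0 : 0 <= M) (HF : forall tau, isF (F tau) (Phi tau)).
Hypothesis HB : forall tau, bcs M A B (Phi tau).
Hypothesis Hm : cmeas (fun z : R * R => Phi z.1 z.2).

Lemma cmeas_Phi1 p : cmeas (fun tau => Phi tau p).
Proof. exact: (cmeas_comp Hm (pair2_measurable p)). Qed.

Lemma normc_Phi_le tau p : normc (Phi tau p) <= M.
Proof. exact: bcs_le M0 (HB tau). Qed.

Lemma cL1_Phi1 p : cL1 (fun tau => Phi tau p * cind 0 t tau).
Proof.
apply: (cL1_le _ _ (rL1Z M (rL1_indic_itv 0 t))).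
  by apply: cmeasM; [exact: cmeas_Phi1|exact: cmeas_cind].
move=> tau; rewrite Normc.normcM normc_real ger0_norm; last by have /andP[] := indic01 `[0, t]%classic tau.
by rewrite ler_wpM2r ?normc_Phi_le//; have /andP[] := indic01 `[0, t]%classic tau.
Qed.

(* Minkowski's integral inequality in a weak form: Fubini needs only the
   integrability on [c, d] of the symbols *)
Lemma simple_int_error (s : simpleH1 (R := R)) chat c d : simple_on `[0, t] s ->
  (forall i, isF (simple_coef (s := s) i) (chat i)) -> c < d ->
  ((rI (fun p => normc (ci (fun tau => simple_symbol chat tau p)
      - cintegral `[0, t] (fun tau => Phi tau p)) * \1_`[c, d] p)
      / Num.sqrt (2 * pi * (d - c)))%:E <=
    \int[mu]_(tau in `[0%R, t]) simple_error F s tau)%E.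
Proof.
move=> ss hc cd.
pose D (z : R * R) := simple_symbol chat z.1 z.2 - Phi z.1 z.2 * cind 0 t z.1.
have mD : cmeas D.
  apply: cmeasB; first exact: (cmeas_simple_symbol ss hc).
  by apply: cmeasM => //; apply: (cmeas_comp (cmeas_cind 0 t)); exact: measurable_fst.
pose S p := \sum_i normc (chat i p).
have S0 p : 0 <= S p by apply: sumr_ge0 => i _; exact: normc_ge0.
have bD tau p : normc (D (tau, p)) <= \1_`[0, t] tau * (S p + M).
  rewrite /D /= (le_trans (ler_normcD _ _))// mulrDr normcN; apply: lerD.
    exact: simple_symbol_le.
  rewrite Normc.normcM mulrC normc_real ger0_norm; last by have /andP[] := indic01 `[0, t]%classic tau.
  by rewrite ler_wpM2l ?normc_Phi_le//; have /andP[] := indic01 `[0, t]%classic tau.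
pose F1 (z : R * R) := \1_`[c, d] z.1 * normc (D (z.2, z.1)).
have mF1 : measurable_fun setT F1.
  apply: measurable_funM.
    by apply: measurableT_comp; [exact: measurable_indic|exact: measurable_fst].
  apply: measurable_normc; apply: (cmeas_comp mD).
  by apply: measurable_fun_pair; [exact: measurable_snd|exact: measurable_fst].
have F10 z : 0 <= F1 z.
  by rewrite mulr_ge0 ?normc_ge0//; have /andP[] := indic01 `[c, d]%classic z.1.
pose k p := (S p + M) * \1_`[c, d] p.
have Lk : rL1 k.
  have Lc i : rL1 (fun p => normc (chat i p) * \1_`[c, d] p).
    have [_ L2 _] := hc i.
    have := rL1_normc (cL2M L2 (cL2_cind c d)); congr rL1; apply/funext => p.
    by rewrite Normc.normcM normc_real ger0_norm//; have /andP[] := indic01 `[c, d]%classic p.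
  have -> : k = fun p => \sum_i (normc (chat i p) * \1_`[c, d] p) + M * \1_`[c, d] p.
    by apply/funext => p; rewrite /k mulrDl mulr_suml.
  apply: rL1D; last exact/rL1Z/rL1_indic_itv.
  elim: (index_enum _) => [|i r IH].
    by rewrite (_ : (fun p => _) = fun=> 0); [exact: rL10|apply/funext => p; rewrite big_nil].
  rewrite (_ : (fun p => _) = fun p => normc (chat i p) * \1_`[c, d] p +
      \sum_(j <- r) (normc (chat j p) * \1_`[c, d] p)); first exact: rL1D.
  by apply/funext => p; rewrite big_cons.
have bF1 p tau : `|F1 (p, tau)| <= k p * \1_`[0, t] tau.
  rewrite ger0_norm// /F1 /k /= mulrC [leRHS]mulrAC.
  apply: ler_wpM2r; first by have /andP[] := indic01 `[c, d]%classic p.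
  by rewrite mulrC bD.
have Lt := rL1_indic_itv 0 t.
have E : rI (fun p => normc (ci (fun tau => simple_symbol chat tau p)
      - cintegral `[0, t] (fun tau => Phi tau p)) * \1_`[c, d] p) <=
    rI (fun tau => rI (fun p => F1 (p, tau))).
  rewrite -(rI_fubini mF1 Lk Lt bF1).
  have LD p : cL1 (fun tau => D (tau, p)).
    apply: (cL1_le _ (fun tau => bD tau p)).
      exact: (cmeas_comp mD (pair2_measurable p)).
    by under eq_fun do rewrite mulrC; exact: rL1Z.
  have DE p : ci (fun tau => simple_symbol chat tau p) -
      cintegral `[0, t] (fun tau => Phi tau p) = ci (fun tau => D (tau, p)).
    rewrite cintegralE -ciB//; last exact: cL1_Phi1.
    apply: (cL1_le _ (fun tau => simple_symbol_le ss chat tau p)).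
      exact: (cmeas_comp (cmeas_simple_symbol ss hc) (pair2_measurable p)).
    by under eq_fun do rewrite mulrC; exact: rL1Z.
  have bp p : normc (ci (fun tau => simple_symbol chat tau p) -
      cintegral `[0, t] (fun tau => Phi tau p)) * \1_`[c, d] p <= rI (fun tau => F1 (p, tau)).
    rewrite DE /F1 /= rIZ; last exact: rL1_normc.
    rewrite mulrC ler_wpM2l//.
    exact: normc_ci_le.
  have LF := rL1_rI1 mF1 Lk Lt bF1.
  apply: rI_le => //; apply: (rL1_le _ _ LF).
    apply: measurable_funM; last exact: measurable_indic.
    under eq_fun do rewrite DE.
    apply: measurable_normc.
    have mD' : cmeas (fun z : R * R => D (z.2, z.1)).
      apply: (cmeas_comp mD).
      by apply: measurable_fun_pair; [exact: measurable_snd|exact: measurable_fst].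
    exact: (cmeas_ci mD').
  move=> p; rewrite ger0_norm//.
  by rewrite mulr_ge0 ?normc_ge0//; have /andP[] := indic01 `[c, d]%classic p.
have mF1' : measurable_fun setT (fun z : R * R => F1 (z.2, z.1)).
  apply: (measurableT_comp mF1).
  by apply: measurable_fun_pair; [exact: measurable_snd|exact: measurable_fst].
have bF1' tau p : `|F1 (p, tau)| <= \1_`[0, t] tau * k p by rewrite mulrC.
set K := Num.sqrt _.
have K0 : 0 <= K^-1 by rewrite invr_ge0 sqrtr_ge0.
have LE : rL1 (fun tau => K^-1 * rI (fun p => F1 (p, tau))).
  exact: rL1Z (rL1_rI1 mF1' Lt Lk bF1').
apply: (@le_trans _ _ (rI (fun tau => K^-1 * rI (fun p => F1 (p, tau))))%:E).
  rewrite lee_fin rIZ; last exact: (rL1_rI1 mF1' Lt Lk bF1').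
  by rewrite mulrC ler_wpM2l.
rewrite -(rI_EFin LE).
(* Outside [0, t] both the symbol of the simple function and the cut-off [Phi] vanish, so the
   integral over the line reduces to [0, t]. *)
have -> : (\int[mu]_x (K^-1 * rI (fun p => F1 (p, x)))%:E =
    \int[mu]_(x in `[0%R, t]) (K^-1 * rI (fun p => F1 (p, x)))%:E)%E.
  rewrite [RHS]integral_mkcond; apply: eq_integral => x _; rewrite patchE.
  case: ifPn => // xI; congr EFin.
  rewrite (_ : (fun p => F1 (p, x)) = fun=> 0); first by rewrite rI_cst0 mulr0.
  apply/funext => p; rewrite /F1 /D /= (simple_symbol_out ss)// /cind [\1_`[0, t] x]indicE (negbTE xI).
  by rewrite mulr0 subrr Normc.normc0 mulr0.
(* The H^1 error is not known to be measurable in tau; it is bounded below pointwise by a measurable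
   function. *)
apply: ge0_integral_mono => tau tI.
  by rewrite lee_fin mulr_ge0// rI_ge0.
have HI := isFB (HF tau) (isF_simple_val hc tau).
have := sobolev_norm_ge HI cd; rewrite -/K mulrC.
congr (_ <= _)%E; congr (_ * rI _)%:E; apply/funext => p.
rewrite /F1 /D /= /cind [\1_`[0, t] tau]indicE mem_set// mulr1 mulrC; congr (_ * _).
by rewrite normcB.
Qed.

(** On each [c, d] the L^1 distance between the two transforms is bounded, up to the factor [K], by
    quantities tending to 0 along the approximating simple functions. *)
Lemma bochnerH1_unique (G G' : R -> R[i]) :
  isF G (fun p => cintegral `[0, t] (fun tau => Phi tau p)) ->
  is_bochnerH1 t F G' -> ae_eq mu setT G G'.
Proof.
move=> HG [_ [/cL2P LG' _] [s [son _ cint csob]]].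
have HG' := isF_fourier LG'; set g' := fourier G' in HG'.
set g := (fun p => _) in HG.
have [_ Lg _] := HG; have [_ Lg' _] := HG'.
have chatE n i : isF (simple_coef (s := s n) i) (fourier (simple_coef (s := s n) i)).
  by apply: isF_fourier; have [_ _ [/cL2P]] := son n i.
suff E : ae_eq mu setT g g'.
  apply: (isF_injective HG); apply: (isF_ae HG').
  - exact: LG'.1.
  - exact: Lg.1.
  - exact: aeT.
  - by move: E; apply: aeS => p /[apply].
have : ae_eq mu setT (fun p => g p - g' p) (fun=> 0).
  apply: cL2_itv_eq0; first exact: cL2B.
  move=> c d cd.
  set K := Num.sqrt (2 * pi * (d - c)).
  have K0 : 0 < K.
    rewrite sqrtr_gt0; apply: mulr_gt0; last by rewrite subr_gt0.
    by apply: mulr_gt0; [exact: ltr0Sn|exact: pi_gt0].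
  have LI (h : R -> R[i]) : cL2 h -> rL1 (fun p => normc (h p) * \1_`[c, d] p).
    move=> Lh; have := rL1_normc (cL2M Lh (cL2_cind c d)); congr rL1; apply/funext => p.
    by rewrite Normc.normcM normc_real ger0_norm//; have /andP[] := indic01 `[c, d]%classic p.
  apply: Normc.eq0_normc; apply/eqP; rewrite eq_le normc_ge0 andbT.
  have L0 := cL2M (cL2B Lg Lg') (cL2_cind c d).
  apply: (le_trans (normc_ci_le L0)).
  set X := rI _.
  (* [sh] is the transform of the integral of the n-th simple function. Passing through it separates
     the Bochner error, via [simple_int_error], from the H^1 distance to [G'], via
     [sobolev_norm_ge]. *)
  have XK n : ((X / K)%:E <= (\int[mu]_(tau in `[0%R, t]) simple_error F (s n) tau)
      + sobolev_norm 1%N (fun x => (simple_int (s n) x - G' x)%R))%E.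
    pose sh p := ci (fun tau => simple_symbol (fun i => fourier (simple_coef (s := s n) i)) tau p).
    have Hsh : isF (simple_int (s n)) sh := isF_simple_int (son n) (chatE n).
    have [_ Lsh _] := Hsh.
    have e1 := simple_int_error (son n) (chatE n) cd.
    have e2 := sobolev_norm_ge (isFB Hsh HG') cd.
    apply: (le_trans _ (leeD e1 e2)); rewrite -EFinD lee_fin -/K -mulrDl ler_pM2r ?invr_gt0//.
    have L1 := LI _ (cL2B Lsh Lg); have L2 := LI _ (cL2B Lsh Lg').
    rewrite -/sh -rID//; apply: rI_le; [exact: rL1_normc|exact: rL1D|].
    move=> p; rewrite -mulrDl Normc.normcM normc_real ger0_norm; last first.
      by have /andP[] := indic01 `[c, d]%classic p.
    rewrite ler_wpM2r//.
    rewrite (_ : g p - g' p = (g p - sh p) + (sh p - g' p)); last by rewrite addrA subrK.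
    by rewrite (le_trans (ler_normcD _ _))// lerD2r normcB.
  have cv := cvgeD _ cint csob.
  have {}cv := cv _ isT.
  rewrite adde0 in cv; have {}cv := cv eventually_filter.
  have X0 : ((X / K)%:E <= 0)%E.
    rewrite -(cvg_lim _ cv)//; apply: lime_ge; first by apply/cvg_ex; eexists; exact: cv.
    exact: nearW.
  by move: X0; rewrite lee_fin ler_pdivrMr// mul0r.
by apply: aeS => p /[apply] /eqP; rewrite subr_eq0 => /eqP.
Qed.

End BochnerUnique.

(** * Existence of the Bochner integral by step functions *)

Section BochnerExists.
Context {R : realType}.
Local Notation mu := (@lebesgue_measure R).
Variables (t : R) (F Phi : R -> R -> R[i]) (M A B L : R).
Hypotheses (t0 : 0 <= t) (M0 : 0 <= M) (L0 : 0 <= L).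
Hypothesis HF : forall tau, isF (F tau) (Phi tau).
Hypothesis HB : forall tau, bcs M A B (Phi tau).
Hypothesis HL : forall tau sig p,
  normc (Phi tau p - Phi sig p) <= L * `|tau - sig| * \1_`[A, B] p.
Hypothesis Hm : cmeas (fun z : R * R => Phi z.1 z.2).

Definition mesh (n : nat) : R := n.+1%:R^-1.

Definition cell (n i : nat) : set R :=
  `[0, t] `&` [set tau | i%:R * mesh n <= tau < i.+1%:R * mesh n].

(** [Num.bound t] is an integer above [t], so the half-open cells cover [0, t], its right end
    included; cells starting beyond [t] are empty. Each cell takes the value of [F] at its left
    end. *)
Definition step (n : nat) : simpleH1 (R := R) :=
  @SimpleH1 R (Num.bound t * n.+1)%N (fun i => cell n i) (fun i => F (i%:R * mesh n)).

Lemma mesh_gt0 n : 0 < mesh n. Proof. by rewrite invr_gt0. Qed.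

Lemma measurable_cell n i : measurable (cell n i).
Proof.
apply: measurableI; first exact: measurable_itv.
have -> : [set tau | i%:R * mesh n <= tau < i.+1%:R * mesh n] =
    `[i%:R * mesh n, i.+1%:R * mesh n[%classic :> set R.
  by apply/seteqP; split => x /=; rewrite in_itv.
exact: measurable_itv.
Qed.

Lemma simple_on_step n : simple_on `[0, t] (step n).
Proof.
move=> i; split; [exact: measurable_cell|by move=> x []|].
exact: (sobolev1_bcs M0 (HF _) (HB _)).
Qed.

(** Each indicator is a difference of two threshold indicators, so the sum telescopes: the threshold
    0 is passed by tau and the last one is not. *)
Lemma sum_cell n tau : tau \in `[0, t]%classic ->
  \sum_(i < Num.bound t * n.+1) (\1_(cell n i) tau : R) = 1.
Proof.
rewrite inE /= in_itv/= => /andP[tau0 taut].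
pose f (i : nat) : R := - ((i%:R * mesh n <= tau)%R)%:R.
transitivity (\sum_(i < Num.bound t * n.+1) (f i.+1 - f i)).
  apply: eq_bigr => i _; rewrite /f opprK addrC indicE.
  have le1 : i%:R * mesh n <= i.+1%:R * mesh n.
    by rewrite ler_wpM2r ?(ltW (mesh_gt0 n))// ler_nat.
  have [i1|i1] := leP (i.+1%:R * mesh n) tau.
    rewrite (le_trans le1 i1) subrr memNset//= => -[_ /= /andP[_]].
    by rewrite ltNge i1.
  have [i2|i2] := leP (i%:R * mesh n) tau.
    by rewrite subr0 mem_set//=; split => /=; rewrite ?in_itv/= ?tau0 ?taut ?i2 ?i1.
  by rewrite subrr memNset//= => -[_ /= /andP[]]; rewrite leNgt i2.
rewrite -(big_mkord xpredT (fun i => f i.+1 - f i)) telescope_sumr// /f mul0r tau0.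
have -> : ((Num.bound t * n.+1)%N%:R * mesh n <= tau) = false.
  rewrite /mesh natrM mulfK ?pnatr_eq0//; apply/negbTE; rewrite -ltNge.
  exact: (le_lt_trans taut (archi_boundP t0)).
by rewrite oppr0 sub0r opprK.
Qed.

Local Notation ssym n := (@simple_symbol R (step n) (fun i => Phi (i%:R * mesh n))).

(** The cells form a partition of unity on [0, t], so the error is an average of increments of [Phi]
    over distances of at most [mesh n]. *)
Lemma step_error n tau p :
  normc (Phi tau p * cind 0 t tau - ssym n tau p) <=
  (L * mesh n * \1_`[A, B] p) * \1_`[0, t] tau.
Proof.
have [tI|tI] := boolP (tau \in `[0, t]%classic); last first.
  rewrite (simple_symbol_out (@simple_on_step n))// /cind [\1_`[0, t] tau]indicE (negbTE tI).
  by rewrite !mulr0 subrr Normc.normc0.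
have -> : Phi tau p * cind 0 t tau - ssym n tau p =
    \sum_(i < Num.bound t * n.+1) (\1_(cell n i) tau)%:C * (Phi tau p - Phi (i%:R * mesh n) p).
  under [RHS]eq_bigr do rewrite mulrBr.
  rewrite sumrB -mulr_suml /cind [\1_`[0, t] tau]indicE tI; congr (_ - _).
  rewrite mulrC; congr (_ * _).
  rewrite -[in LHS](sum_cell n tI); apply: complexP => /=.
    by rewrite (raddf_sum (@complex.Re R)).
  by rewrite (raddf_sum (@complex.Im R)) big1.
rewrite (le_trans (normc_sum_le _ _))//.
apply: (@le_trans _ _ (\sum_(i < Num.bound t * n.+1) (\1_(cell n i) tau : R) * (L * mesh n * \1_`[A, B] p))).
  apply: ler_sum => i _; rewrite Normc.normcM normc_real.
  have /andP[c0 _] := indic01 (cell n i) tau.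
  rewrite ger0_norm//; have [tc|tc] := boolP (tau \in cell n i); last first.
    by rewrite indicE (negbTE tc) !mul0r.
  rewrite indicE tc !mul1r (le_trans (HL _ _ _))//.
  rewrite ler_wpM2r// ler_wpM2l//.
  move: tc; rewrite inE => -[_ /= /andP[c1 c2]].
  rewrite ger0_norm ?subr_ge0// lerBlDl (le_trans (ltW c2))//.
  by rewrite -natr1 mulrDl mul1r.
by rewrite -mulr_suml sum_cell// mul1r [\1_`[0, t] tau]indicE tI mulr1.
Qed.

Lemma isF_step_val n tau : isF (simple_val (step n) tau) (ssym n tau).
Proof. by apply: isF_simple_val => i; exact: HF. Qed.

Lemma cmeas_ssym n : cmeas (fun z : R * R => ssym n z.1 z.2).
Proof. by apply: (cmeas_simple_symbol (@simple_on_step n)) => i; exact: HF. Qed.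

Lemma step_simple_error n tau : tau \in `[0, t]%classic ->
  (simple_error F (step n) tau <= (L * mesh n * sobK A B)%:E)%E.
Proof.
move=> tI; apply: (sobolev_norm_le (c := A) (d := B) _ (isFB (HF tau) (isF_step_val n tau))).
  by rewrite mulr_ge0// ltW// mesh_gt0.
split.
  apply: cmeasB; first exact: (HB tau).1.
  by have [_ [] ] := isF_step_val n tau.
move=> p; have := step_error n tau p.
by rewrite /cind [\1_`[0, t] tau]indicE tI !mulr1.
Qed.

Definition phint (p : R) : R[i] := cintegral `[0, t] (fun tau => Phi tau p).

Lemma bcs_phint : bcs (M * t) A B phint.
Proof.
have E : phint = fun p => ci (fun tau => Phi tau p * cind 0 t tau).
  by apply/funext => p; rewrite /phint cintegralE.
split.
  rewrite E.
  have mF : cmeas (fun z : R * R => Phi z.2 z.1 * cind 0 t z.2).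
    apply: cmeasM; last by apply: (cmeas_comp (cmeas_cind 0 t)); exact: measurable_snd.
    have msw : measurable_fun setT (fun z : R * R => (z.2, z.1)).
      by apply: measurable_fun_pair; [exact: measurable_snd|exact: measurable_fst].
    exact: (cmeas_comp Hm msw).
  exact: (cmeas_ci mF).
move=> p; have LP := cL1_Phi1 t M0 HB Hm p.
rewrite E (le_trans (normc_ci_le LP))//.
apply: (@le_trans _ _ (rI (fun tau => (M * \1_`[A, B] p) * \1_`[0, t] tau))).
  apply: rI_le; [exact: rL1_normc|exact/rL1Z/rL1_indic_itv|].
  move=> tau; rewrite Normc.normcM normc_real ger0_norm//.
  by rewrite ler_wpM2r//; exact: (HB tau).2.
rewrite rIZ; last exact: rL1_indic_itv.
by rewrite rI_indic_itv// subr0 mulrAC.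
Qed.

(** Each error is at most [mesh n] times a constant: the Lipschitz constant, the factor [sobK], and
    the length [t] when an integral in tau is involved. *)
Lemma bochnerH1_exists (G : R -> R[i]) : isF G phint -> is_bochnerH1 t F G.
Proof.
move=> HG.
have Mt0 : 0 <= M * t by rewrite mulr_ge0.
have meshc (C : R) : (mesh n * C)%:E @[n --> \oo] --> (0%E : \bar R).
  apply: cvg_EFin; first exact: nearW.
  rewrite -[X in _ --> X](mul0r C); apply: cvgM; last exact: cvg_cst.
  exact: cvg_harmonic.
have squeeze (u : nat -> \bar R) (C : R) : (forall n, 0 <= u n)%E ->
    (forall n, u n <= (mesh n * C)%:E)%E -> u n @[n --> \oo] --> 0%E.
  move=> u0 uC; apply: (@squeeze_cvge _ _ _ _ (cst 0%E) _ (fun n => (mesh n * C)%:E)).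
  - by apply: nearW => n; rewrite u0 uC.
  - exact: cvg_cst.
  - exact: meshc.
have E0 n tau : (0 <= simple_error F (step n) tau)%E by exact: sobolev_norm_ge0.
split.
- by move=> tau _; exact: (sobolev1_bcs M0 (HF _) (HB _)).
- exact: (sobolev1_bcs Mt0 HG bcs_phint).
exists step; split.
- exact: simple_on_step.
- apply: aeT => tau tI; apply: (squeeze _ (L * sobK A B)) => // n.
  rewrite mulrCA mulrA.
  by apply: step_simple_error; rewrite inE.
- apply: (squeeze _ (L * sobK A B * t)).
    by move=> n; apply: integral_ge0 => tau _.
  move=> n; apply: (@le_trans _ _ (\int[mu]_(tau in `[0%R, t]) (L * mesh n * sobK A B)%:E)%E).
    by apply: ge0_integral_mono => // tau tI; apply: step_simple_error; rewrite inE.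
  rewrite integral_cst; last exact: measurable_itv.
  rewrite [X in (_ * X)%E](_ : _ = t%:E); last first.
    by rewrite -[in RHS](subr0 t); exact: lebesgue_itv_cc.
  rewrite -EFinM lee_fin le_eqVlt; apply/orP; left; apply/eqP; ring.
- apply: (squeeze _ (L * t * sobK A B)); first by move=> n; exact: sobolev_norm_ge0.
  move=> n.
  (* The distance between the integrals is estimated in frequency: the difference of the transforms
     is the integral in tau of the quantity bounded by [step_error]. *)
  have HI : isF (simple_int (step n)) (fun p => ci (fun tau => ssym n tau p)).
    by apply: (isF_simple_int (@simple_on_step n)) => i; exact: HF.
  have HD := isFB HI HG.
  have := @sobolev_norm_le R _ _ (L * mesh n * t) A B _ HD.
  rewrite (_ : L * mesh n * t * sobK A B = mesh n * (L * t * sobK A B)); last by ring.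
  apply; first by rewrite !mulr_ge0// ltW// mesh_gt0.
  split; first by have [_ []] := HD.
  move=> p; have LP := cL1_Phi1 t M0 HB Hm p.
  have LS : cL1 (fun tau => ssym n tau p).
    apply: (cL1_le _ (fun tau => simple_symbol_le (@simple_on_step n) _ tau p)).
      exact: (cmeas_comp (cmeas_ssym n) (pair2_measurable p)).
    by under eq_fun do rewrite mulrC; exact/rL1Z/rL1_indic_itv.
  rewrite /phint cintegralE -ciB// (le_trans (normc_ci_le (cL1B LS LP)))//.
  apply: (@le_trans _ _ (rI (fun tau => (L * mesh n * \1_`[A, B] p) * \1_`[0, t] tau))).
    apply: rI_le; [exact/rL1_normc/cL1B|exact/rL1Z/rL1_indic_itv|].
    by move=> tau; rewrite normcB; exact: step_error.
  rewrite rIZ; last exact: rL1_indic_itv.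
  by rewrite rI_indic_itv// subr0 mulrAC.
Qed.

End BochnerExists.

(** * The continuous representative *)

Section ContinuousRepresentative.
Context {R : realType}.
Local Notation mu := (@lebesgue_measure R).

(** A nonzero value would persist on a ball, which has positive measure and would lie in a null
    set. *)
Lemma continuous_ae_eq0 (h : R -> R) : continuous h ->
  {ae mu, forall x, h x = 0} -> forall x, h x = 0.
Proof.
move=> ch [N [mN N0 hN]] x; apply/eqP/negP => /negP hx.
have /nbhs_ballP[e /= e0 eh] : \forall y \near x, h y != 0.
  exact: (cvgr_neq0 _ (ch x)).
have : (mu (ball x e) <= mu N)%E.
  apply: le_measure; rewrite ?inE//; first exact: measurable_ball.
  by move=> y /eh hy; apply: hN => /= /eqP; apply/negP.
rewrite N0 lebesgue_measure_ball ?(ltW e0)// lee_fin => e2.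
by move: e0; rewrite -(pmulrn_lgt0 _ (isT : (0 < 2)%N)) ltNge e2.
Qed.

Lemma Cn0_ae_eq (f g : R -> R[i]) : Cn 0 f -> Cn 0 g -> ae_eq mu setT f g -> f = g.
Proof.
move=> /Cn_continuous[f1 f2] /Cn_continuous[g1 g2] fg; apply/funext => x.
apply: complexP; apply/eqP; rewrite -subr_eq0; apply/eqP.
  apply: (@continuous_ae_eq0 (fun x => cRe (f x) - cRe (g x))).
    by move=> y; apply: cvgB; [exact: f1|exact: g1].
  by apply: aeS fg => y /(_ I) ->; rewrite subrr.
apply: (@continuous_ae_eq0 (fun x => cIm (f x) - cIm (g x))).
  by move=> y; apply: cvgB; [exact: f2|exact: g2].
by apply: aeS fg => y /(_ I) ->; rewrite subrr.
Qed.

Lemma continuous_representativeE (f g : R -> R[i]) : Cn 0 g -> ae_eq mu setT f g ->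
  continuous_representative f = g.
Proof.
move=> cg fg.
have [cf ff] : [set g | Cn 0 g /\ ae_eq mu setT f g] (continuous_representative f).
  by apply: xgetPex; exists g.
by apply: Cn0_ae_eq => //; apply: aeI ff fg => x /(_ I) <- /(_ I) ->.
Qed.

Lemma lipschitz_continuous_real (h : R -> R) (L : R) :
  (forall x y, `|h x - h y| <= L * `|x - y|) -> continuous h.
Proof.
move=> hL x; apply/cvgrPdist_le => e e0; near=> y.
rewrite (le_trans (hL _ _))//.
(* [L] may be zero or negative; |L| + 1 is positive and can be divided by. *)
apply: (@le_trans _ _ ((`|L| + 1) * `|x - y|)).
  by rewrite ler_wpM2r// ler_wpDr// ler_norm.
rewrite -ler_pdivlMl ?ltr_wpDl// mulrC.
near: y; have /cvgrPdist_le : (fun y : R => y) @ x --> x by exact: cvg_id.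
by apply; rewrite divr_gt0// ltr_wpDl.
Unshelve. all: by end_near. Qed.

Lemma ifourier_Cn0 (g : R -> R[i]) (M A B : R) : 0 <= M -> bcs M A B g -> Cn 0 (ifourier g).
Proof.
move=> M0 Hg; have [mg gM] := Hg.
have Le x : cL1 (fun p => g p * expi (x * p)).
  apply: (cL1_le _ _ (rL1Z M (rL1_indic_itv A B))) => [|p].
    by apply: cmeasM => //; apply: cmeas_expi; apply: measurable_funM; [exact: measurable_cst|exact: measurable_id].
  by rewrite Normc.normcM normc_expi mulr1 gM.
(* Majorant of the difference quotient in x: [M] bounds [g], |A| + |B| bounds the frequency on the
   support, and 2 comes from [normc_expiB_le]. *)
pose k p : R := (2 * M * (`|A| + `|B|)) * \1_`[A, B] p.
have Lk : rL1 k by exact/rL1Z/rL1_indic_itv.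
pose C : R := normc (((2 * pi)^-1)%:C : R[i]) * rI k.
have lip x y : normc (ifourier g x - ifourier g y) <= C * `|x - y|.
  rewrite /ifourier -mulrBr -ciB// Normc.normcM -mulrA ler_wpM2l ?normc_ge0//.
  rewrite (le_trans (normc_ci_le (cL1B (Le x) (Le y))))//.
  rewrite mulrC -rIZ//; apply: rI_le; [exact/rL1_normc/cL1B|exact: rL1Z|].
  move=> p; rewrite -mulrBr Normc.normcM.
  have [pI|pI] := boolP (p \in `[A, B]%classic); last first.
    by rewrite (bcs_out Hg pI) Normc.normc0 mul0r /k indicE (negbTE pI) !mulr0.
  rewrite /k indicE pI mulr1.
  have pP : `|p| <= `|A| + `|B|.
    move: pI; rewrite mem_setE in_itv/= => /andP[h1 h2].
    have := ler_norm B; have := ler_norm (- A); rewrite normrN.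
    have := normr_ge0 B; have := normr_ge0 A => n1 n2 n3 n4.
    by rewrite ler_norml; apply/andP; split; lra.
  rewrite (_ : `|x - y| * _ = M * (2 * (`|x - y| * (`|A| + `|B|)))); last by ring.
  apply: ler_pM; rewrite ?normc_ge0//; first exact: bcs_le M0 Hg.
  rewrite (le_trans (normc_expiB_le _ _))// ler_wpM2l// -mulrBl normrM.
  by rewrite ler_wpM2l.
move=> h hE; split => //.
apply: (@lipschitz_continuous_real _ C) => x y; apply: le_trans (lip x y).
case: hE => ->.
  rewrite (_ : _ - _ = cRe (ifourier g x - ifourier g y)); first exact: normr_Re_le.
  by rewrite cReD cReN.
rewrite (_ : _ - _ = cIm (ifourier g x - ifourier g y)); first exact: normr_Im_le.
by rewrite cImD cImN.
Qed.

End ContinuousRepresentative.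

(** * Support and frequency representation of the second Dyson-Phillips term *)

Theorem proposition5p1 (R : realType) (k l : nat) (p1 p2 a b : R)
    (u0 uhat V Vhat : R -> R[i])
    (hk : (1 <= k)%N) (hp : p1 < p2) (hab : a < b)
    (hu0 : sobolev 3 u0)
    (huhat : is_fourier u0 uhat)
    (huC : Cn l uhat)
    (husupp : supp uhat `<=` `[p1, p2])
    (hV : cLp 2%:E V)
    (hVhat : is_fourier V Vhat)
    (hVC : Cn k Vhat)
    (hVsupp : supp Vhat `<=` `[a, b]) :
  (forall t : R, 0 <= t -> supp (W Vhat uhat t) `<=` `[p1 + a, p2 + b]) /\
  (forall t x : R, 0 <= t ->
     continuous_representative (S2 V t u0) x =
       (((2 * pi) ^- 2)%:C) *
       cintegral setT (fun p => W Vhat uhat t p * expi (- (t * p ^+ 2) + x * p))).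
Proof.
have [Mu Mu0 Hu] := Cn_bcs (ltW hp) huC husupp.
have [MV MV0 HV] := Cn_bcs (ltW hab) hVC hVsupp.
split=> [t t0|t x t0].
  have cI : closed `[p1 + a, p2 + b]%classic by exact: interval_closed.
  (* The interval is closed, so it is enough to locate the points where [W] is nonzero. *)
  rewrite ((closure_id _).1 cI); apply: closureS.
  move=> p /= /eqP Wp; rewrite [p1 + a]addrC [p2 + b]addrC.
  have [/set_mem//|pI] := boolP (p \in `[a + p1, b + p2]%classic).
  by case: Wp; exact: (W_out MV0 Mu0 (ltW hab) HV Hu).
have {}Fu := (is_fourierP u0 uhat).1 huhat.
have {}FV := (is_fourierP V Vhat).1 hVhat.
pose F tau := S1 (t - tau) (B V (S1 tau u0)).
pose M : R := normc ((- (0 +i* 1) * ((2 * pi)^-1)%:C : R[i])) * (MV * Mu * (b - a)).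
have M0 : 0 <= M.
  apply: mulr_ge0; first exact: normc_ge0.
  by apply: mulr_ge0; rewrite ?mulr_ge0// subr_ge0 ltW.
have HF tau : isF (F tau) (duhamel Vhat uhat t tau).
  exact: (isF_duhamel MV0 Mu0 (ltW hab) HV Hu).
have HB tau : bcs M (a + p1) (b + p2) (duhamel Vhat uhat t tau).
  exact: (duhamel_bcs MV0 Mu0 (ltW hab) HV Hu).
have [L L0 HL] := duhamel_lipschitz MV0 Mu0 (ltW hab) HV Hu t.
have Hm := cmeas_duhamel HV Hu t.
pose g := phint t (duhamel Vhat uhat t).
have Hg : bcs (M * t) (a + p1) (b + p2) g := bcs_phint t0 M0 HB Hm.
have [g1 g2] := bcs_cL12 Hg.
have FG := isF_ifourier g1 g2.
(* [S2] selects some Bochner integral as soon as one exists; [ifourier g] is one, so the selected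
   function satisfies the relation and can be compared with [ifourier g]. *)
have HS : is_bochnerH1 t F (S2 V t u0).
  apply: xgetPex; exists (ifourier g).
  exact: (bochnerH1_exists t0 M0 L0 HF HB HL Hm FG).
have GS := bochnerH1_unique M0 HF HB Hm FG HS.
have Mt0 : 0 <= M * t by rewrite mulr_ge0.
rewrite (continuous_representativeE (ifourier_Cn0 Mt0 Hg) (ae_eq_sym GS)).
have gE p : g p = ((2 * pi)^-1)%:C * (W Vhat uhat t p * expi (- (t * p ^+ 2))).
  exact: (cintegral_duhamel MV0 Mu0 (ltW hab) HV Hu).
(* [g] already contains one factor 1 / (2 pi), from the convolution theorem; a second one comes with
   [ifourier], whence the power -2 of 2 pi in the formula. *)
have WE p : W Vhat uhat t p * expi (- (t * p ^+ 2) + x * p) =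
    (2 * pi)%:C * (g p * expi (x * p)).
  rewrite gE expiD !mulrA [_ * ((2 * pi)^-1)%:C]mulrC inv2piC mul1r.
  by rewrite -!mulrA.
under eq_fun do rewrite WE.
rewrite -/(ci _) ciZ; last exact: cL1_expi.
rewrite /ifourier mulrA; congr (_ * _).
by rewrite -exprVn expr2 rmorphM -mulrA inv2piC mulr1.
Qed.
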